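(* In the integer setting (general or log-concave), for any constant $a>4$ there is a randomized procedure which, given $\gamma\in(0,1)$, outputs a covering schedule $\mathcal I$ with $\mathrm{InvWeight}(\mathcal I)\le a(n+1)\rho$ such that $\Pr[\mathcal I\text{ is proper}]\ge1-\gamma$, and whose cost is $O\bigl(n\rho(\log^2n+\log\frac1\gamma)+n\log q\bigr)$.
   Context: Setup. Let $n\ge2$ be an integer, $\mathcal H=\{0,1,\dots,n\}$. An instance consists of nonnegative counts $c_x$, $x\in\mathcal H$, not all zero, and reals $\beta_{\min}<\beta_{\max}$. Let $Z(\beta)=\sum_xc_xe^{\beta x}$, $\mu_\beta(x)=c_xe^{\beta x}/Z(\beta)$, $q=\log(Z(\beta_{\max})/Z(\beta_{\min}))$ (in cost bounds $q$ stands for $\max\{1,q\}$). The procedure accesses the instance only through an oracle which, on query $\beta\in[\beta_{\min},\beta_{\max}]$, returns an independent sample from $\mu_\beta$; cost is the expected number of oracle calls. The log-concave setting is when the indices with $c_k\ne0$ form a discrete interval $\{i_0,\dots,i_1\}$ and $c_k^2\ge c_{k-1}c_{k+1}$ for $i_0<k<i_1$; set $\rho=e$ there and $\rho=1+\log(n+1)$ in the general integer setting. A segment is a tuple $(\beta,[\sigma^-,\sigma^+],w)$ with $\beta\in[\beta_{\min},\beta_{\max}]$, $\sigma^-\in\mathcal H\cup\{-\infty\}$, $\sigma^+\in\mathcal H\cup\{+\infty\}$, $\sigma^-\le\sigma^+$, $w\in(0,1]$; it is proper if $\mu_\beta(k)\ge w$ for every $k\in\{\sigma^-,\sigma^+\}\cap\mathcal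 H$. A sequence of segments is proper if all its segments are proper, and $\mathrm{InvWeight}(\mathcal I)=\sum_{(\beta,\sigma,w)\in\mathcal I}1/w$. A covering schedule is a sequence of distinct segments $((\beta_i,[\sigma_i^-,\sigma_i^+],w_i))_{i=0}^t$ with $\beta_{\min}=\beta_0<\dots<\beta_t=\beta_{\max}$ and $-\infty=\sigma_0^-<\sigma_0^+=\sigma_1^-<\sigma_1^+=\sigma_2^-<\dots<\sigma_{t-1}^+=\sigma_t^-<\sigma_t^+=+\infty$. *)

(* Defs.v *)
From HB Require Import structures.
From mathcomp Require Import all_boot all_order all_algebra.
From mathcomp Require Import all_classical all_reals all_analysis.

Set Implicit Arguments.
Unset Strict Implicit.
Unset Printing Implicit Defensive.
Import Order.TTheory GRing.Theory Num.Theory.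
Local Open Scope ring_scope.

Inductive setting := General | LogConcave.

Section Gibbs.
Context {R : realType} {n : nat}.
Implicit Types c : 'I_n.+1 -> R.

Definition is_instance c : Prop :=
  (forall x, 0 <= c x) /\ (exists x, c x != 0).

Definition log_concave c : Prop :=
  exists i0 i1 : 'I_n.+1,
    [/\ (i0 <= i1)%N,
        forall k, (c k != 0) = (i0 <= k <= i1)%N &
        forall j k l : 'I_n.+1, j.+1 = k -> k.+1 = l -> (i0 < k < i1)%N ->
          c j * c l <= c k ^+ 2].

Definition in_setting (st : setting) c : Prop :=
  match st with General => True | LogConcave => log_concave c end.

Definition partition_fun c (beta : R) : R :=
  \sum_(x < n.+1) c x * expR (beta * x%:R).

Definition gibbs c (beta : R) (x : 'I_n.+1) : R :=
  c x * expR (beta * x%:R) / partition_fun c beta.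

Definition log_ratio c (bmin bmax : R) : R :=
  ln (partition_fun c bmax / partition_fun c bmin).

End Gibbs.

Definition rho {R : realType} (st : setting) (n : nat) : R :=
  match st with
  | General => 1 + ln n.+1%:R
  | LogConcave => expR 1
  end.

(* (beta, (sigma^-, sigma^+), w) *)
Definition segment (R : realType) : Type := (R * (\bar int * \bar int) * R)%type.

Section Segments.
Context {R : realType}.
Implicit Types (s : segment R) (sch : seq (segment R)).

Definition seg_beta s : R := s.1.1.
Definition seg_lo s : \bar int := s.1.2.1.
Definition seg_hi s : \bar int := s.1.2.2.
Definition seg_weight s : R := s.2.

Definition is_segment (n : nat) (bmin bmax : R) s : Prop :=
  [/\ bmin <= seg_beta s <= bmax,
      seg_lo s = -oo%E \/ (exists k : 'I_n.+1, seg_lo s = (k%:Z)%:E),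
      seg_hi s = +oo%E \/ (exists k : 'I_n.+1, seg_hi s = (k%:Z)%:E),
      (seg_lo s <= seg_hi s)%E &
      0 < seg_weight s <= 1].

Definition proper_segment (n : nat) (c : 'I_n.+1 -> R) s : Prop :=
  forall k : 'I_n.+1, seg_lo s = (k%:Z)%:E \/ seg_hi s = (k%:Z)%:E ->
    seg_weight s <= gibbs c (seg_beta s) k.

Definition proper_segments (n : nat) (c : 'I_n.+1 -> R) sch : Prop :=
  forall s, s \in sch -> proper_segment c s.

Definition InvWeight sch : R := \sum_(s <- sch) (seg_weight s)^-1.

Definition covering_schedule (n : nat) (bmin bmax : R) sch : Prop :=
  if sch is s0 :: sch' then
    let st := last s0 sch' in
    [/\ uniq sch /\ (forall s, s \in sch -> is_segment n bmin bmax s),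
        seg_beta s0 = bmin /\ seg_beta st = bmax,
        seg_lo s0 = -oo%E /\ seg_hi st = +oo%E,
        forall s, s \in sch -> (seg_lo s < seg_hi s)%E &
        path (fun s s' => (seg_beta s < seg_beta s')
                          && (seg_hi s == seg_lo s')) s0 sch']
  else False.

End Segments.

(* A randomized procedure is a possibly infinite decision tree: it can stop
   with an output, toss a fair coin, or query the oracle at an admissible
   inverse temperature.  The tree does not mention the counts, so the only
   access to the instance is through the oracle's answers. *)
CoInductive procedure {R : realType} (n : nat) (bmin bmax : R) : Type :=
| Return of seq (segment R)
| Flip of (bool -> procedure n bmin bmax)
| Query (beta : R) of bmin <= beta <= bmax & ('I_n.+1 -> procedure n bmin bmax).

Section Semantics.
Context {R : realType} {n : nat} {bmin bmax : R}.
Variable c : 'I_n.+1 -> R.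
Implicit Type p : procedure n bmin bmax.

(* Probability that p stops within m steps (coin tosses and queries) with an
   output in E, each query receiving a fresh sample from the Gibbs law. *)
Fixpoint prob_within (m : nat) p (E : set (seq (segment R))) {struct m} : R :=
  match p, m with
  | Return out, _ => \1_E out
  | _, 0%N => 0
  | Flip k, m'.+1 => \sum_(b : bool) 2^-1 * prob_within m' (k b) E
  | @Query _ _ _ _ beta _ k, m'.+1 =>
      \sum_(x < n.+1) gibbs c beta x * prob_within m' (k x) E
  end.

(* Expected number of queries among the first m steps of p. *)
Fixpoint calls_within (m : nat) p {struct m} : R :=
  match p, m with
  | Return _, _ | _, 0%N => 0
  | Flip k, m'.+1 => \sum_(b : bool) 2^-1 * calls_within m' (k b)
  | @Query _ _ _ _ beta _ k, m'.+1 =>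
      1 + \sum_(x < n.+1) gibbs c beta x * calls_within m' (k x)
  end.

(* Both truncations are nondecreasing in m, so the suprema are their limits.
   A run that never stops has no output, hence lies in no event; its queries
   are all counted in the cost. *)
Definition output_prob p (E : set (seq (segment R))) : \bar R :=
  ereal_sup (range (fun m => (prob_within m p E)%:E)).

Definition expected_calls p : \bar R :=
  ereal_sup (range (fun m => (calls_within m p)%:E)).

End Semantics.

(* Main.v *)
(* For a threshold e between two consecutive points of H, let beta_e be the inverse temperature
   at which the masses below e and from e on are balanced. On each side of e some k satisfies
   mu(k) * dist(k, e) >= mass / rho (by the harmonic sum in general, by comparison with a
   geometric sequence in the log-concave case), so beta_e gives a segment across e whose inverse
   weight is about 2 rho times its length. These maximisers are monotone in e. Hence, when the
   uncovered gaps are bisected recursively, the neighbourhoods inspected on one level of the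
   recursion are essentially disjoint, and the total cost is O(n rho log^2 n). If every point is
   covered at most twice, the inverse weights add up to about 4 (n + 1) rho. Two overlapping
   neighbours can be matched at a common endpoint, because one of the two crossing ends is heavy
   at both temperatures. Fresh samples certify the endpoints with confidence gamma, and the
   construction, which succeeds with constant probability, is repeated until this succeeds.

   To find beta_e, note that the odds of the event x >= e grow at least like exp(beta), so that at
   distance d from beta_e a sample falls on the wrong side with probability at most exp(-d). A
   bracket can therefore be found and halved with single samples down to width O(log n), in
   O(log q) expected calls since q >= beta_max - beta_e - ln 2; the remaining O(log n) bisection
   steps use O(log n) samples each. *)

Require Import Defs.
From HB Require Import structures.
From mathcomp Require Import all_boot all_order all_algebra.
From mathcomp Require Import all_classical all_reals all_analysis.
From mathcomp Require Import zify ring lra.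

Set Implicit Arguments.
Unset Strict Implicit.
Unset Printing Implicit Defensive.
Import Order.TTheory GRing.Theory Num.Theory.
Local Open Scope ring_scope.

(** * Decision trees with oracle queries *)

(** Two kinds of guarantee are kept apart. The covering structure and the bound on the inverse
    weight hold on every branch, because a piece gets the weight [2 / (a * rho * length)], fixed by
    its length and not by estimates. Estimates only decide whether these weights are true lower
    bounds, and for that only the last samples matter: an error made before them can at worst make
    the attempt return nothing. So among the sample sizes only that of the certification depends on
    [gamma]; the number of attempts does too, but not the bound on their expected cost. The excess
    of [a] over 4 pays for all approximation errors, through the choice of [eps]. The main obstacle
    is that these errors could compound in the recursion, where the winners of earlier searches
    delimit the window of the next one. A winner is only a maximiser up to a factor [slack], and
    this factor must be inherited unchanged at every depth: passing to another threshold loses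
    nothing, and replacing an incumbent must never lower the true value. *)

(* Bounded decision trees with oracle queries only; [retry] makes the failure probability small
   with finitely many attempts, so neither coin tosses nor unbounded runs are needed. *)
Inductive tree (R : realType) (n : nat) (A : Type) : Type :=
| Ret of A
| Ask of R & ('I_n.+1 -> tree R n A).
Arguments Ret {R n A}.
Arguments Ask {R n A}.

Section Trees.
Context {R : realType} {n : nat}.

Fixpoint bind A B (t : tree R n A) (k : A -> tree R n B) : tree R n B :=
  match t with
  | Ret a => k a
  | Ask b f => Ask b (fun x => bind (f x) k)
  end.

(** A guarantee along every branch, whatever the oracle answers: no kernel occurs in it. It serves
    for the almost sure part of the claim and as an invariant under which costs and errors are
    bounded. *)
Fixpoint sure A (t : tree R n A) (Q : A -> Prop) : Prop :=
  match t with
  | Ret a => Q a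
  | Ask _ f => forall x, sure (f x) Q
  end.

Lemma sure_bind A B (t : tree R n A) (k : A -> tree R n B) P Q :
  sure t P -> (forall a, P a -> sure (k a) Q) -> sure (bind t k) Q.
Proof. by move=> + H; elim: t => [a|b f IH] /=; [exact: H|move=> h x; exact: IH]. Qed.

Lemma sure_imp A (t : tree R n A) (P Q : A -> Prop) :
  sure t P -> (forall a, P a -> Q a) -> sure t Q.
Proof. by move=> + H; elim: t => [a|b f IH] /=; [exact: H|move=> h x; exact: IH]. Qed.

Lemma sure_true A (t : tree R n A) : sure t (fun=> True).
Proof. by elim: t. Qed.

Variable nu : R -> 'I_n.+1 -> R.

Fixpoint Ex A (t : tree R n A) (f : A -> R) : R :=
  match t with
  | Ret a => f a
  | Ask b k => \sum_x nu b x * Ex (k x) f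
  end.

Fixpoint cost A (t : tree R n A) : R :=
  match t with
  | Ret _ => 0
  | Ask b k => 1 + \sum_x nu b x * cost (k x)
  end.

(* The probability that the output violates [Q]. *)
Definition err A (t : tree R n A) (Q : A -> Prop) : R :=
  Ex t (fun a => (~~ `[< Q a >])%:R).

Lemma Ex_bind A B (t : tree R n A) (k : A -> tree R n B) f :
  Ex (bind t k) f = Ex t (fun a => Ex (k a) f).
Proof. by elim: t => //= b g IH; apply: eq_bigr => x _; rewrite IH. Qed.

Hypothesis nu_ge0 : forall b x, 0 <= nu b x.
Hypothesis nu_sum1 : forall b, \sum_x nu b x = 1.

Lemma nu_avg b (m : R) : \sum_x nu b x * m = m.
Proof. by rewrite -mulr_suml nu_sum1 mul1r. Qed.

Lemma Ex_cst A (t : tree R n A) m : Ex t (fun=> m) = m.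
Proof.
elim: t => //= b g IH; rewrite -[RHS](nu_avg b).
by apply: eq_bigr => x _; rewrite IH.
Qed.

Lemma ExD A (t : tree R n A) f g : Ex t (fun a => f a + g a) = Ex t f + Ex t g.
Proof.
elim: t => //= b k IH; rewrite -big_split; apply: eq_bigr => x _.
by rewrite IH mulrDr.
Qed.

Lemma ExZ A (t : tree R n A) m f : Ex t (fun a => m * f a) = m * Ex t f.
Proof.
elim: t => //= b k IH; rewrite mulr_sumr; apply: eq_bigr => x _.
by rewrite IH mulrCA.
Qed.

Lemma Ex_le_sure A (t : tree R n A) (P : A -> Prop) f g :
  sure t P -> (forall a, P a -> f a <= g a) -> Ex t f <= Ex t g.
Proof.
move=> + H; elim: t => [a|b k IH] /=; first exact: H.
by move=> h; apply: ler_sum => x _; apply: ler_wpM2l => //; apply: IH.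
Qed.

Lemma Ex_le A (t : tree R n A) f g : (forall a, f a <= g a) -> Ex t f <= Ex t g.
Proof. by move=> H; apply: (Ex_le_sure (sure_true t)) => a _. Qed.

Lemma Ex_ge0 A (t : tree R n A) f : (forall a, 0 <= f a) -> 0 <= Ex t f.
Proof. by move=> H; rewrite -(Ex_cst t 0); apply: Ex_le. Qed.

Lemma cost_ge0 A (t : tree R n A) : 0 <= cost t.
Proof.
elim: t => //= b k IH; apply: addr_ge0 => //; apply: sumr_ge0 => x _.
exact: mulr_ge0.
Qed.

Lemma cost_bind A B (t : tree R n A) (k : A -> tree R n B) :
  cost (bind t k) = cost t + Ex t (fun a => cost (k a)).
Proof.
elim: t => [a|b g IH] /=; first by rewrite add0r.
rewrite -addrA -big_split; congr (_ + _); apply: eq_bigr => x _.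
by rewrite IH mulrDr.
Qed.

Lemma cost_bind_le A B (t : tree R n A) (k : A -> tree R n B) P m1 m2 :
  sure t P -> cost t <= m1 -> (forall a, P a -> cost (k a) <= m2) ->
  cost (bind t k) <= m1 + m2.
Proof.
move=> hP h1 h2; rewrite cost_bind lerD// -[leRHS](Ex_cst t).
exact: Ex_le_sure hP h2.
Qed.

Lemma err_le1 A (t : tree R n A) Q : err t Q <= 1.
Proof. by rewrite -[leRHS](Ex_cst t); apply: Ex_le => a; case: asbool. Qed.

Lemma err_ge0 A (t : tree R n A) Q : 0 <= err t Q.
Proof. by apply: Ex_ge0. Qed.

Lemma err_sub_sure A (t : tree R n A) (S P Q : A -> Prop) :
  sure t S -> (forall a, S a -> P a -> Q a) -> err t Q <= err t P.
Proof.
move=> hS H; apply: Ex_le_sure hS _ => a Sa; rewrite ler_nat.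
case: (asboolP (Q a)) => // nQ; case: asboolP => // Pa; exfalso; exact/nQ/H.
Qed.

Lemma err_sub A (t : tree R n A) (P Q : A -> Prop) :
  (forall a, P a -> Q a) -> err t Q <= err t P.
Proof. by move=> H; apply: (err_sub_sure (sure_true t)) => a _; exact: H. Qed.

Lemma err_and A (t : tree R n A) (P Q : A -> Prop) :
  err t (fun a => P a /\ Q a) <= err t P + err t Q.
Proof.
rewrite /err -ExD; apply: Ex_le => a; rewrite -natrD ler_nat.
case: (asboolP (P a)) => hP; case: (asboolP (Q a)) => hQ;
  case: asboolP => //= h; by case: h.
Qed.

Lemma err_sure A (t : tree R n A) (Q : A -> Prop) : sure t Q -> err t Q = 0.
Proof.
move=> h; apply/eqP; rewrite eq_le err_ge0 andbT -[leRHS](Ex_cst t).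
by apply: (Ex_le_sure h) => a Qa; rewrite asboolT.
Qed.

Lemma err_bind A B (t : tree R n A) (k : A -> tree R n B) P Q m1 m2 :
  err t P <= m1 -> 0 <= m2 -> (forall a, P a -> err (k a) Q <= m2) ->
  err (bind t k) Q <= m1 + m2.
Proof.
move=> h1 m20 h2; rewrite /err Ex_bind.
apply: (@le_trans _ _ (err t P + m2)); last by rewrite lerD2r.
rewrite -[X in _ + X](Ex_cst t) -ExD; apply: Ex_le => a.
case: asboolP => [Pa|_] /=; first by rewrite add0r; exact: h2.
by apply: (le_trans (err_le1 _ _)); rewrite lerDl.
Qed.

Fixpoint collect A (d : A) (f : nat -> tree R n A) (m : nat) : tree R n (nat -> A) :=
  if m is m'.+1 then
    bind (collect d f m') (fun g => bind (f m') (fun a =>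
      Ret (fun i => if i == m' then a else g i)))
  else Ret (fun=> d).

Lemma err_collect A d (f : nat -> tree R n A) m (Q : nat -> A -> Prop) e :
  0 <= e -> (forall i, (i < m)%N -> err (f i) (Q i) <= e) ->
  err (collect d f m) (fun g => forall i, (i < m)%N -> Q i (g i)) <= m%:R * e.
Proof.
move=> e0; elim: m => [|m IH] H.
  by rewrite mul0r le_eqVlt err_sure ?eqxx.
rewrite -natr1 mulrDl mul1r.
apply: err_bind => //; first by apply: IH => i im; apply: H; rewrite ltnS ltnW.
move=> g hg; rewrite -[e]addr0.
apply: err_bind => //; first exact: H.
move=> a Qa; rewrite le_eqVlt err_sure ?eqxx //= => i.
by rewrite ltnS leq_eqVlt; case: eqVneq => [->|] //= _; exact: hg.
Qed.

Lemma cost_collect A d (f : nat -> tree R n A) m e :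
  (forall i, (i < m)%N -> cost (f i) <= e) -> cost (collect d f m) <= m%:R * e.
Proof.
elim: m => [|m IH] H; first by rewrite mul0r.
rewrite -natr1 mulrDl mul1r; apply: cost_bind_le (sure_true _) _ _.
  by apply: IH => i im; apply: H; rewrite ltnS ltnW.
move=> g _; rewrite -[e]addr0; apply: cost_bind_le (sure_true _) _ _ => //.
exact: H.
Qed.

Lemma err_markov A (t : tree R n A) Q (f : A -> R) :
  (forall a, 0 <= f a) -> (forall a, ~ Q a -> 1 <= f a) -> err t Q <= Ex t f.
Proof.
move=> f0 f1; apply: Ex_le => a; case: asboolP => [_|/f1] //=; exact: f0.
Qed.

Fixpoint retry A (t : tree R n (option A)) (d : A) (m : nat) : tree R n A :=
  if m is m'.+1 then
    bind t (fun o => if o is Some a then Ret a else retry t d m')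
  else Ret d.

Lemma sure_retry A (t : tree R n (option A)) d m (Q : A -> Prop) :
  sure t (fun o => forall a, o = Some a -> Q a) -> Q d -> sure (retry t d m) Q.
Proof.
move=> h hd; elim: m => [|m IH] //=; apply: sure_bind h _ => -[a|] H //=.
exact: H.
Qed.

(** The bound is the fixed point of [x = e + x / 2]: a further attempt follows only after [None],
    which has probability at most 1/2. *)
Lemma cost_retry A (t : tree R n (option A)) d m e :
  cost t <= e -> err t (fun o => o <> None) <= 2^-1 ->
  cost (retry t d m) <= 2 * e.
Proof.
move=> h1 h2; have e0 : 0 <= e := le_trans (cost_ge0 t) h1.
elim: m => [|m IH] /=; first by rewrite mulr_ge0.
rewrite cost_bind.
apply: (@le_trans _ _ (e + 2^-1 * (2 * e))); last by lra.
apply: lerD => //; apply: (@le_trans _ _ ((2 * e) * err t (fun o => o <> None))).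
  rewrite /err -ExZ; apply: Ex_le => -[a|] /=.
    by rewrite asboolT // mulr0.
  by rewrite asboolF ?mulr1 //; case.
by rewrite mulrC ler_wpM2r // mulr_ge0.
Qed.

(** The first hypothesis bounds the joint event of returning something and being wrong, so nothing
    is conditioned on success. Attempt [i] is reached with probability at most [2^-i], whence
    [2 * e]; the last term is the chance of ending with [d]. *)
Lemma err_retry A (t : tree R n (option A)) d m (Q : A -> Prop) e :
  err t (fun o => forall a, o = Some a -> Q a) <= e ->
  err t (fun o => o <> None) <= 2^-1 ->
  err (retry t d m) Q <= 2 * e + 2^-1 ^+ m.
Proof.
move=> h1 h2; have e0 : 0 <= e := le_trans (err_ge0 _ _) h1.
elim: m => [|m IH] /=.
  by rewrite expr0; apply: (le_trans (err_le1 _ _)); rewrite lerDr mulr_ge0.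
rewrite /err Ex_bind.
apply: (@le_trans _ _ (e + (2 * e + 2^-1 ^+ m) * 2^-1)); last by rewrite exprS; lra.
apply: (@le_trans _ _ (e + (2 * e + 2^-1 ^+ m) * err t (fun o => o <> None))); last first.
  by rewrite lerD2l ler_wpM2l // addr_ge0 ?mulr_ge0 // exprn_ge0.
apply: (@le_trans _ _ (err t (fun o => forall a, o = Some a -> Q a) +
   (2 * e + 2^-1 ^+ m) * err t (fun o => o <> None))); last by rewrite lerD2r.
rewrite /err -ExZ -ExD; apply: Ex_le => -[a|] /=.
  rewrite [X in _ + _ * X](_ : _ = 0) ?mulr0 ?addr0; last by rewrite asboolT.
  rewrite ler_nat; case: asboolP => // nQ; case: asboolP => // H; exfalso.
  exact/nQ/H.
rewrite [X in X + _ ](_ : _ = 0) ?add0r; last by rewrite asboolT.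
by rewrite [X in _ * X](_ : _ = 1) ?mulr1 // asboolF //; case.
Qed.

End Trees.

(** * Empirical frequencies *)

Lemma expR_le_quad (R : realType) (t : R) : t <= 4^-1 -> expR t <= 1 + t + t ^+ 2.
Proof.
move=> t4; have [t0|t0] := leP t 0.
  have h : 1 - t <= expR (- t) by rewrite expR_ge1Dx.
  have h1 : expR (- t) * expR t = 1 by rewrite -expRD addNr expR0.
  have h2 : (1 - t) * expR t <= 1 by rewrite -[leRHS]h1 ler_wpM2r // expR_ge0.
  have : (1 - t) * expR t <= (1 - t) * (1 + t + t ^+ 2).
    apply: (le_trans h2); have : t * t ^+ 2 <= 0 by rewrite mulr_le0_ge0 ?sqr_ge0.
    by rewrite !expr2; nra.
  by rewrite ler_pM2l //; lra.
(* For positive [t] the tangent [1 - t] is too weak, since [(1 - t) * (1 + t + t^2) = 1 - t^3].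
   Applied to [t / 2] and squared it suffices up to 1/4. *)
have h : 1 - t / 2 <= expR (- (t / 2)) by rewrite expR_ge1Dx.
have h1 : expR (- (t / 2)) * expR (t / 2) = 1 by rewrite -expRD addNr expR0.
have h2 : (1 - t / 2) * expR (t / 2) <= 1.
  by rewrite -[leRHS]h1 ler_wpM2r // expR_ge0.
have -> : expR t = expR (t / 2) * expR (t / 2) by rewrite -expRD -splitr.
set y := expR (t / 2) in h1 h2 *.
have y0 : 0 < y by rewrite expR_gt0.
have h3 : (1 - t / 2) ^+ 2 * (y * y) <= 1.
  have -> : (1 - t / 2) ^+ 2 * (y * y) = ((1 - t / 2) * y) ^+ 2.
    by rewrite exprMn expr2 [in RHS]expr2 -!expr2.
  by rewrite expr_le1 // mulr_ge0 ?(ltW y0) //; lra.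
have h4 : 1 <= (1 - t / 2) ^+ 2 * (1 + t + t ^+ 2).
  have -> : (1 - t / 2) ^+ 2 * (1 + t + t ^+ 2) =
    1 + t ^+ 2 * (4^-1 * (1 - 3 * t + t ^+ 2)) by field.
  rewrite lerDl mulr_ge0 ?sqr_ge0 // mulr_ge0 //.
  have := sqr_ge0 t; lra.
have := le_trans h3 h4; rewrite ler_pM2l // exprn_gt0 //; lra.
Qed.

Section Sampling.
Context {R : realType} {n : nat}.

Fixpoint sample (N : nat) (b : R) : tree R n (seq 'I_n.+1) :=
  if N is N'.+1 then Ask b (fun x => bind (sample N' b) (fun s => Ret (x :: s)))
  else Ret [::].

Definition freq (N : nat) (P : pred 'I_n.+1) (xs : seq 'I_n.+1) : R :=
  (count P xs)%:R / N%:R.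

Variable nu : R -> 'I_n.+1 -> R.
Hypothesis nu_ge0 : forall b x, 0 <= nu b x.
Hypothesis nu_sum1 : forall b, \sum_x nu b x = 1.

Definition mass b (P : pred 'I_n.+1) : R := \sum_(x | P x) nu b x.

Lemma mass_ge0 b P : 0 <= mass b P.
Proof. exact: sumr_ge0. Qed.

Lemma cost_sample N b : cost nu (sample N b) = N%:R.
Proof.
elim: N => //= N IH; rewrite -natr1 addrC; congr (_ + _).
rewrite -[RHS](nu_avg nu_sum1 b); apply: eq_bigr => x _; congr (_ * _).
rewrite cost_bind // IH -[RHS]addr0; congr (_ + _); exact: Ex_cst.
Qed.

(** A sample contributes [1 + p * (expR t - 1)], where [p] is the mass of [P]; [expR_le_quad] and
    [1 + x <= expR x] bound this by [expR (p * (t + t^2))]. *)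
Lemma moment_sample N b (P : pred 'I_n.+1) t : t <= 4^-1 ->
  Ex nu (sample N b) (fun xs => expR (t * (count P xs)%:R)) <=
  expR (N%:R * (mass b P * (t + t ^+ 2))).
Proof.
move=> t4; have p0 := mass_ge0 b P; set m := mass b P * _.
elim: N => [|N IH] /=; first by rewrite mulr0 mul0r.
have H x : Ex nu (bind (sample N b) (fun s => Ret (x :: s)))
     (fun xs => expR (t * (count P xs)%:R)) =
   expR (t * (P x)%:R) *
   Ex nu (sample N b) (fun xs => expR (t * (count P xs)%:R)).
  rewrite Ex_bind -ExZ; congr Ex; apply: boolp.funext => s /=.
  by rewrite natrD mulrDr expRD.
under eq_bigr => x _ do rewrite H mulrA.
rewrite -mulr_suml -natr1 addrC mulrDl mul1r expRD.
apply: ler_pM => //.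
- by apply: sumr_ge0 => x _; rewrite mulr_ge0 ?expR_ge0.
- by apply: Ex_ge0 => // a; rewrite expR_ge0.
apply: (@le_trans _ _ (1 + m)); last by rewrite expR_ge1Dx.
rewrite -[X in _ <= X + m](nu_sum1 b) /m /mass mulr_suml.
rewrite [X in _ <= _ + X]big_mkcond -big_split /=.
apply: ler_sum => x _; case: (P x) => /=.
  rewrite mulr1 -[X in _ <= X + _]mulr1 -mulrDr ler_wpM2l //.
  by rewrite addrA expR_le_quad.
by rewrite mulr0 expR0 mulr1 addr0.
Qed.

(** A multiplicative Chernoff bound, with the error frozen at [e * w] for masses below [w], where a
    relative error would need too many samples. *)
Lemma freq_deviation N b (P : pred 'I_n.+1) w e :
  (0 < N)%N -> 0 < w -> 0 < e <= 2^-1 ->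
  err nu (sample N b) (fun xs => `|freq N P xs - mass b P| <=
                                 e * Num.max (mass b P) w)
  <= 2 * expR (- (N%:R * w * e ^+ 2 / 4)).
Proof.
move=> N0 w0 /andP[e0 e1].
set p := mass b P; set M := Num.max p w.
have p0 : 0 <= p := mass_ge0 b P.
have pM : p <= M by rewrite le_max lexx.
have wM : w <= M by rewrite le_max lexx orbT.
have N0' : 0 < N%:R :> R by rewrite ltr0n.
(* Both tails at once, with [t = e / 2] and [t = - (e / 2)]. The exponent per sample is
   [e^2 / 4 * (p - 2 * M)], and [M] bounds both [p] and [w]. *)
have tail (t : R) : t ^+ 2 = (e / 2) ^+ 2 -> t <= 4^-1 ->
    err nu (sample N b) (fun xs => t * (freq N P xs - p) <= e / 2 * (e * M)) <=
    expR (- (N%:R * w * e ^+ 2 / 4)).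
  move=> t2 t4.
  apply: (@le_trans _ _ (Ex nu (sample N b) (fun xs =>
     expR (- (N%:R * (t * p + e / 2 * (e * M)))) *
       expR (t * (count P xs)%:R)))).
    apply: err_markov => // xs /negP; rewrite -ltNge => h.
    rewrite -expRD -[leLHS]expR0 ler_expR.
    have -> : (count P xs)%:R = N%:R * freq N P xs :> R.
      by rewrite /freq mulrC divfK // gt_eqF.
    have : 0 <= N%:R * (t * (freq N P xs - p) - e / 2 * (e * M)).
      by rewrite mulr_ge0 // ?subr_ge0 ltW.
    lra.
  rewrite ExZ; apply: (le_trans (ler_wpM2l (expR_ge0 _) (moment_sample _ _ _ t4))).
  rewrite -expRD ler_expR t2 -/p.
  have : 0 <= N%:R * (e ^+ 2 / 4 * (M - w) + e ^+ 2 / 4 * (M - p)).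
    by rewrite mulr_ge0 ?ler0n // -mulrDr mulr_ge0 ?divr_ge0 ?sqr_ge0 //; lra.
  rewrite expr2; lra.
have h1 := tail (e / 2) erefl ltac:(lra).
have h2 := tail (- (e / 2)) (sqrrN _) ltac:(lra).
apply: le_trans _ (_ : expR _ + expR _ <= _); last by rewrite mulr2n mulrDl mul1r.
apply: le_trans (lerD h1 h2); apply: le_trans (err_and nu_ge0 _ _ _).
apply: err_sub => // xs [h3 h4]; rewrite ler_norml.
have e20 : 0 < e / 2 by lra.
rewrite mulNr -mulrN ler_pM2l // in h4; rewrite ler_pM2l // in h3; lra.
Qed.

Lemma err_forall A (T : finType) (t : tree R n A) (Q : T -> A -> Prop) d :
  (forall i, err nu t (Q i) <= d) ->
  err nu t (fun a => forall i, Q i a) <= #|T|%:R * d.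
Proof.
move=> H.
have -> : (fun a => forall i, Q i a) = (fun a => forall i, i \in enum T -> Q i a).
  apply: boolp.funext => a; apply: boolp.propext; split => [h i _|h i]; first exact: h.
  by apply: h; rewrite mem_enum.
rewrite cardE; elim: (enum T) => [|i s IH].
  by rewrite mul0r le_eqVlt err_sure ?eqxx //; apply: sure_imp (sure_true t) _.
rewrite /= -natr1 mulrDl mul1r addrC.
apply: le_trans (lerD (H i) IH); apply: le_trans (err_and nu_ge0 _ _ _).
apply: err_sub => // a [h1 h2] j; rewrite inE => /predU1P[->|]; [exact: h1|exact: h2].
Qed.

Definition accurate N b w e (xs : seq 'I_n.+1) : Prop :=
  forall k, `|freq N (pred1 k) xs - nu b k| <= e * Num.max (nu b k) w.

Lemma mass_pred1 b k : mass b (pred1 k) = nu b k.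
Proof. by rewrite /mass big_pred1_eq. Qed.

Lemma err_accurate N b w e : (0 < N)%N -> 0 < w -> 0 < e <= 2^-1 ->
  err nu (sample N b) (accurate N b w e) <=
  n.+1%:R * (2 * expR (- (N%:R * w * e ^+ 2 / 4))).
Proof.
move=> N0 w0 e01; rewrite -[X in X%:R * _](card_ord n.+1).
apply: err_forall => k; rewrite -mass_pred1; exact: freq_deviation.
Qed.

End Sampling.

(** * Maximal weighted terms of a sequence *)

Section SumBounds.
Context {R : realType}.

Lemma harmonic_le_ln m : \sum_(1 <= j < m.+2) (j%:R)^-1 <= 1 + ln m.+1%:R :> R.
Proof.
elim: m => [|m IH]; first by rewrite big_nat1 invr1 ln1 addr0.
rewrite big_nat_recr //=; apply: le_trans (lerD IH (lexx _)) _.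
rewrite -addrA lerD2l.
have h0 : 0 < m.+1%:R :> R by rewrite ltr0n.
have h1 : 0 < m.+2%:R :> R by rewrite ltr0n.
suff : (m.+2%:R : R)^-1 <= - ln (m.+1%:R / m.+2%:R).
  by rewrite ln_div ?posrE // opprB -lerBrDl.
have -> : (m.+1%:R : R) / m.+2%:R = 1 + (- m.+2%:R^-1).
  apply: (mulIf (lt0r_neq0 h1)).
  by rewrite mulrDl mul1r mulNr mulVf ?divfK ?lt0r_neq0 // -[m.+2%:R]natr1 addrK.
rewrite lerNr; apply: le_ln1Dx; rewrite ltrN2 invf_lt1 // ltr1n //.
Qed.

Lemma harmonic_sum_bound (b : nat -> R) (m : nat) (M : R) :
  (forall j, (1 <= j <= m)%N -> j%:R * b j <= M) -> 0 <= M ->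
  \sum_(1 <= j < m.+1) b j <= (1 + ln m%:R) * M.
Proof.
case: m => [|m] H M0.
  by rewrite big_geq // mulr_ge0 // ln0 ?addr0.
apply: (@le_trans _ _ ((\sum_(1 <= j < m.+2) (j%:R)^-1) * M)); last first.
  by rewrite ler_wpM2r // harmonic_le_ln.
rewrite mulr_suml big_seq [leRHS]big_seq; apply: ler_sum => j.
rewrite mem_index_iota => jm; have j0 : 0 < j%:R :> R by rewrite ltr0n; case/andP: jm.
by rewrite -(ler_pM2l j0) mulrA divff ?gt_eqF // mul1r H.
Qed.

Lemma geometric_sum_le (r : R) m : 0 <= r < 1 -> \sum_(0 <= j < m) r ^+ j <= (1 - r)^-1.
Proof.
move=> /andP[r0 r1]; have h : 0 < 1 - r by lra.
rewrite -(ler_pM2l h) divff ?gt_eqF // big_mkord.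
have := subrX1 r m; move/(congr1 -%R); rewrite opprB -mulNr opprB => <-.
by rewrite gerBl exprn_ge0.
Qed.

(* A log-concave sequence lies below a geometric one with ratio [r] touching it at a
   maximiser [s] of [j * b j]; [r] can be taken between [(s-1)/s] and [s/(s+1)]. *)
Lemma tangent_bound (s : nat) (r : R) : (0 < s)%N ->
  (s.-1)%:R / s%:R <= r -> r <= s%:R / s.+1%:R ->
  1 <= expR 1 * s%:R * (r ^+ s.-1 * (1 - r)).
Proof.
case: s => // s _; rewrite [s.+1.-1]/=.
have s0 : 0 < s.+1%:R :> R by rewrite ltr0n.
have s1 : 0 < s.+2%:R :> R by rewrite ltr0n.
rewrite ler_pdivrMr // ler_pdivlMr // => h1 h2.
have e1 : 2 <= expR 1 :> R by have := expR_ge1Dx (1 : R); lra.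
have hs2 : s.+2%:R = s%:R + 2 :> R by rewrite -addn2 natrD.
have hs1 : s.+1%:R = s%:R + 1 :> R by rewrite -addn1 natrD.
have ps : 0 <= s%:R :> R by rewrite ler0n.
rewrite hs2 hs1 in h2 h1 *.
case: s => [|s] in s0 s1 hs2 hs1 h1 h2 ps *.
  rewrite expr0 mul1r add0r; nra.
have r0 : 0 < r.
  have : 0 < s.+1%:R :> R by rewrite ltr0n.
  nra.
have r1 : r < 1 by nra.
set t := s.+1%:R in hs2 hs1 h1 h2 ps *.
have t0 : 0 < t by rewrite ltr0n.
have x0 : 0 < 1 - r by lra.
(* Both estimates are instances of [1 + x <= expR x]. The sum of the exponents is convex in [r] and
   equals 1 at both ends of the allowed range. *)
have k1 : r^-1 <= expR ((1 - r) / r).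
  apply: le_trans (expR_ge1Dx _).
  by rewrite le_eqVlt; apply/orP; left; apply/eqP; field; lra.
have k2 : ((1 - r) * (t + 1))^-1 <= expR (((1 - r) * (t + 1))^-1 - 1).
  by apply: le_trans (expR_ge1Dx _); lra.
have k3 : r^-1 ^+ s.+1 <= expR (t * ((1 - r) / r)).
  by rewrite expRM_natl lerXn2r // nnegrE ?invr_ge0 ?expR_ge0 // ltW.
have k4 : r^-1 ^+ s.+1 * ((1 - r) * (t + 1))^-1 <= expR 1.
  apply: (@le_trans _ _ (expR (t * ((1 - r) / r)) * expR (((1 - r) * (t + 1))^-1 - 1))).
    by apply: ler_pM => //; rewrite ?invr_ge0 ?exprn_ge0 ?invr_ge0 ?mulr_ge0 //; lra.
  rewrite -expRD ler_expR.
  have xt : 0 < (1 - r) * (t + 1) by rewrite mulr_gt0 //; lra.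
  have -> : t * ((1 - r) / r) + (((1 - r) * (t + 1))^-1 - 1) =
    (t * (1 - r) ^+ 2 * (t + 1) + r - (1 - r) * (t + 1) * r) / (r * ((1 - r) * (t + 1))).
    field; lra.
  have z0 : 0 < r * ((1 - r) * (t + 1)) by rewrite mulr_gt0.
  by rewrite ler_pdivrMr //; rewrite mul1r expr2; nra.
have rp : 0 < r ^+ s.+1 by rewrite exprn_gt0.
move: k4; rewrite exprVn -invfM.
rewrite -[_^-1]mul1r ler_pdivrMr; last by rewrite !mulr_gt0 //; lra.
by rewrite -/t => /le_trans; apply; rewrite le_eqVlt; apply/orP; left; apply/eqP; ring.
Qed.

(** If [s] maximises [j * b j], then [b j <= b s * r^(j - s)] on both sides of [s] for a suitable
    [r]. The sum is thus at most [b s * r^(1 - s) / (1 - r)], and [tangent_bound] turns this into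
    [expR 1 * (s * b s)]. *)
Lemma geometric_sum_bound (b : nat -> R) (m : nat) (M : R) :
  (forall j, 0 <= b j) ->
  (forall j, b j * b j.+2 <= b j.+1 ^+ 2) ->
  (forall i j k, (i <= j <= k)%N -> 0 < b i -> 0 < b k -> 0 < b j) ->
  b m.+1 = 0 ->
  (forall j, (1 <= j <= m)%N -> j%:R * b j <= M) -> 0 <= M ->
  \sum_(1 <= j < m.+1) b j <= expR 1 * M.
Proof.
move=> b0 blc bint bend bM M0.
(* The maximum is taken up to [m.+1], where [b] vanishes: if [b s > 0] then [s <= m], and [s.+1] is
   still available for comparison. *)
have [s sm smax] : exists2 s, (1 <= s <= m.+1)%N &
    forall j, (1 <= j <= m.+1)%N -> j%:R * b j <= s%:R * b s.
  elim: {bM bend} m.+1 (ltn0Sn m) => // k IH _.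
  case: k IH => [|k] IH.
    by exists 1%N => // j; case: j => [|[|]].
  have [s /andP[s1 sk] smax] := IH (ltn0Sn k).
  have [h|h] := leP (k.+2%:R * b k.+2) (s%:R * b s).
    exists s => [|j jk]; first by lia.
    by have [->//|jk2] := eqVneq j k.+2; apply: smax; lia.
  exists k.+2 => [|j jk]; first by lia.
  have [->//|jk2] := eqVneq j k.+2.
  by apply: ltW; apply: le_lt_trans h; apply: smax; lia.
have [s1 s2] := andP sm.
have s0 : 0 < s%:R :> R by rewrite ltr0n.
have [bs|bs] := leP (b s) 0.
  rewrite (@le_trans _ _ 0) ?mulr_ge0 ?expR_ge0 // big_seq.
  apply: sumr_le0 => j; rewrite mem_index_iota ltnS => /andP[j1 j2].
  have h := smax j; rewrite j1 ltnW ?ltnS // in h; have {}h := h isT.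
  have j0 : 0 < j%:R :> R by rewrite ltr0n.
  have : s%:R * b s <= 0 by rewrite pmulr_rle0.
  by move=> /(le_trans h); rewrite pmulr_rle0.
have sm' : (s <= m)%N.
  by move: s2; rewrite leq_eqVlt => /predU1P[sE|//]; rewrite sE bend ltxx in bs.
have bsM : s%:R * b s <= M by apply: bM; rewrite s1.
(* [r] must be at least the ratio of [b] after [s], at most the ratio before [s], and in the range
   of [tangent_bound]. By log-concavity and the maximality of [s] the larger of the two lower ends
   satisfies everything. *)
pose r := Num.max (b s.+1 / b s) (s.-1%:R / s%:R).
have r1 : s.-1%:R / s%:R <= r by rewrite le_max lexx orbT.
have sS0 : 0 < s.+1%:R :> R by rewrite ltr0n.
have r2 : r <= s%:R / s.+1%:R.
  rewrite ge_max; apply/andP; split.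
    rewrite ler_pdivrMr // mulrAC ler_pdivlMr // mulrC smax //.
  rewrite ler_pdivrMr // mulrAC ler_pdivlMr // -!natrM ler_nat.
  by case: (s) s1 => //= k _; lia.
have r0 : 0 <= r by apply: le_trans r1; rewrite divr_ge0.
have r3 : r < 1 by apply: le_lt_trans r2 _; rewrite ltr_pdivrMr // mul1r ltr_nat.
have bS : b s.+1 <= r * b s by rewrite -ler_pdivrMr // le_max lexx.
have bP : (1 < s)%N -> r * b s.-1 <= b s.
  move=> s12; rewrite /r maxr_pMl //; rewrite ge_max; apply/andP; split.
    rewrite mulrAC ler_pdivrMr // mulrC -expr2.
    by have := blc s.-1; rewrite prednK.
  rewrite mulrAC ler_pdivrMr // [b s * _]mulrC smax //.
  by clear -s12 s2; lia.
have up k : b (s + k.+1)%N <= r * b (s + k)%N.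
  elim: k => [|k IH]; first by rewrite addn0 addn1.
  have := blc (s + k)%N; rewrite -!addnS => h.
  have [bk|bk] := leP (b (s + k.+1)%N) 0.
    have bk0 : b (s + k.+1)%N = 0 by apply/eqP; rewrite eq_le bk b0.
    rewrite bk0 mulr0 leNgt; apply/negP => h'.
    have := bint s (s + k.+1)%N (s + k.+2)%N; rewrite bk0 ltxx => H.
    by have : false by apply: H => //; rewrite leq_addr leq_add2l /=.
  have bk' : 0 < b (s + k)%N.
    by apply: (bint s _ (s + k.+1)%N) => //; rewrite leq_addr leq_add2l /=.
  rewrite -(ler_pM2l bk'); apply: (le_trans h); rewrite expr2 mulrCA mulrA.
  by rewrite ler_wpM2r.
have dn k : (k < s)%N -> b (s - k)%N * r ^+ k <= b s.
  elim: k => [|k IH] ks; first by rewrite subn0 expr0 mulr1.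
  have [bk|bk] := leP (b (s - k.+1)%N) 0.
    by apply: (@le_trans _ _ 0) => //; rewrite mulr_le0_ge0 ?exprn_ge0.
  have : r * b (s - k.+1)%N <= b (s - k)%N.
    elim: k ks bk {IH} => [|k IH] ks bk; first by rewrite subn1 subn0; apply: bP.
    have bk1 : 0 < b (s - k.+1)%N.
      by apply: (bint (s - k.+2)%N _ s) => //; rewrite leq_subr leq_sub2l.
    have h := IH (ltnW ks) bk1.
    have := blc (s - k.+2)%N.
    rewrite (subnSK (ltnW ks)) (subnSK (ltnW (ltnW ks))) => h'.
    rewrite -(ler_pM2l bk1) -[X in _ <= X]expr2.
    apply: le_trans h'; rewrite [X in _ <= X]mulrC mulrCA mulrA.
    by rewrite ler_wpM2r.
  move=> h; apply: le_trans (IH (ltnW ks)).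
  by rewrite exprS mulrA [X in X * _]mulrC ler_wpM2r // exprn_ge0.
(* Free of negative powers, because [r] is 0 when [s = 1] and [b 2 = 0]. *)
have key j : (1 <= j)%N -> b j * r ^+ s.-1 <= b s * r ^+ j.-1.
  move=> j1; have [js|js] := leqP s j.
    have -> : j.-1 = (s.-1 + (j - s))%N by clear -s1 js; lia.
    rewrite exprD [X in _ <= b s * X]mulrC mulrA ler_wpM2r ?exprn_ge0 //.
    rewrite -{1}(subnKC js); elim: (j - s)%N => [|k IH].
      by rewrite addn0 expr0 mulr1.
    by apply: le_trans (up k) _; rewrite exprS mulrCA ler_wpM2l.
  have := dn (s - j)%N; rewrite subKn ?(ltnW js) // => h.
  have -> : s.-1 = ((s - j) + j.-1)%N by clear -j1 js; lia.
  by rewrite exprD mulrA ler_wpM2r ?exprn_ge0 // h //; clear -j1 js; lia.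
have tb := tangent_bound s1 r1 r2.
have r4 : 0 < 1 - r by lra.
have sum_le : r ^+ s.-1 * \sum_(1 <= j < m.+1) b j <= b s * (1 - r)^-1.
  apply: le_trans (_ : b s * \sum_(0 <= j < m) r ^+ j <= _); last first.
    by rewrite ler_wpM2l ?(ltW bs) // geometric_sum_le // r0.
  rewrite !mulr_sumr big_add1 /=; apply: ler_sum => j _.
  by rewrite mulrC key.
have S0 : 0 <= \sum_(1 <= j < m.+1) b j by exact: sumr_ge0.
apply: (@le_trans _ _ (expR 1 * (s%:R * b s))); last by rewrite ler_wpM2l ?expR_ge0.
apply: (@le_trans _ _ (expR 1 * s%:R * (r ^+ s.-1 * (1 - r)) *
   \sum_(1 <= j < m.+1) b j)); first by rewrite ler_peMl.
rewrite -!mulrA ler_wpM2l ?expR_ge0 // ler_wpM2l ?ler0n //.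
by rewrite mulrCA mulrC -ler_pdivlMr.
Qed.

End SumBounds.

(** * Gibbs distributions *)

Section GibbsFacts.
Import numFieldNormedType.Exports.
Context {R : realType} {n : nat}.
Variable c : 'I_n.+1 -> R.
Hypothesis c_inst : is_instance c.

Lemma partition_fun_gt0 b : 0 < partition_fun c b.
Proof.
have [c0 [x cx]] := c_inst.
rewrite /partition_fun (bigD1 x) //= ltr_wpDr //.
  by apply: sumr_ge0 => y _; rewrite mulr_ge0 ?expR_ge0.
by rewrite mulr_gt0 ?expR_gt0 // lt_neqAle eq_sym cx c0.
Qed.

Lemma gibbs_ge0 b x : 0 <= gibbs c b x.
Proof.
by rewrite /gibbs divr_ge0 ?mulr_ge0 ?expR_ge0 ?(ltW (partition_fun_gt0 _)) //; case: c_inst.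
Qed.

Lemma gibbs_sum1 b : \sum_x gibbs c b x = 1.
Proof. by rewrite -mulr_suml divff // gt_eqF // partition_fun_gt0. Qed.

(** Both products contain the same two partition functions, so only the exponential factors
    differ. *)
Lemma gibbs_cross b b' k l :
  gibbs c b' k * gibbs c b l =
  expR ((b' - b) * (k%:R - l%:R)) * (gibbs c b k * gibbs c b' l).
Proof.
rewrite /gibbs.
have -> : expR (b' * k%:R) = expR ((b' - b) * (k%:R - l%:R)) * expR (b * k%:R) *
    expR (b' * l%:R) / expR (b * l%:R).
  by rewrite -expRN -!expRD; congr expR; ring.
have h := partition_fun_gt0 b; have h' := partition_fun_gt0 b'.
by have h2 := expR_gt0 (b * l%:R); field; rewrite !gt_eqF.
Qed.

Definition tail b (e : nat) : R := mass (gibbs c) b (fun x : 'I_n.+1 => (e <= x)%N).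

Lemma tail_compl b e : 1 - tail b e = mass (gibbs c) b (fun x : 'I_n.+1 => (x < e)%N).
Proof.
rewrite -(gibbs_sum1 b) (bigID (fun x : 'I_n.+1 => (e <= x)%N)) /=.
rewrite addrAC subrr add0r; apply: eq_bigl => x; by rewrite ltnNge.
Qed.

Lemma tail_ge0 b e : 0 <= tail b e.
Proof. by apply: sumr_ge0 => x _; exact: gibbs_ge0. Qed.

Lemma tail_le1 b e : tail b e <= 1.
Proof.
by rewrite -subr_ge0 tail_compl; apply: sumr_ge0 => x _; exact: gibbs_ge0.
Qed.

Lemma tail_anti b e e' : (e <= e')%N -> tail b e' <= tail b e.
Proof.
move=> ee; rewrite /tail /mass [leRHS](bigID (fun x : 'I_n.+1 => (e' <= x)%N)) /=.
rewrite -[leLHS]addr0 lerD //; last by apply: sumr_ge0 => x _; exact: gibbs_ge0.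
rewrite le_eqVlt; apply/orP; left; apply/eqP; apply: eq_bigl => x.
by case: (leqP e' x) => //=; rewrite ?andbF // andbT => /(leq_trans ee).
Qed.

(** Sum [gibbs_cross] over the pairs [l < e <= k], for which [1 <= k - l <= n]. The odds are
    compared through cross products because a tail may be 0 or 1. *)
Lemma tail_odds b b' e : b <= b' ->
  expR (b' - b) * (tail b e * (1 - tail b' e)) <= tail b' e * (1 - tail b e) /\
  tail b' e * (1 - tail b e) <= expR (n%:R * (b' - b)) * (tail b e * (1 - tail b' e)).
Proof.
move=> bb; rewrite !tail_compl /tail /mass !mulr_suml !mulr_sumr.
split; apply: ler_sum => k ke; rewrite !mulr_sumr; apply: ler_sum => l le;
  rewrite [gibbs c b' k * _]gibbs_cross
    (ler_wpM2r (mulr_ge0 (gibbs_ge0 b k) (gibbs_ge0 b' l))) // ler_expR.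
- rewrite ler_peMr ?subr_ge0 // lerBrDr.
  by rewrite addrC natr1 ler_nat (leq_trans le).
- rewrite mulrC ler_wpM2r ?subr_ge0 // lerBlDr (le_trans (_ : _ <= n%:R)) ?lerDl //.
  by rewrite ler_nat -ltnS ltn_ord.
Qed.

Lemma tail_mono b b' e : b <= b' -> tail b e <= tail b' e.
Proof.
move=> bb; have [h _] := tail_odds e bb.
have h1 : 1 <= expR (b' - b) by rewrite -expR0 ler_expR subr_ge0.
have h2 : 0 <= tail b e * (1 - tail b' e).
  by rewrite mulr_ge0 ?tail_ge0 ?subr_ge0 ?tail_le1.
have := ler_peMl h2 h1; lra.
Qed.

Lemma tail_decay_hi b b' e : b <= b' -> 2^-1 <= tail b e ->
  1 - tail b' e <= expR (- (b' - b)).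
Proof.
move=> bb h; have [h1 _] := tail_odds e bb.
have t0 := tail_ge0 b e; have t1 := tail_le1 b' e; have t2 := tail_ge0 b' e.
rewrite expRN -[leRHS]mul1r ler_pdivlMr ?expR_gt0 // mulrC.
have E := expR_gt0 (b' - b).
set E' := expR _ in h1 E *.
have g0 : 0 <= E' * (1 - tail b' e) by rewrite mulr_ge0 ?subr_ge0 // ltW.
have : tail b e * (E' * (1 - tail b' e)) <= tail b' e * tail b e.
  rewrite mulrCA; apply: le_trans h1 _; rewrite ler_wpM2l //; lra.
rewrite [X in _ <= X]mulrC ler_pM2l; lra.
Qed.

Lemma tail_decay_lo b b' e : b <= b' -> tail b' e <= 2^-1 ->
  tail b e <= expR (- (b' - b)).
Proof.
move=> bb h; have [h1 _] := tail_odds e bb.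
have t0 := tail_ge0 b e; have t1 := tail_le1 b e; have t2 := tail_ge0 b' e.
rewrite expRN -[leRHS]mul1r ler_pdivlMr ?expR_gt0 // mulrC.
have E := expR_gt0 (b' - b).
set E' := expR _ in h1 E *.
have g0 : 0 <= E' * tail b e by rewrite mulr_ge0 // ltW.
have : (E' * tail b e) * (1 - tail b' e) <= (1 - tail b e) * (1 - tail b' e).
  rewrite -mulrA; apply: le_trans h1 _; rewrite [leRHS]mulrC ler_wpM2r //; lra.
rewrite ler_pM2r; lra.
Qed.

(** The difference of the tails equals that of the two cross products in [tail_odds], hence is at
    most [expR (n * (b' - b)) - 1]. This tells at which width the bisection may stop. *)
Lemma tail_lipschitz b b' e : b <= b' -> n%:R * (b' - b) <= 4^-1 ->
  tail b' e - tail b e <= 2 * (n%:R * (b' - b)).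
Proof.
move=> bb h; have [_ h1] := tail_odds e bb.
have d0 : 0 <= n%:R * (b' - b) by rewrite mulr_ge0 ?subr_ge0.
have E : expR (n%:R * (b' - b)) - 1 <= 2 * (n%:R * (b' - b)).
  have := expR_le_quad h; move: (n%:R * _) h d0 => d h d0; rewrite expr2; nra.
have t0 := tail_ge0 b e; have t1 := tail_le1 b e.
have u0 := tail_ge0 b' e; have u1 := tail_le1 b' e.
set E' := expR _ in h1 E.
have E1 : 0 <= E' - 1 by rewrite subr_ge0 -[leLHS]expR0 ler_expR.
have : (E' - 1) * (tail b e * (1 - tail b' e)) <= (E' - 1) * 1.
  by rewrite ler_wpM2l //; apply: mulr_ile1 => //; lra.
lra.
Qed.

(** From [b] to [bmax] every term of [Z] with [x >= e >= 1] grows by at least [expR (bmax - b)], and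
    at [b] these terms make up half of a sum that is at least [Z(bmin)]. *)
Lemma log_ratio_ge b bmin bmax e : (0 < e)%N -> bmin <= b <= bmax ->
  2^-1 <= tail b e -> bmax - b <= log_ratio c bmin bmax + ln 2.
Proof.
have [c0 _] := c_inst.
move=> e0 /andP[b1 b2] h.
have Zmono : partition_fun c bmin <= partition_fun c b.
  apply: ler_sum => x _; rewrite ler_wpM2l // ler_expR ler_wpM2r //.
have Z1 := partition_fun_gt0 bmin; have Z2 := partition_fun_gt0 b.
have Z3 := partition_fun_gt0 bmax.
have tE : tail b e * partition_fun c b =
    \sum_(x < n.+1 | (e <= x)%N) c x * expR (b * x%:R).
  by rewrite /tail /mass mulr_suml; apply: eq_bigr => x _; rewrite /gibbs divfK // gt_eqF.
have Zbig : expR (bmax - b) * (tail b e * partition_fun c b) <= partition_fun c bmax.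
  rewrite tE mulr_sumr /partition_fun [leRHS](bigID (fun x : 'I_n.+1 => (e <= x)%N)) /=.
  rewrite -[leLHS]addr0 lerD //; last first.
    by apply: sumr_ge0 => x _; rewrite mulr_ge0 ?expR_ge0.
  apply: ler_sum => x ex; rewrite mulrCA -expRD ler_wpM2l // ler_expR.
  rewrite -lerBrDr -mulrBl ler_peMr ?subr_ge0 //.
  by rewrite ler1n (leq_trans e0).
have E0 := expR_gt0 (bmax - b).
have : expR (bmax - b) * (2^-1 * partition_fun c bmin) <= partition_fun c bmax.
  apply: le_trans Zbig; rewrite ler_pM2l //; apply: ler_pM => //; exact: ltW.
rewrite /log_ratio ln_div ?posrE // => H.
have Z12 : 0 < 2^-1 * partition_fun c bmin by rewrite mulr_gt0.
have : ln (expR (bmax - b) * (2^-1 * partition_fun c bmin)) <= ln (partition_fun c bmax).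
  by rewrite ler_ln // posrE ?mulr_gt0.
rewrite lnM ?posrE // expRK lnM ?posrE // lnV ?posrE //; lra.
Qed.

Lemma continuous_weight (x : 'I_n.+1) : continuous (fun b : R => c x * expR (b * x%:R)).
Proof.
move=> b; apply: cvgM; first exact: cvg_cst.
apply: continuous_comp; last exact: continuous_expR.
by apply: cvgM; [exact: cvg_id|exact: cvg_cst].
Qed.

Lemma continuous_tail e : continuous (fun b => tail b e).
Proof.
have sumc (P : pred 'I_n.+1) :
    continuous (fun b : R => \sum_(x | P x) c x * expR (b * x%:R)).
  apply: continuous_big => [|x _]; last exact: continuous_weight.
  exact: add_continuous.
move=> b; rewrite /tail /mass.
under boolp.eq_fun do rewrite -mulr_suml.
apply: cvgM; first exact: sumc.
apply: cvgV; first by rewrite gt_eqF // partition_fun_gt0.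
exact: sumc.
Qed.

(** The balance point may lie outside the range; then an end of the range has to do. The side left
    too light there is harmless: a segment at [bmax] has no finite right end, one at [bmin] no
    finite left end. *)
Definition near_median bmin bmax e eps t : Prop :=
  [/\ bmin <= t <= bmax, 2^-1 - eps <= tail t e \/ t = bmax
    & tail t e <= 2^-1 + eps \/ t = bmin].

Lemma median_exists bmin bmax e : bmin <= bmax ->
  exists T, near_median bmin bmax e 0 T.
Proof.
move=> bb; have [h1|h1] := leP (tail bmax e) 2^-1.
  by exists bmax; split; [rewrite bb lexx|right|left; rewrite addr0].
have [h2|h2] := leP 2^-1 (tail bmin e).
  by exists bmin; split; [rewrite bb lexx|left; rewrite subr0|right].
have [||t tI tE] := @IVT R (fun b => tail b e) bmin bmax 2^-1 bb.
- by apply: continuous_subspaceT => b; exact: continuous_tail.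
- by rewrite ge_min (ltW h2) le_max (ltW h1) orbT.
by move: tI; rewrite in_itv /= => tI; exists t; split; [|left; rewrite tE subr0|left;
  rewrite tE addr0].
Qed.

End GibbsFacts.

(** * Searching for the balance point *)

Definition clip (R : realType) (bmin bmax b : R) : R := Num.max bmin (Num.min b bmax).

Lemma clip_id (R : realType) (bmin bmax b : R) : bmin <= b <= bmax -> clip bmin bmax b = b.
Proof.
by move=> /andP[h1 h2]; rewrite /clip (min_idPl h2); apply/max_idPr.
Qed.

Lemma clip_in (R : realType) (bmin bmax b : R) :
  bmin <= bmax -> bmin <= clip bmin bmax b <= bmax.
Proof. by move=> h; rewrite /clip le_max lexx /= ge_max h ge_min lexx orbT. Qed.

Section SearchDef.
Context {R : realType} (n : nat) (bmin bmax : R).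

(** The answer [true] votes for a balance point at or below [b]. Outside the range the right answer
    is known without a query. *)
Definition test (e : nat) (b : R) : tree R n bool :=
  if b < bmin then Ret false else if bmax < b then Ret true
  else Ask b (fun x => Ret (e <= x)%N).

Variable W0 : R.

(* Halves a bracket of width [2 ^ j * W0] around the balance point with one or two samples. A
   wrong decision requires a sample on the wrong side at distance at least [W / 8]. *)
Fixpoint shrink (e j : nat) (lo : R) : tree R n R :=
  if j is j'.+1 then
    let W := 2 ^+ j * W0 in
    bind (test e (lo + 3 * W / 8)) (fun b1 =>
      if b1 then shrink e j' lo
      else bind (test e (lo + 5 * W / 8)) (fun b2 =>
        if b2 then shrink e j' (lo + W / 4) else shrink e j' (lo + W / 2)))
  else Ret lo.

(* Looks for a bracket by doubling backwards from [bmax], because only the distance to [bmax],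
   not [bmax - bmin], is controlled by the log-ratio. *)
Fixpoint expand (e fuel j : nat) : tree R n R :=
  let y := 2 ^+ j * W0 in
  if fuel is fuel'.+1 then
    if bmax - bmin <= y then shrink e j (bmax - y)
    else bind (test e (bmax - y)) (fun b =>
      if b then expand e fuel' j.+1 else shrink e j.+1 (bmax - 2 * y))
  else shrink e j (bmax - y).

(** The last sample decides between the two ends. If [bmax] is the only acceptable point, midpoints
    never reach it and it survives only as the right end of the bracket. *)
Fixpoint bisect (e N : nat) (eta : R) (s : nat) (lo hi : R) : tree R n R :=
  if s is s'.+1 then
    let m := (lo + hi) / 2 in
    bind (sample N m) (fun xs =>
      if (2^-1 : R) < freq N (fun x => e <= x)%N xs then bisect e N eta s' lo m
      else bisect e N eta s' m hi)
  else bind (sample N lo) (fun xs =>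
    Ret (if (2^-1 - 2 * eta : R) <= freq N (fun x => e <= x)%N xs then lo else hi)).

(** The fuel [f] satisfies [bmax - bmin <= 2 ^ f], so the doubling covers the whole range before it
    runs out; the expected number of doublings is far smaller. *)
Definition search (e N : nat) (eta : R) (s : nat) : tree R n R :=
  bind (expand e (Num.truncn (bmax - bmin)).+1 0) (fun lo =>
    bisect e N eta s (Num.max bmin lo) (Num.min bmax (lo + W0))).

End SearchDef.

Lemma asbool_eq (b b' : bool) : `[< b = b' >] = (b == b').
Proof. by apply/asboolP/eqP. Qed.

Section SearchProof.
Context {R : realType} {n : nat}.
Variables (c : 'I_n.+1 -> R) (bmin bmax : R).
Hypothesis c_inst : is_instance c.
Hypothesis bmm : bmin < bmax.

(* Trees may query any real; [embed] clips the query to the admissible range. *)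
Definition ker (b : R) : 'I_n.+1 -> R := gibbs c (clip bmin bmax b).

Lemma ker_ge0 b x : 0 <= ker b x.
Proof. exact: gibbs_ge0. Qed.

Lemma ker_sum1 b : \sum_x ker b x = 1.
Proof. exact: gibbs_sum1. Qed.

Let nu0 := ker_ge0.
Let nu1 := ker_sum1.

Lemma Ex_le_err A (t : tree R n A) (P : A -> Prop) f m1 m2 :
  0 <= m2 -> (forall a, P a -> f a <= m1) -> (forall a, f a <= m1 + m2) ->
  Ex ker t f <= m1 + m2 * err ker t P.
Proof.
move=> m20 h1 h2; rewrite /err -ExZ -[X in _ <= X + _](Ex_cst nu1 t) -ExD.
by apply: Ex_le => // a; case: asboolP => [/h1|_]; rewrite ?mulr0 ?addr0 ?mulr1.
Qed.

Variable (e : nat).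
Variable (T : R).
Hypothesis T_med : near_median c bmin bmax e 0 T.

Lemma err_test_lo b d : b + d <= T -> err ker (test n bmin bmax e b) (fun r => r = false) <= expR
  (- d).
Proof.
move=> bT; have [d0|d0] := leP d 0.
  apply: (le_trans (err_le1 nu0 nu1 _ _)).
  by rewrite -[leLHS]expR0 ler_expR oppr_ge0.
have [Tr _ T2] := T_med; have /andP[T3 T4] := Tr.
rewrite /test; case: ltP => b1; first by rewrite err_sure // expR_ge0.
case: ltP => b2; first by lra.
have tT : tail c T e <= 2^-1 by case: T2 => [|TE]; lra.
rewrite /err /= /ker clip_id ?b1 //.
have -> : \sum_x gibbs c b x * (~~ `[< (e <= x)%N = false >])%:R = tail c b e.
  rewrite /tail /mass [RHS]big_mkcond; apply: eq_bigr => x _.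
  by rewrite asbool_eq; case: leqP => _; rewrite ?mulr0 ?mulr1.
apply: le_trans (tail_decay_lo c_inst (b' := T) _ tT) _; first by lra.
by rewrite ler_expR; lra.
Qed.

Lemma err_test_hi b d : T + d <= b -> err ker (test n bmin bmax e b) (fun r => r = true) <= expR (-
  d).
Proof.
move=> bT; have [d0|d0] := leP d 0.
  apply: (le_trans (err_le1 nu0 nu1 _ _)).
  by rewrite -[leLHS]expR0 ler_expR oppr_ge0.
have [Tr T2 _] := T_med; have /andP[T3 T4] := Tr.
rewrite /test; case: ltP => b1; first by lra.
case: ltP => b2; first by rewrite err_sure // expR_ge0.
have tT : 2^-1 <= tail c T e by case: T2 => [|TE]; lra.
rewrite /err /= /ker clip_id ?b1 //.
have -> : \sum_x gibbs c b x * (~~ `[< (e <= x)%N = true >])%:R = 1 - tail c b e.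
  rewrite tail_compl // /mass [RHS]big_mkcond; apply: eq_bigr => x _.
  by rewrite asbool_eq; case: leqP => _; rewrite ?mulr0 ?mulr1.
apply: le_trans (tail_decay_hi c_inst (b := T) _ tT) _; first by lra.
by rewrite ler_expR; lra.
Qed.

Lemma err_test b d :
  err ker (test n bmin bmax e b) (fun r : bool => if r then T <= b + d else b - d <= T) <= expR (-
    d).
Proof.
have [hd|hd] := leP d 0.
  apply: (le_trans (err_le1 nu0 nu1 _ _)).
  by rewrite -[leLHS]expR0 ler_expR oppr_ge0.
have [h1|h1] := leP T (b + d); last first.
  apply: le_trans (err_test_lo (b := b) (d := d) (ltW h1)).
  by apply: err_sub => // r ->; lra.
have [h2|h2] := leP (b - d) T; first by rewrite err_sure ?expR_ge0 //;
  apply: sure_imp (sure_true _) _ => -[].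
by apply: le_trans (err_test_hi (b := b) (d := d) _); [apply: err_sub => // r ->|lra].
Qed.

Lemma cost_test b : cost ker (test n bmin bmax e b) <= 1.
Proof.
rewrite /test; case: ltP => _ //; case: ltP => _ //=.
by rewrite big1 ?addr0 // => x _; rewrite mulr0.
Qed.

Variables (l : nat).
Hypothesis l_gt0 : (0 < l)%N.
(** An eighth of this width is the exponent [8 * l] of [d0], so the margin [W / 8] of any halving
    step errs with probability at most [d0]; [l] will be of order log n. *)
Let W0 : R := 64 * l%:R.
Let d0 : R := expR (- (8 * l%:R)).

Lemma W0_ge64 : 64 <= W0.
Proof. by rewrite /W0 ler_peMr // ler1n. Qed.

Lemma decay j x : 2 ^+ j * (8 * l%:R) <= x -> expR (- x) <= 2^-1 ^+ j * d0.
Proof.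
move=> h; have l1 : 1 <= l%:R :> R by rewrite ler1n.
have -> : 2^-1 ^+ j = expR (- (ln 2 * j%:R)) :> R.
  by rewrite expRN expRM_natr lnK ?posrE // exprVn.
rewrite -expRD ler_expR -opprD lerN2; apply: le_trans h.
have ln2 : ln 2 <= 1 :> R.
  have : ln (1 + 1) <= 1 :> R by apply: le_ln1Dx; lra.
  by [].
have h1 : ln 2 * j%:R <= j%:R :> R by rewrite ler_piMl.
have h2 : j%:R + 1 <= 2 ^+ j :> R.
  by rewrite natr1 -natrX ler_nat ltn_expl.
apply: (@le_trans _ _ (j%:R + 8 * l%:R)); first by lra.
have : (j%:R + 1) * (8 * l%:R) <= 2 ^+ j * (8 * l%:R) :> R.
  by rewrite ler_wpM2r // mulr_ge0.
have : 0 <= j%:R * (l%:R - 1) :> R by rewrite mulr_ge0 ?subr_ge0.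
have : 0 <= j%:R :> R by [].
lra.
Qed.

Lemma cost_shrink j lo : cost ker (shrink n bmin bmax W0 e j lo) <= 2 * j%:R.
Proof.
elim: j lo => [|j IH] lo /=; first by rewrite mulr0.
rewrite -[j.+1%:R]natr1 mulrDr mulr1.
apply: (@le_trans _ _ (1 + (1 + 2 * j%:R))); last by lra.
apply: (cost_bind_le nu0 nu1 (sure_true _) (cost_test _)) => -[] _.
  by apply: (le_trans (IH _)); rewrite lerDr.
by apply: (cost_bind_le nu0 nu1 (sure_true _) (cost_test _)) => -[] _; exact: IH.
Qed.

Definition bracket (lo : R) : Prop := lo <= T <= lo + W0.

Lemma d0_ge0 : 0 <= d0. Proof. exact: expR_ge0. Qed.

(** The interval kept extends [W / 8] beyond the tests that select it. Error probabilities at least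
    halve when [W] doubles, so their sum is bounded however many halvings there are, and single
    samples suffice. *)
Lemma err_shrink j lo : lo <= T <= lo + 2 ^+ j * W0 ->
  err ker (shrink n bmin bmax W0 e j lo) bracket <= 2 * (1 - 2^-1 ^+ j) * d0.
Proof.
have d00 := d0_ge0; have W64 := W0_ge64.
elim: j lo => [|j IH] lo h /=.
  rewrite expr0 subrr mulr0 mul0r err_sure //.
  by move: h; rewrite expr0 mul1r.
set W := 2 ^+ j.+1 * W0 in h *.
have W2 : W / 2 = 2 ^+ j * W0.
  by rewrite /W exprS mulrAC; field.
have Wd : expR (- (W / 8)) <= 2^-1 ^+ j.+1 * d0.
  by apply: decay; rewrite /W /W0; lra.
have pj : 0 <= 2^-1 ^+ j :> R by rewrite exprn_ge0.
have pj1 : 2^-1 ^+ j <= 1 :> R by rewrite exprn_ile1 // invf_le1 // ler1n.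
have m0 : 0 <= 2 * (1 - 2^-1 ^+ j) * d0 by rewrite !mulr_ge0 ?subr_ge0.
apply: (@le_trans _ _ (2^-1 ^+ j.+1 * d0 + (2^-1 ^+ j.+1 * d0 + 2 * (1 - 2^-1 ^+ j) * d0))).
  have q0 : 0 <= 2^-1 ^+ j.+1 * d0 by rewrite mulr_ge0 ?exprn_ge0.
  have /andP[h1 h2] := h.
  apply: (err_bind nu0 nu1 (le_trans (err_test _ _) Wd)); first by rewrite addr_ge0.
  move=> -[] hb1.
    by apply: (le_trans (IH _ _)); [rewrite -W2; lra|rewrite lerDr].
  apply: (err_bind nu0 nu1 (le_trans (err_test _ _) Wd)) => //.
  by move=> -[] hb2; apply: IH; rewrite -W2; lra.
rewrite exprS; lra.
Qed.

(** After a false answer at [bmax - y] the bracket starts at [bmax - 2 * y], so losing [T] takes a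
    wrong sample at distance [y]. A wrong true answer merely enlarges the bracket. *)
Lemma err_expand fuel j : bmax - bmin <= 2 ^+ (fuel + j) * W0 ->
  err ker (expand n bmin bmax W0 e fuel j) bracket <= 2 * d0 + 2 * 2^-1 ^+ j * d0.
Proof.
have d00 := d0_ge0; have W64 := W0_ge64.
have [/andP[T1 T2] _ _] := T_med.
have sh k lo : lo <= T <= lo + 2 ^+ k * W0 ->
    err ker (shrink n bmin bmax W0 e k lo) bracket <= 2 * d0.
  move=> h; apply: (le_trans (err_shrink h)).
  have : 0 <= 2^-1 ^+ k * d0 by rewrite mulr_ge0 // exprn_ge0.
  lra.
elim: fuel j => [|f IH] j h /=.
  have : 0 <= 2 * 2^-1 ^+ j * d0 by rewrite !mulr_ge0 // exprn_ge0.
  have : err ker (shrink n bmin bmax W0 e j (bmax - 2 ^+ j * W0)) bracket <= 2 * d0.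
    by apply: sh; move: h; rewrite add0n; set y := 2 ^+ j * W0; lra.
  lra.
have pj : 0 <= 2^-1 ^+ j * d0 by rewrite mulr_ge0 // exprn_ge0.
set y := 2 ^+ j * W0.
case: ifP => hy.
  have : err ker (shrink n bmin bmax W0 e j (bmax - y)) bracket <= 2 * d0.
    by apply: sh; rewrite -/y; lra.
  lra.
have yd : expR (- y) <= 2^-1 ^+ j * d0.
  apply: decay; rewrite /y ler_wpM2l ?exprn_ge0 //.
  by have : 0 <= l%:R :> R by []; rewrite /W0; lra.
apply: (@le_trans _ _ (2^-1 ^+ j * d0 + (2 * d0 + 2 * 2^-1 ^+ j.+1 * d0))); last first.
  rewrite exprS; lra.
have qj : 0 <= 2^-1 ^+ j.+1 * d0 by rewrite mulr_ge0 // exprn_ge0.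
apply: (err_bind nu0 nu1 (le_trans (err_test _ _) yd)); first by lra.
move=> -[] /= hb; first by apply: IH; rewrite addnS -addSn.
apply: (@le_trans _ _ (2 * d0)); last by lra.
by apply: (sh j.+1 (bmax - 2 * y)); rewrite exprS -mulrA -/y; lra.
Qed.

(** Up to [J] each doubling costs one query. From then on [bmax - y] lies at least 1 below [T], so
    the doubling continues with probability at most 1/2, which outweighs the linear growth of the
    halving cost. *)
Lemma cost_expand J fuel j : 2 * (bmax - T) <= 2 ^+ J ->
  cost ker (expand n bmin bmax W0 e fuel j) <= (J - j + 4 * maxn J j + 10)%:R.
Proof.
have W64 := W0_ge64.
have [/andP[T1 T2] _ _] := T_med.
move=> hJ; elim: fuel j => [|f IH] j /=.
  apply: (le_trans (cost_shrink _ _)); rewrite -natrM ler_nat; lia.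
case: ifP => _; first by apply: (le_trans (cost_shrink _ _)); rewrite -natrM ler_nat; lia.
set y := 2 ^+ j * W0.
have cs := cost_shrink j.+1 (bmax - 2 * y).
rewrite cost_bind //.
have ct := cost_test (bmax - y).
have [jJ|Jj] := ltnP j J.
  apply: (@le_trans _ _ (1 + (J - j.+1 + 4 * maxn J j + 10)%:R)); last first.
    by rewrite -[1]/(1%:R) -natrD ler_nat; lia.
  apply: lerD => //; rewrite -[leRHS](Ex_cst nu1 (test n bmin bmax e (bmax - y))).
  apply: Ex_le => // -[].
    by apply: (le_trans (IH _)); rewrite ler_nat; lia.
  by apply: (le_trans cs); rewrite -natrM ler_nat; lia.
have y2 : 2 ^+ J * 64 <= y.
  by apply: ler_pM => //; rewrite ?exprn_ge0 // ler_weXn2l // ler1n.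
have J1 : 1 <= 2 ^+ J :> R by rewrite exprn_ege1 // ler1n.
have p2 : err ker (test n bmin bmax e (bmax - y)) (fun r => r = false) <= 2^-1.
  apply: (le_trans (err_test_lo (d := 1) _)); first by lra.
  have e2 := expR_ge1Dx (1 : R).
  by rewrite expRN lef_pV2 ?posrE //; lra.
(* For [j >= J], [f j = 4 * j + 10] solves the recursion [f j = 1 + 2 * (j + 1) + f (j + 1) / 2]. *)
apply: (@le_trans _ _ (1 + ((2 * j.+1)%:R + 2^-1 * (4 * j + 14)%:R))); last first.
  apply: (@le_trans _ _ (4 * j + 10)%:R); last by rewrite ler_nat; lia.
  by rewrite !natrD !natrM -[j.+1%:R]natr1; lra.
apply: lerD => //.
apply: (@le_trans _ _ ((2 * j.+1)%:R + (4 * j + 14)%:R *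
   err ker (test n bmin bmax e (bmax - y)) (fun r => r = false))); last first.
  by rewrite lerD2l mulrC ler_wpM2r.
apply: Ex_le_err => // [_ ->|[]]; first by rewrite natrM.
  by apply: (le_trans (IH _)); rewrite -natrD ler_nat; lia.
by apply: (le_trans cs); rewrite natrM lerDl.
Qed.

Lemma cost_bisect N eta s lo hi :
  cost ker (bisect n e N eta s lo hi) <= N%:R * s.+1%:R.
Proof.
elim: s lo hi => [|s IH] lo hi /=.
  rewrite mulr1 -[leRHS]addr0.
  by apply: (cost_bind_le nu0 nu1 (sure_true _)); rewrite ?cost_sample.
rewrite -[s.+2%:R]natr1 mulrDr mulr1 [leRHS]addrC.
apply: (cost_bind_le nu0 nu1 (sure_true _)); rewrite ?cost_sample // => xs _.
by case: ifP => _; exact: IH.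
Qed.

Lemma err_tail_freq N eta b : (0 < N)%N -> 0 < eta <= 2^-1 -> bmin <= b <= bmax ->
  err ker (sample N b) (fun xs => `|freq N (fun x => e <= x)%N xs - tail c b e| <= eta)
  <= 2 * expR (- (N%:R * eta ^+ 2 / 4)).
Proof.
move=> N0 eta0 br; have := freq_deviation nu0 nu1 b (fun x => e <= x)%N N0 ltr01 eta0.
rewrite mulr1; apply: le_trans; apply: err_sub => // xs.
have -> : mass ker b (fun x => e <= x)%N = tail c b e by rewrite /mass /ker clip_id.
by rewrite (max_idPr (tail_le1 c_inst _ _)) mulr1.
Qed.

(** The invariant asks for some near-median in the bracket, not for a fixed one. If the half kept
    loses it, the observed frequency and monotonicity show that the midpoint is one with the same
    [eta], so the tolerance does not degrade from step to step. *)
Lemma err_bisect N eta s lo hi : (0 < N)%N -> 0 < eta <= 2^-1 ->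
  bmin <= lo <= hi -> hi <= bmax ->
  (exists2 t, lo <= t <= hi & near_median c bmin bmax e eta t) ->
  n%:R * (hi - lo) <= 2 ^+ s * (eta / 2) ->
  err ker (bisect n e N eta s lo hi) (near_median c bmin bmax e (4 * eta)) <=
  s.+1%:R * (2 * expR (- (N%:R * eta ^+ 2 / 4))).
Proof.
move=> N0 eta0; have /andP[eta1 eta2] := eta0.
set dl := 2 * _; have dl0 : 0 <= dl by rewrite mulr_ge0 ?expR_ge0.
elim: s lo hi => [|s IH] lo hi /andP[lo1 lohi] hi1 [t /andP[t1 t2] [_ t3 t4]] w /=.
  rewrite mul1r -[dl]addr0; apply: (err_bind nu0 nu1 (err_tail_freq N0 eta0 _)) => //.
    by rewrite lo1 (le_trans lohi).
  move=> xs hx; rewrite err_sure //=; move: hx; set f := freq _ _ _.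
  rewrite ler_norml => /andP[f1 f2]; rewrite expr0 mul1r in w.
  have n0 : 0 <= n%:R :> R by [].
  have d1 : n%:R * (t - lo) <= n%:R * (hi - lo) by rewrite ler_wpM2l //; lra.
  have d2 : n%:R * (hi - t) <= n%:R * (hi - lo) by rewrite ler_wpM2l //; lra.
  have l1 := tail_lipschitz c_inst e t1 ltac:(lra).
  have l2 := tail_lipschitz c_inst e t2 ltac:(lra).
  have m1 := tail_mono c_inst e t1; have m2 := tail_mono c_inst e t2.
  case: ifP => hf; split; try by apply/andP; split; lra.
  - by left; lra.
  - case: t4 => h; first by left; lra.
    by right; lra.
  - case: t3 => h; first by left; lra.
    by right; lra.
  - case: t4 => h; first by left; lra.
    have E : tail c lo e = tail c t e by congr tail; lra.
    by move/negbT: hf; rewrite -ltNge => hf; left; lra.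
set m := (lo + hi) / 2.
have -> : s.+2%:R * dl = dl + s.+1%:R * dl by rewrite -[s.+2%:R]natr1; ring.
have mr : bmin <= m <= bmax by rewrite /m; lra.
apply: (err_bind nu0 nu1 (err_tail_freq N0 eta0 mr)); first by rewrite mulr_ge0.
move=> xs; set f := freq _ _ _; rewrite ler_norml => /andP[f1 f2].
rewrite exprS in w.
have w2 : n%:R * ((hi - lo) / 2) <= 2 ^+ s * (eta / 2) by lra.
have w3 : m - lo = (hi - lo) / 2 by rewrite /m; field.
have w4 : hi - m = (hi - lo) / 2 by rewrite /m; field.
case: ltP => hf; apply: IH; rewrite ?w3 ?w4 //; rewrite ?lo1 /m; try lra.
- have [tm|tm] := leP t m.
    by exists t; [rewrite /m in tm; lra|split => //; apply/andP; split; lra].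
  exists m; first by rewrite /m; lra.
  have := tail_mono c_inst e (ltW tm); split => //; first by left; lra.
  by case: t4 => h; left; lra.
- have [tm|tm] := leP m t.
    by exists t; [rewrite /m in tm; lra|split => //; apply/andP; split; lra].
  exists m; first by rewrite /m; lra.
  have := tail_mono c_inst e (ltW tm); split => //; last by left; lra.
  by case: t3 => h; left; lra.
Qed.

End SearchProof.

(** * Binary logarithms *)

Definition log2_up (m : nat) : nat := (trunc_log 2 m).+1.

Lemma ltn_log2_up m : (m < 2 ^ log2_up m)%N.
Proof. exact: trunc_log_ltn. Qed.

Section LogBounds.
Context {R : realType}.

Lemma ln2_ge_half : 2^-1 <= ln 2 :> R.
Proof.
have : ln (1 + (- 2^-1)) <= - 2^-1 :> R by apply: le_ln1Dx; lra.
rewrite (_ : 1 + - 2^-1 = 2^-1 :> R); last by field.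
by rewrite lnV ?posrE // lerN2.
Qed.

Lemma ln2_le1 : ln 2 <= 1 :> R.
Proof. by have : ln (1 + 1) <= 1 :> R by apply: le_ln1Dx; lra. Qed.

Lemma log2_up_le m : (0 < m)%N -> (log2_up m)%:R <= 1 + 2 * ln m%:R :> R.
Proof.
move=> m0; rewrite /log2_up -[_.+1%:R]natr1 addrC lerD2l.
have h : (2 ^ trunc_log 2 m <= m)%N by apply: trunc_logP.
have : ln ((2 ^ trunc_log 2 m)%:R : R) <= ln m%:R.
  by rewrite ler_ln ?posrE ?ltr0n ?expn_gt0 // ler_nat.
rewrite natrX lnXn // -[ln 2 *+ _]mulr_natl.
have : 0 <= (trunc_log 2 m)%:R * (ln 2 - 2^-1) :> R by rewrite mulr_ge0 ?subr_ge0 ?ln2_ge_half.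
lra.
Qed.

Lemma pow2_above (x : R) : 1 <= x -> exists J : nat, x <= 2 ^+ J /\ J%:R <= 1 + 2 * ln x.
Proof.
move=> x1; have x0 : 0 <= x by lra.
have t1 : (0 < Num.truncn x)%N by rewrite Num.Theory.truncn_gt0.
exists (log2_up (Num.truncn x)); split.
  apply: ltW; apply: lt_le_trans (Num.Theory.truncnS_gt _) _.
  by rewrite -natrX ler_nat ltn_log2_up.
apply: (le_trans (log2_up_le t1)); rewrite lerD2l ler_pM2l // ler_ln ?posrE ?ltr0n //; last by lra.
by rewrite Num.Theory.truncn_le.
Qed.

End LogBounds.

(** * Monotone thresholds *)

Section Thresholds.
Context {R : realType} {n : nat}.
Variables (c : 'I_n.+1 -> R) (bmin bmax : R).
Hypothesis c_inst : is_instance c.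
Hypothesis bmm : bmin < bmax.

Local Notation nu := (ker c bmin bmax).
Let nu0 := ker_ge0 bmin bmax c_inst.
Let nu1 := ker_sum1 bmin bmax c_inst.

Variables (l : nat).
Hypothesis l_gt0 : (0 < l)%N.
Let W0 : R := 64 * l%:R.

Lemma near_median_ge0 e eps T : 0 <= eps -> near_median c bmin bmax e 0 T ->
  near_median c bmin bmax e eps T.
Proof.
by move=> e0 [h1 h2 h3]; split => //; [case: h2 => h; [left; lra|right]
  |case: h3 => h; [left; lra|right]].
Qed.

Lemma err_search e N eta s : (0 < N)%N -> 0 < eta <= 2^-1 ->
  n%:R * W0 <= 2 ^+ s * (eta / 2) ->
  err nu (search n bmin bmax W0 e N eta s) (near_median c bmin bmax e (4 * eta)) <=
  4 * expR (- (8 * l%:R)) + s.+1%:R * (2 * expR (- (N%:R * eta ^+ 2 / 4))).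
Proof.
move=> N0 eta0 hs; have [T hT] := median_exists c_inst e (ltW bmm).
have W64 : 64 <= W0 by rewrite /W0 ler_peMr // ler1n.
have /andP[eta1 _] := eta0.
rewrite /search; apply: (err_bind nu0 nu1 (P := bracket T l)).
- apply: (le_trans (err_expand c_inst hT l_gt0 (fuel := (Num.truncn (bmax - bmin)).+1) (j := 0)
  _)); last first.
    by rewrite expr0; lra.
  rewrite addn0 -/W0.
  have h1 : bmax - bmin < (Num.truncn (bmax - bmin)).+1%:R.
    exact: Num.Theory.truncnS_gt.
  have h2 : (Num.truncn (bmax - bmin)).+1%:R <= 2 ^+ (Num.truncn (bmax - bmin)).+1 :> R.
    by rewrite -natrX ler_nat ltnW // ltn_expl.
  apply: (le_trans (ltW h1)); apply: (le_trans h2).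
  by rewrite ler_peMr ?exprn_ge0 //; lra.
- by rewrite !mulr_ge0 ?expR_ge0.
move=> lo; rewrite /bracket -/W0 => /andP[h1 h2].
have [/andP[T1 T2] _ _] := hT.
have a1 : bmin <= Num.max bmin lo by rewrite le_max lexx.
have a2 : Num.min bmax (lo + W0) <= bmax by rewrite ge_min lexx.
have a3 : Num.max bmin lo <= T by rewrite ge_max T1.
have a4 : T <= Num.min bmax (lo + W0) by rewrite le_min T2.
apply: err_bisect => //.
- by rewrite a1 (le_trans a3).
- exists T; first by rewrite a3.
  by apply: near_median_ge0 => //; lra.
apply: le_trans hs; rewrite ler_wpM2l //.
have : lo <= Num.max bmin lo by rewrite le_max lexx orbT.
have : Num.min bmax (lo + W0) <= lo + W0 by rewrite ge_min lexx orbT.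
lra.
Qed.

Lemma cost_search e N eta s : (0 < e)%N ->
  cost nu (search n bmin bmax W0 e N eta s) <=
  35 + 10 * ln (Num.max 1 (log_ratio c bmin bmax)) + N%:R * s.+1%:R.
Proof.
move=> e0; have [T hT] := median_exists c_inst e (ltW bmm).
set q := Num.max _ _.
have q1 : 1 <= q by rewrite le_max lexx.
have [J [hJ1 hJ2]] := pow2_above (ltac:(lra) : 1 <= 4 * q).
have Tq : bmax - T <= 2 * q.
  have [Tr T2 _] := hT; case: T2 => [h|->]; last by lra.
  rewrite subr0 in h; have := log_ratio_ge c_inst e0 Tr h.
  have := @ln2_le1 R; have : log_ratio c bmin bmax <= q by rewrite le_max lexx orbT.
  lra.
apply: (cost_bind_le nu0 nu1 (sure_true _)) => [|lo _]; last exact: cost_bisect.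
apply: (le_trans (cost_expand c_inst bmm hT l_gt0 _ _ (J := J) _)); first by lra.
apply: (@le_trans _ _ (5 * J + 10)%:R); first by rewrite ler_nat; lia.
rewrite natrD natrM; move: hJ2; rewrite lnM ?posrE //; last by lra.
have : ln 4 <= 2 :> R.
  have -> : 4 = 2 * 2 :> R by ring.
  by rewrite lnM ?posrE //; have := @ln2_le1 R; lra.
lra.
Qed.

(** Monotone and within the range for every [g], so that the structure of the output does not depend
    on the success of the searches. *)
Fixpoint running_max (g : nat -> R) (e : nat) : R :=
  if e is e'.+1 then Num.max (running_max g e') (clip bmin bmax (g e)) else bmin.

(** The outer thresholds 0 and [n.+1] have all the mass on one side. Placed at [bmin] and [bmax],
    they yield the first and the last item. *)
Definition threshold (g : nat -> R) (e : nat) : R :=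
  if (n < e)%N then bmax else running_max g e.

Lemma running_max_in g e : bmin <= running_max g e <= bmax.
Proof.
elim: e => [|e /andP[h1 h2]] /=; first by rewrite lexx ltW.
rewrite le_max h1 /= ge_max h2 /=.
by case/andP: (clip_in (g e.+1) (ltW bmm)).
Qed.

Lemma threshold_in g e : bmin <= threshold g e <= bmax.
Proof. by rewrite /threshold; case: ifP => _; [rewrite lexx ltW|exact: running_max_in]. Qed.

Lemma running_max_homo g e e' : (e <= e')%N -> running_max g e <= running_max g e'.
Proof.
move=> /subnKC <-; elim: (e' - e)%N => [|k IH]; first by rewrite addn0.
by rewrite addnS /= le_max IH.
Qed.

Lemma threshold_homo g e e' : (e <= e')%N -> threshold g e <= threshold g e'.
Proof.
move=> ee; rewrite /threshold; case: ltnP => h; case: ltnP => h' //.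
- by move: (leq_trans h ee); rewrite ltnNge h'.
- by case/andP: (running_max_in g e).
exact: running_max_homo.
Qed.

(* A running maximum of near-medians stays a near-median, since [tail b e] increases with [b]
   and decreases with [e]. *)
Lemma running_max_median g eps : 0 <= eps ->
  (forall e, (1 <= e <= n)%N -> near_median c bmin bmax e eps (g e)) ->
  forall e, (1 <= e <= n)%N -> near_median c bmin bmax e eps (running_max g e).
Proof.
move=> eps0 H; elim=> // e IH /andP[_ en].
have [gr g1 g2] := H e.+1 en; have /andP[r1 r2] := running_max_in g e.
split; first exact: running_max_in.
all: rewrite /= clip_id //; case: (leP (running_max g e)) => // rg.
- case: g1 => h; last by move: rg; rewrite h ltNge r2.
  by left; apply: le_trans h _; exact: tail_mono (ltW rg).
case: e IH en {H g1 g2 gr} rg r1 r2 => [|e] IH en rg r1 r2; first by right.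
have [_ _ [h|h]] := IH (ltnW en); [left|by right].
by apply: le_trans h; exact: tail_anti.
Qed.

Lemma threshold_balanced g eps : 0 <= eps <= 2^-1 ->
  (forall e, (1 <= e <= n)%N -> near_median c bmin bmax e eps (g e)) ->
  forall e, (e <= n.+1)%N ->
    (threshold g e = bmin \/ 2^-1 - eps <= 1 - tail c (threshold g e) e) /\
    (threshold g e = bmax \/ 2^-1 - eps <= tail c (threshold g e) e).
Proof.
move=> /andP[eps0 eps1] H e en; rewrite /threshold; case: ltnP => h.
  split; last by left.
  right; have -> : tail c bmax e = 0; last by lra.
  by rewrite /tail /mass big_pred0 // => x; apply: contraTF h => /leq_ltn_trans -/(_ _ (ltn_ord
    x)); rewrite ltnS leqNgt.
case: e en h => [|e] en h.
  split; first by left.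
  right; have -> : tail c (running_max g 0) 0 = 1; last by lra.
  by rewrite /tail /mass -[RHS](gibbs_sum1 c_inst (running_max g 0)).
have [_ h1 h2] := running_max_median eps0 H (e := e.+1) h.
by split; [case: h2 => ?; [right; lra|left]|case: h1 => ?; [right; lra|left]].
Qed.

End Thresholds.

(** * Mass on the two sides of a threshold *)

Section Positions.
Context {R : realType} {n : nat}.
Variable c : 'I_n.+1 -> R.
Hypothesis c_inst : is_instance c.

(* Position [k.+1] stands for [k] in H; positions [0] and [n.+2] stand for the two infinities. *)
Definition at_pos (p : nat) : pred 'I_n.+1 := fun x => x.+1 == p.

Definition pm b p := mass (gibbs c) b (at_pos p).

Lemma pm_ge0 b p : 0 <= pm b p.
Proof. by apply: sumr_ge0 => x _; exact: gibbs_ge0. Qed.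

Lemma pmS b (x : 'I_n.+1) : pm b x.+1 = gibbs c b x.
Proof. by rewrite /pm /mass (big_pred1 x) // => y; rewrite /at_pos eqSS. Qed.

Lemma pm0 b p : ~~ (1 <= p <= n.+1)%N -> pm b p = 0.
Proof.
move=> h; rewrite /pm /mass big_pred0 // => x; rewrite /at_pos.
by apply/negbTE; apply: contra h => /eqP <-; rewrite /= ltn_ord.
Qed.

Lemma pm_case p : {x : 'I_n.+1 | p = x.+1} + {~~ (1 <= p <= n.+1)%N}.
Proof.
case: p => [|p]; first by right.
by have [h|h] := ltnP p n.+1; [left; exists (Ordinal h)|right; clear -h; lia].
Qed.

(** Monotone likelihood ratio, free of division: a larger inverse temperature favours larger
    positions. At the infinities both sides vanish. *)
Lemma pm_cross b b' p p' : b <= b' -> (p <= p')%N ->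
  pm b p' * pm b' p <= pm b' p' * pm b p.
Proof.
move=> bb pp; case: (pm_case p) => [[x xE]|h]; last by rewrite !(pm0 _ h) !mulr0.
case: (pm_case p') => [[y yE]|h]; last by rewrite !(pm0 _ h) !mul0r.
rewrite {}xE {}yE in pp *.
rewrite !pmS [leRHS](gibbs_cross c_inst) ler_peMl ?(mulr_ge0 (gibbs_ge0 c_inst _ _) (gibbs_ge0
  c_inst _ _)) //.
by rewrite -[leLHS]expR0 ler_expR mulr_ge0 ?subr_ge0 ?ler_nat.
Qed.

(** The threshold [e] sits between the positions [e] and [e.+1], so distances start at 1 on both
    sides: [e.+1 - p] to the left, [p - e] to the right. *)
Lemma left_mass_sum b e : (e <= n.+1)%N ->
  1 - tail c b e = \sum_(1 <= j < e.+1) pm b (e.+1 - j).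
Proof.
move=> en; rewrite tail_compl // /mass.
rewrite (eq_bigr (fun x : 'I_n.+1 => pm b x.+1)); last by move=> x _; rewrite pmS.
rewrite -(big_mkord (fun k => (k < e)%N) (fun k => pm b k.+1)).
rewrite -(big_nat_widen 0 e n.+1 xpredT (fun k => pm b k.+1)) //.
rewrite big_nat_rev big_add1 /= add0n; apply: eq_big_nat => k /andP[_ ke].
by congr pm; lia.
Qed.

Lemma right_mass_sum b e : (e <= n.+1)%N ->
  tail c b e = \sum_(1 <= j < (n.+1 - e).+1) pm b (e + j).
Proof.
move=> en; rewrite /tail /mass.
rewrite (eq_bigr (fun x : 'I_n.+1 => pm b x.+1)); last by move=> x _; rewrite pmS.
rewrite -(big_mkord (fun k => (e <= k)%N) (fun k => pm b k.+1)).
rewrite -(big_nat_widenl e 0 n.+1 xpredT (fun k => pm b k.+1)) //.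
rewrite -[in LHS](add0n e) big_addn big_add1 /=; apply: eq_big_nat => k _.
by congr pm; lia.
Qed.

(* The only place where the two settings differ. *)
Definition side_bound (r : R) : Prop := forall b e M, (e <= n.+1)%N -> 0 <= M ->
  ((forall p, (1 <= p <= e)%N -> (e.+1 - p)%:R * pm b p <= M) ->
     1 - tail c b e <= r * M) /\
  ((forall p, (e < p <= n.+1)%N -> (p - e)%:R * pm b p <= M) ->
     tail c b e <= r * M).

Lemma general_side_bound : side_bound (1 + ln n.+1%:R).
Proof.
move=> b e M en M0.
have lnM' m : (m <= n.+1)%N -> (1 + ln m%:R) * M <= (1 + ln n.+1%:R) * M.
  case: m => [|m] mn; rewrite ler_wpM2r // lerD2l.
    by rewrite ln0 // ln_ge0 // ler1n.
  by rewrite ler_ln ?posrE ?ltr0n // ler_nat.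
split=> H.
  rewrite left_mass_sum //; apply: le_trans (lnM' e en).
  apply: harmonic_sum_bound => // j /andP[j1 j2].
  by have := H (e.+1 - j)%N; rewrite subKn ?(leqW j2) //; apply; lia.
rewrite right_mass_sum //; apply: le_trans (lnM' (n.+1 - e)%N (leq_subr _ _)).
apply: harmonic_sum_bound => // j /andP[j1 j2].
by have := H (e + j)%N; rewrite addKn; apply; lia.
Qed.

Hypothesis c_lc : log_concave c.

Lemma pm_log_concave b p : pm b p * pm b p.+2 <= pm b p.+1 ^+ 2.
Proof.
case: (pm_case p) => [[x ->]|h]; last by rewrite (pm0 _ h) mul0r sqr_ge0.
case: (pm_case x.+3) => [[z zE]|h]; last by rewrite (pm0 _ h) mulr0 sqr_ge0.
case: (pm_case x.+2) => [[y yE]|h]; last first.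
  by exfalso; move: h (ltn_ord z) zE; clear; lia.
rewrite (congr1 (pm b) zE) (congr1 (pm b) yE) !pmS.
case: zE => zE; case: yE => yE.
have [i0 [i1 [_ csupp clc]]] := c_lc; have [c0 _] := c_inst.
have cc : c x * c z <= c y ^+ 2.
  have [h|h] := boolP (i0 < y < i1)%N; first by apply: clc => //; rewrite -?zE -?yE.
  have : (c x == 0) || (c z == 0).
    rewrite -[c x == 0]negbK -[c z == 0]negbK !csupp; lia.
  by case/orP => /eqP ->; rewrite ?mul0r ?mulr0 sqr_ge0.
have -> : gibbs c b x * gibbs c b z = c x * c z *
    (expR (b * y%:R) / partition_fun c b) ^+ 2.
  have E : expR (b * x%:R) * expR (b * z%:R) = expR (b * y%:R) * expR (b * y%:R).
    rewrite -!expRD; congr expR; rewrite -!mulrDr; congr (_ * _).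
    by rewrite -!natrD; congr _%:R; move: zE yE; clear; lia.
  transitivity (c x * c z * (expR (b * x%:R) * expR (b * z%:R)) *
      ((partition_fun c b)^-1 * (partition_fun c b)^-1)); first by rewrite /gibbs; ring.
  by rewrite E; ring.
by rewrite /gibbs -[X in _ <= X ^+ 2]mulrA [leRHS]exprMn ler_wpM2r // sqr_ge0.
Qed.

Lemma pm_gt0_interval b i j k : (i <= j <= k)%N -> 0 < pm b i -> 0 < pm b k -> 0 < pm b j.
Proof.
move=> ijk; case: (pm_case i) => [[x xE]|h]; last by rewrite (pm0 _ h) ltxx.
case: (pm_case k) => [[z zE]|h]; last by rewrite (pm0 b h) ltxx.
case: (pm_case j) => [[y yE]|h]; last by move: h (ltn_ord z); lia.
have [i0 [i1 [_ csupp _]]] := c_lc; have [c0 _] := c_inst.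
have supp w : (0 < pm b (w : 'I_n.+1).+1) = (i0 <= w <= i1)%N.
  rewrite pmS -csupp /gibbs lt_neqAle.
  have Z := partition_fun_gt0 c_inst b; have E := expR_gt0 (b * w%:R).
  rewrite divr_ge0 ?mulr_ge0 ?(ltW E) ?(ltW Z) // andbT eq_sym.
  by rewrite !mulf_eq0 invr_eq0 (gt_eqF Z) (gt_eqF E) !orbF.
by rewrite xE yE zE !supp; lia.
Qed.

Lemma log_concave_side_bound : side_bound (expR 1).
Proof.
move=> b e M en M0; split=> H.
  rewrite left_mass_sum //; apply: geometric_sum_bound => //.
  - by move=> j; exact: pm_ge0.
  (* Truncated subtraction sends every larger [j] to position 0, which has no mass. *)
  - move=> j; have [h|h] := leqP j.+2 e.+1; last first.
      by rewrite [pm b (_ - j.+2)]pm0 ?mulr0 ?sqr_ge0 //; lia.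
    have := pm_log_concave b (e.+1 - j.+2)%N; rewrite mulrC.
    by congr (pm b _ * pm b _ <= pm b _ ^+ 2); lia.
  - move=> i j k ijk hi hk; apply: pm_gt0_interval hk hi; lia.
  - by rewrite pm0 // subnn.
  move=> j j1; have := H (e.+1 - j)%N; rewrite subKn; last by lia.
  by apply; lia.
rewrite right_mass_sum //; apply: geometric_sum_bound => //.
- by move=> j; exact: pm_ge0.
- by move=> j; rewrite !addnS; exact: pm_log_concave.
- move=> i j k ijk hi hk; apply: pm_gt0_interval hi hk; lia.
- by rewrite pm0 //; lia.
move=> j j1; have := H (e + j)%N; rewrite addKn; apply; lia.
Qed.

End Positions.

(** * Covering the gaps *)

Section Selection.
Context {R : realType}.
Implicit Types (v vh : nat -> R).

Definition argmax v k0 (s : seq nat) : nat :=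
  foldr (fun p q => if v q < v p then p else q) k0 s.

Lemma argmax_mem v k0 s : argmax v k0 s \in k0 :: s.
Proof.
elim: s => [|p s IH] /=; first by rewrite inE.
by case: ifP => _; move: IH; rewrite !inE ?eqxx ?orbT // => /orP[->|->] //; rewrite !orbT.
Qed.

Lemma argmaxP v k0 s p : p \in k0 :: s -> v p <= v (argmax v k0 s).
Proof.
elim: s => [|q s IH] /=; first by rewrite inE => /eqP ->.
rewrite !inE orbCA => /predU1P[->|h]; first by case: ltP.
have {}h := IH h; case: ltP => // hq; exact: le_trans h (ltW hq).
Qed.

(* The incumbent [k0] is kept unless it is clearly beaten, so that approximation errors do
   not accumulate when the winner becomes the next incumbent. *)
Definition select (eps : R) v k0 (s : seq nat) : nat :=
  let k1 := argmax v k0 s in if (1 + 4 * eps) * v k0 < v k1 then k1 else k0.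

Lemma select_mem eps v k0 s : select eps v k0 s \in k0 :: s.
Proof. by rewrite /select; case: ifP => _; [exact: argmax_mem|rewrite inE eqxx]. Qed.

(** If the challenger wins, either the incumbent was below [(1 - 2 * eps) * m], which the challenger
    reaches, or the lead of [4 * eps] exceeds both sampling errors. If it loses, the incumbent is
    within a factor [1 + 8 * eps] of the maximum. *)
Lemma select_near_max eps v vh k0 s m : 0 < eps <= 100^-1 -> 0 <= m ->
  (forall p, p \in k0 :: s -> v p <= m) ->
  (exists2 p, p \in k0 :: s & v p = m) ->
  (forall p, p \in k0 :: s -> `|vh p - v p| <= eps * m) ->
  m <= (1 + 8 * eps) * v (select eps vh k0 s) /\ v k0 <= v (select eps vh k0 s).
Proof.
move=> /andP[e0 e1] m0 vm [pm pms pmE] near.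
have em0 : 0 <= eps * m by rewrite mulr_ge0 // ltW.
have eem : eps * (eps * m) <= 100^-1 * (eps * m) by rewrite ler_wpM2r.
have eeem : eps * (eps * (eps * m)) <= 100^-1 * (eps * (eps * m)).
  by rewrite ler_wpM2r // mulr_ge0 // ltW.
have eem0 : 0 <= eps * (eps * m) by rewrite mulr_ge0 // ltW.
have h1 := argmaxP vh pms; have hk1 := argmax_mem vh k0 s.
have := near _ pms; rewrite pmE ler_norml => /andP[a1 a2].
have k0s : k0 \in k0 :: s by rewrite inE eqxx.
have := near _ hk1; have := near _ k0s; have := vm _ k0s.
rewrite /select; set k1 := argmax vh k0 s in h1 hk1 *.
rewrite !ler_norml => v0m /andP[b1 b2] /andP[c1 c2].
have vk1 : (1 - 2 * eps) * m <= v k1 by lra.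
case: ltP => h; split=> //.
- apply: (@le_trans _ _ ((1 + 8 * eps) * ((1 - 2 * eps) * m))); first by lra.
  by rewrite ler_wpM2l //; lra.
- have [hv|hv] := leP (v k0) ((1 - 2 * eps) * m); first exact: le_trans vk1.
  have : (1 + 4 * eps) * (v k0 - eps * m) <= (1 + 4 * eps) * vh k0.
    by rewrite ler_wpM2l //; lra.
  have : eps * ((1 - 2 * eps) * m) <= eps * v k0 by rewrite ler_wpM2l // ltW.
  lra.
have h2 : (1 + 4 * eps) * vh k0 <= (1 + 4 * eps) * (v k0 + eps * m).
  by rewrite ler_wpM2l //; lra.
have h3 : (1 - 2 * eps - 4 * eps * eps) * m <= (1 + 4 * eps) * v k0 by lra.
have h4 : 0 < 1 - 2 * eps - 4 * eps * eps by nra.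
have h5 : 1 + 4 * eps <= (1 + 8 * eps) * (1 - 2 * eps - 4 * eps * eps).
  have : eps * eps <= 100^-1 * eps by rewrite ler_wpM2r // ltW.
  have : eps * (eps * eps) <= 100^-1 * (eps * eps) by rewrite ler_wpM2r // mulr_ge0 // ltW.
  have : 0 <= eps * eps by rewrite mulr_ge0 // ltW.
  lra.
rewrite -(ler_pM2l h4); apply: (le_trans h3).
have v00 : 0 <= v k0.
  have : 0 <= (1 + 4 * eps) * v k0 by apply: le_trans h3; rewrite mulr_ge0 // ltW.
  by rewrite pmulr_rge0 //; lra.
by rewrite mulrA ler_wpM2r // [leRHS]mulrC.
Qed.

End Selection.

Fixpoint All T (P : T -> Prop) (s : seq T) : Prop :=
  if s is x :: s' then P x /\ All P s' else True.

Lemma All_cat T (P : T -> Prop) s1 s2 : All P s1 -> All P s2 -> All P (s1 ++ s2).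
Proof. by move=> h1 h2; elim: s1 h1 => //= x s IH [h /IH]. Qed.

Record item := Item { ilo : nat; iedge : nat; ihi : nat }.

Section FindDef.
Context {R : realType} (n : nat).
Variables (bmin bmax eps : R) (bt : nat -> R) (K : nat).

Definition find_size (loA hiC : nat) : nat := K * (hiC - loA).

(** Only positions between the winners of the neighbours are candidates. The sample size is
    proportional to the window, since a maximiser may have mass as small as about 1 over [rho] times
    its length. *)
Definition find (loA hiC e : nat) : tree R n item :=
  let N := find_size loA hiC in
  bind (sample N (bt e)) (fun xs =>
    let f p : R := freq N (at_pos p) xs in
    Ret (Item
      (if bt e == bmin then 0%N else
         select eps (fun p => (e.+1 - p)%:R * f p) (maxn loA 1) (index_iota (maxn loA 1) e.+1))
      e
      (if bt e == bmax then n.+2 else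
         select eps (fun p => (p - e)%:R * f p) (minn hiC n.+1)
           (index_iota e.+1 (minn hiC n.+1).+1)))).

(** Returns the items after [A] up to and including [C]. An item at threshold [e] spans the
    positions [e] and [e.+1], which lie between [ihi A] and [ilo C]; so each remaining gap is at
    most about half as long. *)
Fixpoint fill (fuel : nat) (A C : item) : tree R n (seq item) :=
  if fuel is f.+1 then
    if (ilo C <= ihi A)%N then Ret [:: C] else
    let e := ((ihi A + (ilo C).-1) %/ 2)%N in
    bind (find (ilo A) (ihi C) e) (fun B =>
      bind (fill f A B) (fun s1 => bind (fill f B C) (fun s2 => Ret (s1 ++ s2))))
  else Ret [:: C].

Definition skeleton (fuel : nat) : tree R n (seq item) :=
  bind (find 0 n.+2 0) (fun A => bind (find 0 n.+2 n.+1) (fun C =>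
    bind (fill fuel A C) (fun s => Ret (A :: s)))).

End FindDef.

Section FindProof.
Context {R : realType} {n : nat}.
Variables (c : 'I_n.+1 -> R) (bmin bmax : R).
Hypothesis c_inst : is_instance c.
Hypothesis bmm : bmin < bmax.

Local Notation nu := (ker c bmin bmax).
Let nu0 := ker_ge0 bmin bmax c_inst.
Let nu1 := ker_sum1 bmin bmax c_inst.

Variables (rh eps : R) (bt : nat -> R) (K l : nat).
Hypothesis rh_ge1 : 1 <= rh.
Hypothesis eps01 : 0 < eps <= 100^-1.
Hypothesis c_side : side_bound c rh.
Hypothesis bt_in : forall e, bmin <= bt e <= bmax.
Hypothesis bt_homo : forall e e', (e <= e')%N -> bt e <= bt e'.
Hypothesis bt0 : bt 0 = bmin.
Hypothesis bt1 : bt n.+1 = bmax.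
Hypothesis K_gt0 : (0 < K)%N.
Hypothesis K_large : 128 * l%:R * rh <= K%:R * eps ^+ 2.

Local Notation find := (find n bmin bmax eps bt K).
Local Notation fill := (fill n bmin bmax eps bt K).

Definition wf (B : item) : Prop :=
  [/\ (ilo B <= iedge B < ihi B)%N, (ihi B <= n.+2)%N,
      (ilo B == 0%N) = (bt (iedge B) == bmin) &
      (ihi B == n.+2) = (bt (iedge B) == bmax)].

Definition find_spec (loA hiC e : nat) (B : item) : Prop :=
  [/\ wf B, iedge B = e, bt e != bmin -> (loA <= ilo B)%N
    & bt e != bmax -> (ihi B <= hiC)%N].

Lemma sure_find loA hiC e : (loA <= e < hiC)%N -> (hiC <= n.+2)%N ->
  sure (find loA hiC e) (find_spec loA hiC e).
Proof.
move=> /andP[h1 h2] h3; apply: sure_bind (sure_true _) _ => xs _ /=.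
set vl := fun p : nat => _; set vr := fun p : nat => _.
have := select_mem eps vl (maxn loA 1) (index_iota (maxn loA 1) e.+1).
have := select_mem eps vr (minn hiC n.+1) (index_iota e.+1 (minn hiC n.+1).+1).
set x := select _ vl _ _; set y := select _ vr _ _.
rewrite !inE !mem_index_iota => hy hx.
have e1 : bt e != bmin -> (1 <= e)%N by case: (e) => //; rewrite bt0 eqxx.
have e2 : bt e != bmax -> (e <= n)%N.
  move=> h; have : (e <= n.+1)%N by move: h2 h3; clear; lia.
  by rewrite leq_eqVlt => /predU1P[eE|//]; rewrite eE bt1 eqxx in h.
split=> //=; first split=> /=.
- apply/andP; split.
    by case: ifPn => // /e1; move: hx h1 => /=; clear; lia.
  by case: ifPn => [_|/e2]; move: hy h2 h3; clear; lia.
- by case: ifPn => // _; move: hy h3; clear; lia.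
- by case: ifPn => // /e1; move: hx; clear; lia.
- by case: ifPn => [|/e2]; rewrite ?eqxx //; move: hy; clear; lia.
- by move=> b1; rewrite (negbTE b1); move: hx; clear; lia.
- by move=> b2; rewrite (negbTE b2); move: hy (e2 b2) h2; clear; lia.
Qed.

Definition vL e p : R := (e.+1 - p)%:R * pm c (bt e) p.
Definition vR e p : R := (p - e)%:R * pm c (bt e) p.
Definition slack : R := 1 + 8 * eps.

(** Optimality concerns the whole side, although only a window of it is searched; an end at infinity
    requires nothing. *)
Definition optL (B : item) : Prop := ilo B != 0%N ->
  (forall p, (1 <= p <= iedge B)%N -> vL (iedge B) p <= slack * vL (iedge B) (ilo B)) /\
  2^-1 - eps <= rh * (slack * vL (iedge B) (ilo B)).

Definition optR (B : item) : Prop := ihi B != n.+2 ->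
  (forall p, (iedge B < p <= n.+1)%N -> vR (iedge B) p <= slack * vR (iedge B) (ihi B)) /\
  2^-1 - eps <= rh * (slack * vR (iedge B) (ihi B)).

(** What makes the window harmless: its boundary position already dominates everything outside. *)
Definition preL loA e : Prop := forall p, (1 <= p < maxn loA 1)%N ->
  vL e p <= slack * vL e (maxn loA 1).

Definition preR hiC e : Prop := forall p, (minn hiC n.+1 < p <= n.+1)%N ->
  vR e p <= slack * vR e (minn hiC n.+1).

Lemma rh_gt0 : 0 < rh.
Proof. exact: lt_le_trans ltr01 rh_ge1. Qed.

Lemma slack_ge1 : 1 <= slack.
Proof. by move: eps01; rewrite /slack => /andP[]; lra. Qed.

Lemma slack_le : slack <= 108 / 100.
Proof. by move: eps01; rewrite /slack => /andP[]; lra. Qed.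

Lemma vL_ge0 e p : 0 <= vL e p.
Proof. by rewrite mulr_ge0 // pm_ge0. Qed.

Lemma vR_ge0 e p : 0 <= vR e p.
Proof. by rewrite mulr_ge0 // pm_ge0. Qed.

(* Since the dominance ratio [pm _ q / pm _ p] and the distance ratio move the same way with
   the threshold, a near-maximiser for one threshold dominates whatever lies beyond it for
   every further threshold. *)
Lemma dominance_transfer b b' p q (D1 D2 d1 d2 : nat) :
  0 < pm c b q -> (0 < D2)%N -> (d1 * D2 <= D1 * d2)%N ->
  pm c b q * pm c b' p <= pm c b' q * pm c b p ->
  D1%:R * pm c b p <= slack * (D2%:R * pm c b q) ->
  d1%:R * pm c b' p <= slack * (d2%:R * pm c b' q).
Proof.
move=> q0 D20 dD cross H.
have D20' : 0 < D2%:R :> R by rewrite ltr0n.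
rewrite -(ler_pM2l (mulr_gt0 D20' q0)).
apply: (@le_trans _ _ ((D1 * d2)%:R * (pm c b' q * pm c b p))).
  have -> : D2%:R * pm c b q * (d1%:R * pm c b' p) =
      (d1 * D2)%:R * (pm c b q * pm c b' p) by rewrite natrM; ring.
  by apply: ler_pM => //; rewrite ?ler_nat // mulr_ge0 ?pm_ge0.
have -> : (D1 * d2)%:R * (pm c b' q * pm c b p) =
    (d2%:R * pm c b' q) * (D1%:R * pm c b p) by rewrite natrM; ring.
have -> : D2%:R * pm c b q * (slack * (d2%:R * pm c b' q)) =
    (d2%:R * pm c b' q) * (slack * (D2%:R * pm c b q)) by ring.
by rewrite ler_wpM2l // mulr_ge0 // pm_ge0.
Qed.

Lemma quality_pos x : 2^-1 - eps <= rh * (slack * x) -> 0 < x.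
Proof.
move: eps01 => /andP[e0 e1] h; have k1 := slack_ge1.
have : 0 < rh * (slack * x) by lra.
have r0 := rh_gt0.
have k0 : 0 < slack by lra.
by rewrite !pmulr_rgt0.
Qed.

Lemma transferL A e : wf A -> optL A -> (iedge A <= e)%N -> preL (ilo A) e.
Proof.
move=> [h1 _ _ _] hA eA p; have [->|lo0] := eqVneq (ilo A) 0%N; first by case: p.
have [H Q] := hA lo0.
have -> : maxn (ilo A) 1 = ilo A by move: lo0; clear; lia.
move=> /andP[p1 p2]; have := quality_pos Q.
rewrite /vL pmulr_rgt0 => [q0|]; last by rewrite ltr0n; move: h1; clear; lia.
have Hp : vL (iedge A) p <= slack * vL (iedge A) (ilo A).
  by apply: H; move: h1 p1 p2; clear; lia.
apply: (dominance_transfer q0 _ _ _ Hp).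
- by move: h1; clear; lia.
(* In terms of the three lengths [i], [j], [k] the claim is [(i + j + k) * j <= (j + k) * (i + j)];
   the difference is [i * k]. *)
- have -> : (e.+1 - p = e - iedge A + (iedge A - ilo A).+1 + (ilo A - p))%N.
    by move: h1 eA p2; clear; lia.
  have -> : ((iedge A).+1 - p = (iedge A - ilo A).+1 + (ilo A - p))%N.
    by move: h1 eA p2; clear; lia.
  have -> : ((iedge A).+1 - ilo A = (iedge A - ilo A).+1)%N.
    by move: h1 eA p2; clear; lia.
  have -> : (e.+1 - ilo A = e - iedge A + (iedge A - ilo A).+1)%N.
    by move: h1 eA p2; clear; lia.
  by move: (e - _)%N (_ - p)%N (iedge A - _)%N; clear; nia.
- by apply: pm_cross => //; [exact: bt_homo|exact: ltnW].
Qed.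

Lemma transferR C e : wf C -> optR C -> (e <= iedge C)%N -> preR (ihi C) e.
Proof.
move=> [h1 h2 _ _] hC eC p; have [->|hi0] := eqVneq (ihi C) n.+2.
  by rewrite (_ : minn n.+2 n.+1 = n.+1); [case: ltngtP|clear; lia].
have [H Q] := hC hi0.
have -> : minn (ihi C) n.+1 = ihi C by move: hi0 h2; clear; lia.
move=> /andP[p1 p2]; have := quality_pos Q.
rewrite /vR pmulr_rgt0 => [q0|]; last by rewrite ltr0n; move: h1; clear; lia.
have Hp : vR (iedge C) p <= slack * vR (iedge C) (ihi C).
  by apply: H; move: h1 p1 p2; clear; lia.
apply: (dominance_transfer q0 _ _ _ Hp).
- by move: h1; clear; lia.
- have -> : (p - e = iedge C - e + (ihi C - iedge C) + (p - ihi C))%N.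
    by move: h1 eC p1; clear; lia.
  have -> : (p - iedge C = (ihi C - iedge C) + (p - ihi C))%N.
    by move: h1 eC p1; clear; lia.
  have -> : (ihi C - e = iedge C - e + (ihi C - iedge C))%N.
    by move: h1 eC p1; clear; lia.
  by move: (_ - e)%N (_ - ihi C)%N (_ - iedge C)%N; clear; nia.
- have := pm_cross c_inst (bt_homo eC) (ltnW p1); lra.
Qed.

Lemma ker_in b : bmin <= b <= bmax -> nu b = gibbs c b.
Proof. by move=> h; rewrite /ker clip_id. Qed.

Lemma accurate_pos N b w xs p : 0 < w -> bmin <= b <= bmax ->
  accurate nu N b w eps xs ->
  `|freq N (at_pos p) xs - pm c b p| <= eps * Num.max (pm c b p) w.
Proof.
move=> w0 hb acc; case: (pm_case (n := n) p) => [[x ->]|h].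
  have -> : freq N (at_pos x.+1) xs = freq N (pred1 x) xs :> R.
    by rewrite /freq; congr (_%:R / _); apply: eq_count => y; rewrite /at_pos /= eqSS.
  by have := acc x; rewrite ker_in // pmS.
rewrite pm0 // /freq (_ : count _ _ = 0%N) ?mul0r ?subrr ?normr0.
  by move: eps01 => /andP[e0 _]; rewrite mulr_ge0 ?(ltW e0) // le_max lexx.
apply/eqP; rewrite -leqn0 leqNgt -has_count; apply/hasPn => y _.
by rewrite /at_pos; apply: contra h => /eqP <- /=; rewrite ltn_ord.
Qed.

(** By [S] the maximum [m] is at least [1 / (4 * rh)]. A mass error [eps * w] with
    [w = 1 / (4 * rh * L)], multiplied by a distance at most [L], is therefore at most [eps * m], as
    [select_near_max] requires. *)
Lemma select_side b (d : nat -> nat) k0 s L N xs :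
  bmin <= b <= bmax -> (0 < L)%N ->
  accurate nu N b (4 * rh * L%:R)^-1 eps xs ->
  (forall p, p \in k0 :: s -> (d p <= L)%N) ->
  (forall M, 0 <= M -> (forall p, p \in k0 :: s -> (d p)%:R * pm c b p <= M) ->
     2^-1 - eps <= rh * (slack * M)) ->
  let k := select eps (fun p => (d p)%:R * freq N (at_pos p) xs) k0 s in
  (forall p, p \in k0 :: s -> (d p)%:R * pm c b p <= slack * ((d k)%:R * pm c b k)) /\
  (d k0)%:R * pm c b k0 <= (d k)%:R * pm c b k.
Proof.
move=> hb L0 acc dL S; set v := fun p => (d p)%:R * pm c b p.
set vh := fun p => (d p)%:R * freq N (at_pos p) xs.
pose m := v (argmax v k0 s).
have L0' : 0 < L%:R :> R by rewrite ltr0n.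
have rh0 := rh_gt0.
have m0 : 0 <= m by rewrite mulr_ge0 // pm_ge0.
have vm p : p \in k0 :: s -> v p <= m by exact: argmaxP.
have m4 : (4 * rh)^-1 <= m.
  have := S m m0 vm; move: eps01 => /andP[e0 e1] h.
  rewrite -[leLHS]mul1r ler_pdivrMr ?mulr_gt0 //.
  have : rh * (slack * m) <= rh * (108 / 100 * m).
    by rewrite ler_wpM2l ?(ltW rh0) // ler_wpM2r // slack_le.
  lra.
have [||h1 h2] := @select_near_max R eps v vh k0 s m eps01 m0 vm.
- by exists (argmax v k0 s) => //; exact: argmax_mem.
- move=> p ps; rewrite -mulrBr normrM ger0_norm //.
  have w0 : 0 < (4 * rh * L%:R)^-1 by rewrite invr_gt0 !mulr_gt0.
  have := accurate_pos p w0 hb acc; move: eps01 => /andP[e0 e1] h.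
  apply: le_trans (ler_wpM2l (ler0n _ _) h) _.
  rewrite mulrCA ler_pM2l // maxr_pMr // ge_max vm // andTb.
  apply: le_trans m4; rewrite invfM mulrCA -[leRHS]mulr1 ler_wpM2l ?invr_ge0 ?mulr_ge0 ?(ltW rh0)
    //.
  by rewrite ler_pdivrMr // mul1r ler_nat dL.
by split => // p ps; apply: le_trans (vm p ps) _.
Qed.

Definition failure_bound : R := n.+1%:R * (2 * expR (- (8 * l%:R))).

Lemma failure_bound_ge0 : 0 <= failure_bound.
Proof. by rewrite !mulr_ge0 ?expR_ge0. Qed.

Lemma err_find loA hiC e : (loA <= e < hiC)%N -> (hiC <= n.+2)%N ->
  preL loA e -> preR hiC e ->
  (bt e = bmin \/ 2^-1 - eps <= 1 - tail c (bt e) e) ->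
  (bt e = bmax \/ 2^-1 - eps <= tail c (bt e) e) ->
  err nu (find loA hiC e) (fun B => optL B /\ optR B) <= failure_bound.
Proof.
move=> hlo hhi pL pR bL bR; have /andP[h1 h2] := hlo.
have en : (e <= n.+1)%N by move: h2 hhi; clear; lia.
have L0 : (0 < hiC - loA)%N by move: h1 h2; clear; lia.
have L0' : 0 < (hiC - loA)%:R :> R by rewrite ltr0n.
have rh0 := rh_gt0.
have k1 := slack_ge1.
have e01 : 0 < eps <= 2^-1 by move: eps01 => /andP[a1 a2]; lra.
rewrite -[failure_bound]addr0; set w := (4 * rh * (hiC - loA)%:R)^-1.
apply: (err_bind nu0 nu1 (P := accurate nu (find_size K loA hiC) (bt e) w eps)) => //.
  apply: le_trans (err_accurate nu0 nu1 _ _ _ e01) _.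
  - by rewrite muln_gt0 K_gt0.
  - by rewrite invr_gt0 !mulr_gt0.
  rewrite ler_wpM2l // ler_wpM2l // ler_expR lerN2 natrM /w.
  have -> : K%:R * (hiC - loA)%:R * (4 * rh * (hiC - loA)%:R)^-1 * eps ^+ 2 / 4 =
    K%:R * eps ^+ 2 / (16 * rh) by field; rewrite !gt_eqF.
  by rewrite ler_pdivlMr ?mulr_gt0 //; have := K_large; lra.
move=> xs acc; rewrite le_eqVlt err_sure ?eqxx //=.
have e1 : bt e != bmin -> (1 <= e)%N by case: (e) => //; rewrite bt0 eqxx.
have e2 : bt e != bmax -> (e <= n)%N.
  by move: en; rewrite leq_eqVlt => /predU1P[->|//]; rewrite bt1 eqxx.
split.
- have [bE|b1] := eqVneq (bt e) bmin; first by [].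
  rewrite /optL /= => _.
  have {}bL : 2^-1 - eps <= 1 - tail c (bt e) e.
    by case: bL => // bE; move: b1; rewrite bE eqxx.
  set k0 := maxn loA 1; set s := index_iota _ _.
  have k0e : (k0 <= e)%N by move: (e1 b1) h1; rewrite /k0; clear; lia.
  have mem p : p \in k0 :: s = (k0 <= p <= e)%N.
    by rewrite inE mem_index_iota; move: k0e; clear; lia.
  have [||Hr Hk] := select_side (k0 := k0) (s := s) (d := fun p => (e.+1 - p)%N) (bt_in e) L0 acc.
  + by move=> p; rewrite mem /k0; move: h2; clear; lia.
  (* [pL] extends a bound [M] on the window to [slack * M] on the whole left side, to which [c_side]
     applies. *)
  + move=> M M0 HM; apply: (le_trans bL).
    have kM : 0 <= slack * M by rewrite mulr_ge0 //; lra.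
    apply: (c_side (bt e) en kM).1 => p /andP[p1 p2].
    have [pk|pk] := ltnP p k0.
      apply: le_trans (pL p _) _; first by rewrite p1.
      by rewrite ler_wpM2l //; [lra|apply: HM; rewrite mem leqnn].
    apply: le_trans (HM p _) _; first by rewrite mem pk.
    by rewrite ler_peMl.
  set k := select _ _ _ _ in Hr Hk *.
  (* Outside the window the domination by [k0] already spends the factor [slack]; [Hk] passes from
     [k0] to [k] at no further loss. *)
  have all p : (1 <= p <= e)%N -> vL e p <= slack * vL e k.
    move=> /andP[p1 p2]; have [pk|pk] := ltnP p k0; last by apply: Hr; rewrite mem pk.
    apply: le_trans (pL p _) _; first by rewrite p1.
    by rewrite ler_wpM2l //; lra.
  split=> //; apply: le_trans bL _; apply: (c_side (bt e) en _).1 => //.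
  by rewrite mulr_ge0 ?vL_ge0 //; lra.
have [bE|b1] := eqVneq (bt e) bmax; first by rewrite /optR /= eqxx.
rewrite /optR /= => _.
have {}bR : 2^-1 - eps <= tail c (bt e) e.
  by case: bR => // bE; move: b1; rewrite bE eqxx.
set k0 := minn hiC n.+1; set s := index_iota _ _.
have k0e : (e < k0)%N by move: (e2 b1) h2; rewrite /k0; clear; lia.
have mem p : p \in k0 :: s = (e < p <= k0)%N.
  by rewrite inE mem_index_iota; move: k0e; clear; lia.
have [||Hr Hk] := select_side (k0 := k0) (s := s) (d := fun p => (p - e)%N) (bt_in e) L0 acc.
+ by move=> p; rewrite mem /k0; move: h1; clear; lia.
+ move=> M M0 HM; apply: (le_trans bR).
  have kM : 0 <= slack * M by rewrite mulr_ge0 //; lra.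
  apply: (c_side (bt e) en kM).2 => p /andP[p1 p2].
  have [pk|pk] := ltnP k0 p.
    apply: le_trans (pR p _) _; first by rewrite pk.
    by rewrite ler_wpM2l //; [lra|apply: HM; rewrite mem leqnn k0e].
  apply: le_trans (HM p _) _; first by rewrite mem pk p1.
  by rewrite ler_peMl.
set k := select _ _ _ _ in Hr Hk *.
have all p : (e < p <= n.+1)%N -> vR e p <= slack * vR e k.
  move=> /andP[p1 p2]; have [pk|pk] := ltnP k0 p; last by apply: Hr; rewrite mem pk p1.
  apply: le_trans (pR p _) _; first by rewrite pk.
  by rewrite ler_wpM2l //; lra.
split=> //; apply: le_trans bR _; apply: (c_side (bt e) en _).2 => //.
by rewrite mulr_ge0 ?vR_ge0 //; lra.
Qed.

Definition ordered (A C : item) : bool :=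
  [&& (ilo A <= ilo C)%N, (ihi A <= ihi C)%N & (iedge A <= iedge C)%N].

Definition linked (A B : item) : bool := ordered A B && (ilo B <= ihi A)%N.

Lemma find_ordered A B C e : wf A -> wf C -> (ihi A <= e < ilo C)%N ->
  find_spec (ilo A) (ihi C) e B -> ordered A B && ordered B C.
Proof.
move=> [/andP[a1 a2] a3 a4 a5] [/andP[c1 c2] c3 c4 c5] /andP[h1 h2].
move=> [[/andP[b1 b2] b3 b4 b5] eB lB rB].
have l1 : (ilo A <= ilo B)%N.
  (* If [e] sits at [bmin], so does the smaller threshold of [A], hence [A] starts at 0 as well. *)
  have [bE|/lB//] := eqVneq (bt e) bmin.
  suff : ilo A == 0%N by move=> /eqP ->.
  rewrite a4 eq_le; case/andP: (bt_in (iedge A)) => -> _; rewrite andbT -bE.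
  by apply: bt_homo; move: a1 a2 h1; clear; lia.
have r1 : (ihi B <= ihi C)%N.
  have [bE|/rB//] := eqVneq (bt e) bmax.
  suff : ihi C == n.+2 by move=> /eqP ->.
  rewrite c5 eq_le; case/andP: (bt_in (iedge C)) => _ ->; rewrite andTb -bE.
  by apply: bt_homo; move: c1 c2 h2; clear; lia.
rewrite /ordered l1 r1 eB; move: eB a1 a2 c1 c2 h1 h2 b1 b2; clear; lia.
Qed.

Definition fill_spec (A C : item) (s : seq item) : Prop :=
  [/\ path linked A s, last A s = C & All wf s].

Lemma gap_mid (x y f : nat) : (x < y)%N -> (y - x < 2 ^ f.+1)%N ->
  [/\ (x <= (x + y.-1) %/ 2 < y)%N,
      forall z, (z <= (x + y.-1) %/ 2)%N -> (z - x < 2 ^ f)%N &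
      forall z, ((x + y.-1) %/ 2 < z)%N -> (y - z < 2 ^ f)%N].
Proof.
rewrite expnS; move: (2 ^ f)%N => w xy yx.
have := divn_eq (x + y.-1) 2; have := ltn_pmod (x + y.-1) (isT : 0 < 2)%N.
move: (_ %/ _)%N (_ %% _)%N => q m h1 h2.
by split => [|z hz|z hz]; lia.
Qed.

Lemma sure_fill f A C : wf A -> wf C -> ordered A C -> (ilo C - ihi A < 2 ^ f)%N ->
  sure (fill f A C) (fill_spec A C).
Proof.
elim: f A C => [|f IH] A C wA wC oAC /= h.
  by split; rewrite //= andbT /linked oAC /=; move: h; clear; lia.
case: leqP => h1; first by split; rewrite //= andbT /linked oAC.
have [/andP[m1 m2] gl gr] := gap_mid h1 h.
set e := (_ %/ 2)%N in m1 m2 gl gr *.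
have [/andP[a1 a2] a3 _ _] := wA; have [/andP[c1 c2] c3 _ _] := wC.
have hle : (ilo A <= e < ihi C)%N by move: a1 a2 c1 c2 m1 m2; clear; lia.
apply: sure_bind (sure_find hle c3) _ => B hB.
have := find_ordered wA wC _ hB; rewrite m1 m2 => /(_ isT) /andP[oAB oBC].
have [wB eB _ _] := hB; have [/andP[b1 b2] _ _ _] := wB; rewrite eB in b1 b2.
apply: sure_bind (IH _ _ wA wB oAB (gl _ b1)) _ => s1 [p1 q1 r1].
apply: sure_bind (IH _ _ wB wC oBC (gr _ b2)) _ => s2 [p2 q2 r2] /=.
by split; [rewrite cat_path p1 q1|rewrite last_cat q1|apply: All_cat].
Qed.

(* Does not increase when a gap is split, so that each level of the recursion costs at most
   [K * footprint]. *)
Definition footprint (A C : item) : nat :=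
  (if ilo C <= ihi A then 0 else
   (ihi A - ilo A) + (ihi C - ilo C) + 2 * (ilo C - ihi A))%N.

Lemma cost_find loA hiC e : cost nu (find loA hiC e) <= (K * (hiC - loA))%:R.
Proof.
by rewrite -[leRHS]addr0; apply: (cost_bind_le nu0 nu1 (sure_true _)); rewrite ?cost_sample.
Qed.

(** The new item is a neighbour in both subproblems, so its length is counted twice; this is paid by
    the factor 2 on the gap that it replaces. *)
Lemma cost_fill f A C : wf A -> wf C -> ordered A C ->
  cost nu (fill f A C) <= (K * f * footprint A C)%:R.
Proof.
elim: f A C => [|f IH] A C wA wC oAC //=.
case: leqP => h1 //=.
(* Only the location of the midpoint is used here, so any sufficiently large exponent will do. *)
have [|/andP[m1 m2] _ _] := gap_mid (f := ilo C) h1.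
  by apply: leq_trans (ltn_expl _ (isT : 1 < 2)%N) _; rewrite leq_exp2l // (leq_trans (leq_subr _
    _)).
set e := (_ %/ 2)%N in m1 m2 *.
have [/andP[a1 a2] a3 _ _] := wA; have [/andP[c1 c2] c3 _ _] := wC.
have hle : (ilo A <= e < ihi C)%N by move: a1 a2 c1 c2 m1 m2; clear; lia.
apply: (@le_trans _ _ ((K * (ihi C - ilo A))%:R + (K * f * footprint A C)%:R)).
  apply: (cost_bind_le nu0 nu1 (sure_find hle c3) (cost_find _ _ _)) => B hB.
  have := find_ordered wA wC _ hB; rewrite m1 m2 => /(_ isT) /andP[oAB oBC].
  have [wB eB _ _] := hB; have [/andP[b1 b2] _ _ _] := wB; rewrite eB in b1 b2.
  apply: (@le_trans _ _ ((K * f * footprint A B)%:R + ((K * f * footprint B C)%:R + 0))).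
    apply: (cost_bind_le nu0 nu1 (sure_true _) (IH _ _ wA wB oAB)) => s1 _.
    by apply: (cost_bind_le nu0 nu1 (sure_true _) (IH _ _ wB wC oBC)) => s2 _.
  rewrite addr0 -natrD ler_nat -mulnDr leq_mul2l; apply/orP; right.
  move: oAB oBC; rewrite /ordered /footprint => /and3P[x1 x2 _] /and3P[y1 y2 _].
  move: a1 a2 c1 c2 b1 b2 m1 m2 x1 x2 y1 y2 h1; clear.
  by case: (leqP (ilo B) (ihi A)); case: (leqP (ilo C) (ihi B)); case: (leqP (ilo C) (ihi A)); lia.
rewrite -natrD ler_nat (leq_trans (n := (K * footprint A C + K * f * footprint A C)%N)) //.
  rewrite leq_add2r leq_mul2l; apply/orP; right.
  move: oAC; rewrite /ordered /footprint => /and3P[x1 x2 _].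
  by move: a1 a2 c1 c2 x1 x2 h1; clear; case: (leqP (ilo C) (ihi A)); lia.
by rewrite mulnS mulnDl.
Qed.

Definition opt (B : item) : Prop := optL B /\ optR B.

Hypothesis balanced : forall e, (e <= n.+1)%N ->
  (bt e = bmin \/ 2^-1 - eps <= 1 - tail c (bt e) e) /\
  (bt e = bmax \/ 2^-1 - eps <= tail c (bt e) e).

(** A binary recursion of depth [f] makes at most [2 ^ f - 1] searches. The windows of a new item
    are justified by the optimality of its two neighbours, through the transfer lemmas. *)
Lemma err_fill f A C : wf A -> wf C -> ordered A C -> opt A -> opt C ->
  err nu (fill f A C) (All opt) <= (2 ^+ f - 1) * failure_bound.
Proof.
have d0 := failure_bound_ge0.
elim: f A C => [|f IH] A C wA wC oAC oA oC /=.
  by rewrite expr0 subrr mul0r err_sure.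
have p1 : 1 <= 2 ^+ f :> R by rewrite exprn_ege1 // ler1n.
case: leqP => h1 /=.
  rewrite err_sure //= mulr_ge0 // subr_ge0 exprS; lra.
have [|/andP[m1 m2] _ _] := gap_mid (f := ilo C) h1.
  by apply: leq_trans (ltn_expl _ (isT : 1 < 2)%N) _; rewrite leq_exp2l // (leq_trans (leq_subr _
    _)).
set e := (_ %/ 2)%N in m1 m2 *.
have [/andP[a1 a2] a3 _ _] := wA; have [/andP[c1 c2] c3 _ _] := wC.
have hle : (ilo A <= e < ihi C)%N by move: a1 a2 c1 c2 m1 m2; clear; lia.
have en : (e <= n.+1)%N by move: hle c3; clear; lia.
have [bL bR] := balanced en.
have pL : preL (ilo A) e by apply: (transferL wA oA.1); move: a2 m1; clear; lia.
have pR : preR (ihi C) e by apply: (transferR wC oC.2); move: c1 m2; clear; lia.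
have m0 : 0 <= (2 ^+ f - 1) * failure_bound by rewrite mulr_ge0 // subr_ge0.
apply: (@le_trans _ _ (failure_bound + ((2 ^+ f - 1) * failure_bound + ((2 ^+ f - 1) *
  failure_bound + 0)))); last first.
  by rewrite exprS; lra.
apply: (err_bind nu0 nu1 (P := fun B => find_spec (ilo A) (ihi C) e B /\ opt B)).
- apply: le_trans (err_find hle c3 pL pR bL bR).
  by apply: (err_sub_sure nu0 (sure_find hle c3)).
- by rewrite !addr_ge0.
move=> B [hB oB].
have := find_ordered wA wC _ hB; rewrite m1 m2 => /(_ isT) /andP[oAB oBC].
have [wB _ _ _] := hB.
apply: (err_bind nu0 nu1 (IH _ _ wA wB oAB oA oB)) => [|s1 hs1]; first by rewrite addr0.
apply: (err_bind nu0 nu1 (IH _ _ wB wC oBC oB oC)) => // s2 hs2.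
by rewrite err_sure //=; apply: All_cat.
Qed.

Local Notation skeleton := (skeleton n bmin bmax eps bt K).

Definition skeleton_spec (s : seq item) : Prop :=
  exists A s', [/\ s = A :: s', ilo A = 0%N, path linked A s',
    ihi (last A s') = n.+2 & All wf s].

Lemma first_last_spec A C : find_spec 0 n.+2 0 A -> find_spec 0 n.+2 n.+1 C ->
  [/\ wf A, wf C, ilo A = 0%N, ihi C = n.+2 & ordered A C].
Proof.
move=> [wA eA _ _] [wC eC _ _]; have [a1 a2 a3 a4] := wA; have [c1 c2 c3 c4] := wC.
have A0 : ilo A = 0%N by apply/eqP; rewrite a3 eA bt0 eqxx.
have C0 : ihi C = n.+2 by apply/eqP; rewrite c4 eC bt1 eqxx.
by split=> //; rewrite /ordered A0 C0 eA eC a2.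
Qed.

Lemma sure_skeleton f : (n.+2 < 2 ^ f)%N -> sure (skeleton f) skeleton_spec.
Proof.
move=> hf; apply: sure_bind (sure_find (hiC := n.+2) _ (leqnn _)) _ => // A hA.
apply: sure_bind (sure_find (hiC := n.+2) _ (leqnn _)) _ => [|C hC]; first by rewrite ltnSn.
have [wA wC A0 C0 oAC] := first_last_spec hA hC.
have [/andP[c1 c2] c3 _ _] := wC.
apply: sure_bind (sure_fill wA wC oAC _) _ => [|s [h1 h2 h3] /=].
  apply: leq_ltn_trans hf; apply: leq_trans (leq_subr _ _) _.
  exact: leq_trans c1 (leq_trans (ltnW c2) c3).
by exists A, s; split => //; rewrite h2.
Qed.

Lemma cost_skeleton f : cost nu (skeleton f) <= (K * (2 * n.+2 + f * (4 * n.+2)))%:R.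
Proof.
apply: (@le_trans _ _ ((K * (n.+2 - 0))%:R + ((K * (n.+2 - 0))%:R + ((K * f * (4 * n.+2))%:R +
  0)))).
  apply: (cost_bind_le nu0 nu1 (sure_find (hiC := n.+2) _ (leqnn _)) (cost_find _ _ _)) => // A hA.
  apply: (cost_bind_le nu0 nu1 (sure_find (hiC := n.+2) _ (leqnn _)) (cost_find _ _ _)) => [|C hC].
    by rewrite ltnSn.
  have [wA wC A0 C0 oAC] := first_last_spec hA hC.
  apply: (cost_bind_le nu0 nu1 (sure_true _)) => //.
  apply: (le_trans (cost_fill f wA wC oAC)); rewrite ler_nat leq_mul2l; apply/orP; right.
  have [/andP[a1 a2] a3 _ _] := wA; have [/andP[c1 c2] c3 _ _] := wC.
  rewrite /footprint; move: a1 a2 a3 c1 c2 c3; clear.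
  by case: ifP; lia.
rewrite addr0 -!natrD ler_nat; clear; nia.
Qed.

Lemma err_skeleton f : err nu (skeleton f) (All opt) <= (2 ^+ f + 1) * failure_bound.
Proof.
have d0 := failure_bound_ge0.
have p1 : 1 <= 2 ^+ f :> R by rewrite exprn_ege1 // ler1n.
have m0 : 0 <= (2 ^+ f - 1) * failure_bound by rewrite mulr_ge0 // subr_ge0.
have pre0 e : preL 0 e by move=> p; case: p.
have pre1 e : preR n.+2 e.
  by move=> p; rewrite (_ : minn n.+2 n.+1 = n.+1); [case: ltngtP|clear; lia].
have [b0L b0R] := balanced (leq0n n.+1); have [b1L b1R] := balanced (leqnn n.+1).
apply: (@le_trans _ _ (failure_bound + (failure_bound + ((2 ^+ f - 1) * failure_bound + 0))));
  last by lra.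
have hA : (0 <= 0 < n.+2)%N by [].
have hC : (0 <= n.+1 < n.+2)%N by rewrite ltnSn.
apply: (err_bind nu0 nu1 (P := fun B => find_spec 0 n.+2 0 B /\ opt B)).
- apply: le_trans (err_find hA (leqnn _) (pre0 _) (pre1 _) b0L b0R).
  by apply: (err_sub_sure nu0 (sure_find hA (leqnn _))).
- by rewrite !addr_ge0.
move=> A [sA oA].
apply: (err_bind nu0 nu1 (P := fun B => find_spec 0 n.+2 n.+1 B /\ opt B)).
- apply: le_trans (err_find hC (leqnn _) (pre0 _) (pre1 _) b1L b1R).
  by apply: (err_sub_sure nu0 (sure_find hC (leqnn _))).
- by rewrite addr0.
move=> C [sC oC].
have [wA wC _ _ oAC] := first_last_spec sA sC.
apply: (err_bind nu0 nu1 (err_fill f wA wC oAC oA oC)) => // s hs.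
by rewrite err_sure.
Qed.

(** The distance to the threshold is replaced by the full length, a weaker bound that survives when
    items are merged. *)
Definition quality (B : item) : Prop :=
  (ilo B != 0%N -> 2^-1 - eps <=
     rh * (slack * ((ihi B - ilo B)%:R * pm c (bt (iedge B)) (ilo B)))) /\
  (ihi B != n.+2 -> 2^-1 - eps <=
     rh * (slack * ((ihi B - ilo B)%:R * pm c (bt (iedge B)) (ihi B)))).

Lemma opt_quality B : wf B -> opt B -> quality B.
Proof.
move=> [/andP[b1 b2] _ _ _] [oL oR]; have r0 := rh_gt0; have k0 := slack_ge1.
split=> h; [have [_] := oL h|have [_] := oR h] => /le_trans; apply;
  rewrite ler_wpM2l ?(ltW r0) // ler_wpM2l ?(le_trans ler01 k0) //;
  rewrite ler_wpM2r ?pm_ge0 // ler_nat; move: b1 b2; clear; lia.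
Qed.

End FindProof.

(** * Thinning and certification *)

Record piece (R : Type) := Piece { pbeta : R; plo : nat; phi : nat }.
Arguments Piece {R}.

Section Thin.
Context {R : realType} (n : nat) (bmin bmax : R).
Implicit Types x y : piece R.

(** Pieces at one temperature are merged, because a schedule needs strictly increasing temperatures;
    [y] is dropped when the piece after it already overlaps [x]. *)
Fixpoint push x (r : seq (piece R)) : seq (piece R) :=
  match r with
  | [::] => [:: x]
  | y :: r' =>
    if pbeta x == pbeta y then push (Piece (pbeta x) (plo x) (phi y)) r'
    else if r' is z :: _ then if (plo z <= phi x)%N then push x r' else x :: r
    else x :: r
  end.

Definition thin (s : seq (piece R)) : seq (piece R) := foldr push [::] s.

Definition plinked x y : bool :=
  [&& pbeta x <= pbeta y, (plo x <= plo y)%N, (phi x <= phi y)%N & (plo y <= phi x)%N].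

(* Consecutive pieces overlap, but a piece ends before the second next one begins: every point
   is covered at most twice. *)
Fixpoint thinned (b : nat) x (r : seq (piece R)) : bool :=
  if r is y :: r' then
    [&& pbeta x < pbeta y, plinked x y, (b < plo y)%N & thinned (phi x) y r']
  else true.

Definition valid x : Prop :=
  [/\ bmin <= pbeta x <= bmax, (plo x < phi x <= n.+2)%N,
      plo x = 0%N -> pbeta x = bmin & phi x = n.+2 -> pbeta x = bmax].

Lemma thinned_le b b' x r : (b' <= b)%N -> thinned b x r -> thinned b' x r.
Proof.
case: r => //= y r bb /and4P[-> -> h ->]; rewrite andbT.
exact: leq_ltn_trans bb h.
Qed.

(** Dropping a piece preserves any property of all pieces, so merging is the only operation to
    check. *)
Definition merge_closed (Q : piece R -> Prop) : Prop := forall x y,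
  pbeta x = pbeta y -> plinked x y -> Q x -> Q y ->
  Q (Piece (pbeta x) (plo x) (phi y)).

Lemma valid_merge : merge_closed valid.
Proof.
move=> x y b /and4P[h1 h2 h3 h4] [a1 /andP[a2 a2'] a3 a4] [c1 /andP[c2 c2'] c3 c4]; split=> //=.
  by rewrite c2' andbT (leq_trans a2).
by rewrite b; exact: c4.
Qed.

Definition thin_spec (x : piece R) (y : piece R) (r0 r : seq (piece R)) : Prop :=
  exists x' r', [/\ r = x' :: r',
    [/\ pbeta x' = pbeta x, plo x' = plo x & (phi x <= phi x')%N], thinned 0 x' r',
    All valid r & phi (last x' r') = phi (last y r0) /\ pbeta (last x' r') = pbeta (last y r0)].

Lemma push_spec r : forall x y, plinked x y -> thinned 0 y r ->
  valid x -> All valid (y :: r) -> thin_spec x y r (push x (y :: r)).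
Proof.
elim: r => [|z r IH] x y xy yr vx [vy vr] /=.
  have [b1 b2 b3 b4] := and4P xy.
  case: eqVneq => bE.
    exists (Piece (pbeta x) (plo x) (phi y)), [::].
    by split => //=; split => //; apply: valid_merge.
  exists x, [:: y]; split => //=.
  rewrite xy lt_neqAle bE b1 !andbT /= lt0n; apply/eqP => y0.
  have [_ _ /(_ y0) yb _] := vy; have [/andP[xb _] _ _ _] := vx.
  by move: bE; rewrite yb eq_le xb -yb b1.
have [b1 b2 b3 b4] := and4P xy.
have /and4P[yz1 yz2 yz3 yz4] := yr; have /and4P[d1 d2 d3 d4] := yz2.
have zr : thinned 0 z r by exact: thinned_le yz4.
have [vz vr'] := vr.
case: eqVneq => bE.
  have vx1 := valid_merge bE xy vx vy.
  have [|x' [r' [e1 [e2 e3 e4] e5 e6 [e7 e8]]]] := IH _ z _ zr vx1 vr.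
    by rewrite /plinked /= bE d1 (leq_trans b2 d2) d3.
  by exists x', r'; split => //; split => //; apply: leq_trans e4.
(* A piece starting at minus infinity sits at [bmin], which would force [x] to the same temperature,
   a case already treated. *)
have y0 : (0 < plo y)%N.
  rewrite lt0n; apply/eqP => y0.
  have [_ _ /(_ y0) yb _] := vy; have [/andP[xb _] _ _ _] := vx.
  by move: bE; rewrite yb eq_le xb -yb b1.
case: leqP => hz.
  have [|x' [r' [e1 [e2 e3 e4] e5 e6 [e7 e8]]]] := IH x z _ zr vx vr.
    by rewrite /plinked (le_trans b1 d1) (leq_trans b2 d2) (leq_trans b3 d3).
  by exists x', r'.
exists x, (y :: z :: r); split => //.
apply/and4P; split=> //; first by rewrite lt_neqAle bE b1.
exact/and4P.
Qed.

Lemma thin_path x s : path plinked x s -> All valid (x :: s) -> thin_spec x x s (thin (x :: s)).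
Proof.
elim: s x => [|y s IH] x /= => [_ [vx _]|/andP[xy ys] [vx vs]].
  by exists x, [::].
have [y' [r [e1 [e2 e3 e4] e5 e6 [e7 e8]]]] := IH y ys vs.
change (thin_spec x x (y :: s) (push x (thin (y :: s)))); rewrite e1 in e6 *.
have xy' : plinked x y'.
  case/and4P: xy => h1 h2 h3 h4.
  by rewrite /plinked e2 e3 h1 h2 h4 (leq_trans h3 e4).
have [x' [r' [f1 [f2 f3 f4] f5 f6 [f7 f8]]]] := push_spec xy' e5 vx e6.
by exists x', r'; split => //; rewrite ?f7 ?f8.
Qed.

Lemma path_plinked_trans x y r : (forall z, plinked y z -> plinked x z) ->
  path plinked y r -> path plinked x r.
Proof. by case: r => //= z r H /andP[/H -> ->]. Qed.

Lemma All_push Q x r : merge_closed Q -> path plinked x r -> Q x -> All Q r -> All Q (push x r).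
Proof.
move=> mQ; elim: r x => [|y r IH] x //= /andP[xy yr] Qx [Qy Qr].
case: eqVneq => bE.
  apply: IH => //; last exact: mQ.
  apply: path_plinked_trans yr => z /and4P[h1 h2 h3 h4]; case/and4P: xy => g1 g2 g3 g4.
  by rewrite /plinked /= bE h1 (leq_trans g2 h2) h3.
case: r IH yr Qr => [|z r] IH yr Qr //=; case: leqP => hz //.
case/andP: yr => yz zr; apply: IH => //; apply/andP; split=> //.
case/and4P: yz => h1 h2 h3 h4; case/and4P: xy => g1 g2 g3 g4.
by rewrite /plinked (le_trans g1 h1) (leq_trans g2 h2) (leq_trans g3 h3).
Qed.

Lemma thinned_path b x r : thinned b x r -> path plinked x r.
Proof. by elim: r b x => //= y r IH b x /and4P[_ -> _ /IH]. Qed.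

Lemma All_thin Q x s : merge_closed Q -> path plinked x s -> All valid (x :: s) ->
  All Q (x :: s) -> All Q (thin (x :: s)).
Proof.
move=> mQ; elim: s x => [|y s IH] x //= /andP[xy ys] [vx vs] [Qx Qs].
have := IH y ys vs Qs.
have [y' [r [e1 [e2 e3 e4] e5 e6 [e7 e8]]]] := thin_path ys vs.
change (All Q (thin (y :: s)) -> All Q (push x (thin (y :: s)))).
rewrite e1 => h; apply: All_push => //=.
rewrite (thinned_path e5) andbT.
case/and4P: xy => h1 h2 h3 h4.
by rewrite /plinked e2 e3 h1 h2 h4 (leq_trans h3 e4).
Qed.

Definition plen x : nat := phi x - plo x.

(** Here [b] is the end of the piece before [x]. The strict inequality [b < plo y] gains one unit
    per piece, which also bounds the number of pieces. *)
Lemma thinned_total_length b x r : thinned b x r -> (b <= n.+1)%N -> All valid (x :: r) ->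
  (plo x + b + size r + \sum_(y <- x :: r) plen y <= 2 * n + 3)%N.
Proof.
elim: r b x => [|y r IH] b x /= h bn.
  case=> -[_ v _ _] _; rewrite big_seq1 /plen; move: v bn; clear; lia.
case: h => /and4P[h1 h2 h3 h4] [vx vr].
have xn : (phi x <= n.+1)%N.
  have [_ /andP[_ v] _ hb] := vx; have [[/andP[_ yb] _ _ _] _] := vr.
  move: v; rewrite leq_eqVlt => /predU1P[/hb xb|//].
  by move: h1; rewrite xb ltNge yb.
rewrite big_cons; have := IH _ _ h4 xn vr.
set S := (\sum_(_ <- _) _)%N.
have [_ /andP[v _] _ _] := vx; have := h3; rewrite /plen /=; move: v S (size r); clear.
by move=> v S k; lia.
Qed.

End Thin.

(** * Common endpoints and their certification *)

Section FinishDef.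
Context {R : realType} (n : nat).
Variables (a rh eps : R) (K : nat).
Implicit Types x y : piece R.

Definition endpoint (p : nat) : \bar int :=
  if p == 0%N then -oo%E else if p == n.+2 then +oo%E else (p.-1%:Z)%:E.

(** A total length of at most [2 * n.+1] makes the inverse weights add up to at most
    [a * rh * n.+1]. A good piece guarantees nearly [1 / (2 * rh * plen x)], and [2 / a < 1 / 2]
    leaves room below this. *)
Definition weight x : R := 2 / (a * rh * (plen x)%:R).

Definition make_segment x (b b' : nat) : segment R :=
  (pbeta x, (endpoint b, endpoint b'), weight x).

(** Each piece is sampled once and its frequencies [fx] serve for both of its ends. An endpoint is
    accepted only if it passes for both pieces that share it. *)
Fixpoint finish_from (b : nat) x (fx : nat -> R) (s : seq (piece R)) :
    tree R n (option (seq (segment R))) :=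
  if s is y :: s' then
    bind (sample (K * plen y) (pbeta y)) (fun ys =>
      let fy p : R := freq (K * plen y) (at_pos p) ys in
      let ok p := ((1 + eps) * weight x <= fx p) && ((1 + eps) * weight y <= fy p) in
      if ok (phi x) then
        bind (finish_from (phi x) y fy s') (fun o =>
          Ret (omap (cons (make_segment x b (phi x))) o))
      else if ok (plo y) then
        bind (finish_from (plo y) y fy s') (fun o =>
          Ret (omap (cons (make_segment x b (plo y))) o))
      else Ret None)
  else Ret (Some [:: make_segment x b n.+2]).

Definition finish (r : seq (piece R)) : tree R n (option (seq (segment R))) :=
  if r is x :: s then
    bind (sample (K * plen x) (pbeta x)) (fun xs =>
      finish_from 0 x (fun p => freq (K * plen x) (at_pos p) xs) s)
  else Ret None.

End FinishDef.

Section FinishProof.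
Context {R : realType} {n : nat}.
Variables (c : 'I_n.+1 -> R) (bmin bmax : R).
Hypothesis c_inst : is_instance c.
Hypothesis bmm : bmin < bmax.

Local Notation nu := (ker c bmin bmax).
Let nu0 := ker_ge0 bmin bmax c_inst.
Let nu1 := ker_sum1 bmin bmax c_inst.

Variables (a rh eps : R) (K L : nat).
Hypothesis a_gt4 : 4 < a.
Hypothesis rh_ge1 : 1 <= rh.
Hypothesis eps01 : 0 < eps <= 100^-1.
Hypothesis eps_a : (1 + 3 * eps) * (2 / a) * slack eps <= 2^-1 - eps.
Hypothesis K_gt0 : (0 < K)%N.
Hypothesis K_large : 16 * L%:R * a * rh <= K%:R * eps ^+ 2.

Local Notation weight := (weight a rh).
Local Notation make_segment := (make_segment n a rh).
Local Notation finish_from := (finish_from n a rh eps K).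
Local Notation finish := (finish n a rh eps K).
Local Notation valid := (valid n bmin bmax).
Local Notation endpoint := (endpoint n).
Implicit Types x y : piece R.

Lemma weightE x : weight x = 2 / (a * rh * (plen x)%:R).
Proof. by []. Qed.

Lemma a_gt0 : 0 < a. Proof. exact: lt_trans a_gt4. Qed.

Lemma plen_gt0 x : valid x -> 0 < (plen x)%:R :> R.
Proof. by move=> [_ /andP[h _] _ _]; rewrite ltr0n subn_gt0. Qed.

Lemma weight_gt0 x : valid x -> 0 < weight x.
Proof.
move=> /plen_gt0 h; have a0 := a_gt0; have r0 := lt_le_trans ltr01 rh_ge1.
by rewrite divr_gt0 // !mulr_gt0.
Qed.

Lemma weight_le1 x : valid x -> weight x <= 1.
Proof.
move=> vx; have h := plen_gt0 vx; have a0 := a_gt0; have r0 := lt_le_trans ltr01 rh_ge1.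
rewrite ler_pdivrMr ?mulr_gt0 // mul1r.
have h1 : 1 <= (plen x)%:R :> R by rewrite ler1n -(ltr0n R).
have : 2 * 1 <= a * rh.
  by apply: ler_pM => //; apply: ltW; apply: le_lt_trans a_gt4; rewrite ler_nat.
rewrite mulr1 => h2; rewrite (le_trans h2) // ler_peMr // ltW // mulr_gt0 //.
Qed.

Lemma endpoint_lt b b' : (b < b' <= n.+2)%N -> (endpoint b < endpoint b')%E.
Proof.
rewrite /endpoint => /andP[h1 h2]; case: (eqVneq b' 0%N) h1 => [->//|b'0] h1.
case: (eqVneq b 0%N) => b0; first by case: eqP => _; rewrite ?ltNyr ?ltNy0.
have -> : b == n.+2 = false by apply/negbTE; move: h1 h2; clear; lia.
case: eqP => _; first by rewrite ltry.
by rewrite lte_fin ltz_nat; move: h1 b0; clear; lia.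
Qed.

Lemma endpoint_top : endpoint n.+2 = +oo%E.
Proof. by rewrite /endpoint eqxx. Qed.

Lemma endpoint_mem p : (p <= n.+2)%N -> (p != n.+2) ->
  endpoint p = -oo%E \/ (exists k : 'I_n.+1, endpoint p = (k%:Z)%:E).
Proof.
rewrite /endpoint => h1 h2; case: eqVneq => [_|p0]; [by left|right].
have pn : (p.-1 < n.+1)%N by move: h1 h2 p0; clear; lia.
by exists (Ordinal pn); rewrite (negbTE h2).
Qed.

Lemma endpoint_fin p (k : 'I_n.+1) : (p <= n.+2)%N -> endpoint p = (k%:Z)%:E -> p = k.+1.
Proof.
rewrite /endpoint => h; case: eqVneq => // p0; case: eqVneq => // p2 [E].
by move: E p0; clear; lia.
Qed.

Lemma make_segment_ok x b b' : valid x -> (b < b' <= n.+2)%N ->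
  is_segment n bmin bmax (make_segment x b b') /\
  (seg_lo (make_segment x b b') < seg_hi (make_segment x b b'))%E.
Proof.
move=> vx bb; have lt := endpoint_lt bb; split=> //.
have /andP[b1 b2] := bb; have [vb _ _ _] := vx.
split=> //=; last 2 first.
- exact: ltW.
- by rewrite weight_gt0 ?weight_le1.
- by apply: endpoint_mem; move: b1 b2; clear; lia.
have [->|h] := eqVneq b' n.+2; first by left; exact: endpoint_top.
right; have [E|//] := endpoint_mem b2 h.
by move: lt; rewrite E ltNge leNye.
Qed.

Definition chain_from x (b : nat) (s : seq (piece R)) (sch : seq (segment R)) : Prop :=
  exists s0 sch', [/\ sch = s0 :: sch',
    seg_beta s0 = pbeta x /\ seg_lo s0 = endpoint b,
    seg_hi (last s0 sch') = +oo%E /\ seg_beta (last s0 sch') = pbeta (last x s),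
    (forall g, g \in sch -> is_segment n bmin bmax g /\ (seg_lo g < seg_hi g)%E) &
    path (fun g g' => (seg_beta g < seg_beta g') && (seg_hi g == seg_lo g')) s0 sch'
    /\ InvWeight sch = \sum_(y <- x :: s) (weight y)^-1].

Lemma chain_from_cons x y b b' s sch : valid x -> (b < b' <= n.+2)%N -> pbeta x < pbeta y ->
  chain_from y b' s sch -> chain_from x b (y :: s) (make_segment x b b' :: sch).
Proof.
move=> vx bb xy [s0 [sch' [-> [e1 e2] [e3 e4] h [p iw]]]].
exists (make_segment x b b'), (s0 :: sch'); split=> //.
- move=> g; rewrite inE => /predU1P[->|]; [exact: make_segment_ok|exact: h].
- rewrite /= p e1 e2 /= xy eqxx; split=> //.
by move: iw; rewrite /InvWeight !big_cons => ->.
Qed.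

Lemma phi_le x y : valid x -> valid y -> pbeta x < pbeta y -> (phi x <= n.+1)%N.
Proof.
move=> [_ /andP[_ v] _ hb] [/andP[_ yb] _ _ _] xy.
by move: v; rewrite leq_eqVlt => /predU1P[/hb xb|//]; move: xy; rewrite xb ltNge yb.
Qed.

(** [b0] bounds the end of the previous piece and [b <= b0] is the endpoint actually chosen. Since
    [b0 < plo y], both candidates for the next endpoint exceed [b]. *)
Lemma sure_finish_from s : forall b0 b x fx, (b <= b0 <= n.+1)%N -> thinned b0 x s ->
  All valid (x :: s) ->
  sure (finish_from b x fx s) (fun o => forall sch, o = Some sch -> chain_from x b s sch).
Proof.
elim: s => [|y s IH] b0 b x fx /andP[bb b0n].
  move=> _ [vx _] /= _ [<-]; exists (make_segment x b n.+2), [::].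
  have bn : (b < n.+2 <= n.+2)%N by rewrite leqnn andbT ltnS (leq_trans bb).
  have [h1 h2] := make_segment_ok vx bn.
  split=> //; first by split => //; exact: endpoint_top.
    by move=> g; rewrite inE => /eqP ->.
  by rewrite /InvWeight !big_seq1.
move=> /= /and4P[xy pxy by0 th] [vx [vy vs]].
have xn := phi_le vx vy xy.
have /and4P[_ _ _ yx] := pxy; have [_ /andP[vx1 vx2] _ _] := vx.
apply: sure_bind (sure_true _) _ => ys _.
have step b' fy : (b < b' <= phi x)%N ->
    sure (bind (finish_from b' y fy s) (fun o => Ret (omap (cons (make_segment x b b')) o)))
      (fun o => forall sch, o = Some sch -> chain_from x b (y :: s) sch).
  move=> /andP[b1 b2]; apply: sure_bind (IH (phi x) b' y fy _ th _) _ => //.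
    by rewrite b2.
  move=> -[sch|] h //= _ [<-]; apply: chain_from_cons => //; last exact: h.
  by rewrite b1 (leq_trans b2).
case: ifP => _; first by apply: step; move: bb by0 yx; clear; lia.
by case: ifP => _ //; apply: step; move: bb by0 yx; clear; lia.
Qed.

Lemma sum_inv_weight s : All valid s ->
  \sum_(y <- s) (weight y)^-1 = a * rh / 2 * (\sum_(y <- s) plen y)%:R.
Proof.
elim: s => [|x s IH] /=; first by rewrite !big_nil mulr0.
move=> [vx vs]; rewrite !big_cons IH // natrD mulrDr; congr (_ + _).
have h := plen_gt0 vx; have a0 := a_gt0; have r0 := lt_le_trans ltr01 rh_ge1.
by rewrite weightE; field; rewrite !gt_eqF.
Qed.

Lemma chain_covering x s sch : pbeta x = bmin -> pbeta (last x s) = bmax ->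
  chain_from x 0 s sch -> covering_schedule n bmin bmax sch.
Proof.
move=> e1 e2 [s0 [sch' [-> [h1 h2] [h3 h4] h5 [h6 _]]]].
rewrite /covering_schedule; split=> //; rewrite ?h1 ?h4 //.
- split; last by move=> g /h5[].
  have : sorted <%R (map (@seg_beta R) (s0 :: sch')).
    rewrite /= path_map; apply: sub_path h6 => g g' /andP[] //.
  by move=> /lt_sorted_uniq /map_uniq.
- by move=> g /h5[].
Qed.

Lemma cost_finish_from s b x fx : cost nu (finish_from b x fx s) <=
  (K * \sum_(y <- s) plen y)%:R.
Proof.
elim: s b x fx => [|y s IH] b x fx //=.
rewrite big_cons mulnDr natrD.
apply: (cost_bind_le nu0 nu1 (sure_true _)); first by rewrite cost_sample.
move=> ys _; rewrite -[leRHS]addr0.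
by case: ifP => _; [|case: ifP => _; last by rewrite addr0 ler0n];
  apply: (cost_bind_le nu0 nu1 (sure_true _) (IH _ _ _)).
Qed.

Lemma cost_finish r : cost nu (finish r) <= (K * \sum_(y <- r) plen y)%:R.
Proof.
case: r => [|x s] //=; rewrite big_cons mulnDr natrD.
apply: (cost_bind_le nu0 nu1 (sure_true _)); first by rewrite cost_sample.
by move=> xs _; exact: cost_finish_from.
Qed.

Definition good_piece x : Prop :=
  (plo x != 0%N -> 2^-1 - eps <= rh * (slack eps * ((plen x)%:R * pm c (pbeta x) (plo x)))) /\
  (phi x != n.+2 -> 2^-1 - eps <= rh * (slack eps * ((plen x)%:R * pm c (pbeta x) (phi x)))).

Lemma good_piece_merge : merge_closed good_piece.
Proof.
move=> x y xy /and4P[h1 h2 h3 h4] [xl _] [_ yr].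
have r0 := lt_le_trans ltr01 rh_ge1; have k0 := slack_ge1 eps01.
split=> /= h; [apply: le_trans (xl h) _|apply: le_trans (yr h) _];
  rewrite ler_wpM2l ?(ltW r0) // ler_wpM2l ?(le_trans ler01 k0) // -?xy;
  rewrite ler_wpM2r ?pm_ge0 // ler_nat /plen /=; move: h2 h3; clear; lia.
Qed.

Lemma good_weight x p : valid x ->
  2^-1 - eps <= rh * (slack eps * ((plen x)%:R * pm c (pbeta x) p)) ->
  (1 + 3 * eps) * weight x <= pm c (pbeta x) p.
Proof.
move=> vx h; have h0 := plen_gt0 vx; have a0 := a_gt0.
have r0 := lt_le_trans ltr01 rh_ge1; have k0 := lt_le_trans ltr01 (slack_ge1 eps01).
rewrite -(ler_pM2l (mulr_gt0 (mulr_gt0 r0 k0) h0)).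
rewrite -!mulrA; apply: le_trans h; apply: le_trans eps_a.
by rewrite le_eqVlt; apply/orP; left; apply/eqP; rewrite weightE; field; rewrite !gt_eqF.
Qed.

Local Notation dlt' := (@failure_bound R n L).

(** The test level [(1 + eps) * weight x] lies between the mass to be certified and the mass of a
    good end, with room for the sampling error on either side. *)
Definition reliable x (fx : nat -> R) : Prop := forall p,
  ((1 + eps) * weight x <= fx p -> weight x <= pm c (pbeta x) p) /\
  ((1 + 3 * eps) * weight x <= pm c (pbeta x) p -> (1 + eps) * weight x <= fx p).

Lemma err_reliable x : valid x ->
  err nu (sample (K * plen x) (pbeta x))
    (fun xs => reliable x (fun p => freq (K * plen x) (at_pos p) xs)) <= dlt'.
Proof.
move=> vx; have w0 := weight_gt0 vx; have h0 := plen_gt0 vx; have a0 := a_gt0.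
have r0 := lt_le_trans ltr01 rh_ge1; have /andP[e0 e1] := eps01.
have e01 : 0 < eps <= 2^-1 by lra.
apply: (@le_trans _ _ (err nu (sample (K * plen x) (pbeta x))
   (accurate nu (K * plen x) (pbeta x) (weight x) eps))).
  apply: err_sub => // xs acc p; have [xb _ _ _] := vx.
  have := accurate_pos eps01 p w0 xb acc; move: (freq _ _ _) => f.
  set m := pm _ _ _; rewrite ler_norml => /andP[h1 h2].
  split=> h.
    rewrite leNgt; apply/negP => mw; rewrite (max_idPr (ltW mw)) in h2; lra.
  have wm : weight x <= m.
    by apply: le_trans h; rewrite ler_peMl ?(ltW w0) //; lra.
  rewrite (max_idPl wm) in h1.
  have : (1 - eps) * ((1 + 3 * eps) * weight x) <= (1 - eps) * m by rewrite ler_wpM2l //; lra.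
  have : 0 <= weight x * (eps * (1 - 3 * eps)).
    by apply: mulr_ge0 (ltW w0) (mulr_ge0 (ltW e0) _); lra.
  lra.
apply: le_trans (err_accurate nu0 nu1 _ _ w0 e01) _.
  by rewrite muln_gt0 K_gt0 -(ltr0n R).
rewrite ler_wpM2l // ler_wpM2l // ler_expR lerN2 natrM.
have -> : K%:R * (plen x)%:R * weight x * eps ^+ 2 / 4 = K%:R * eps ^+ 2 / (2 * a * rh).
  by rewrite weightE; field; rewrite !gt_eqF.
by rewrite ler_pdivlMr ?mulr_gt0 //; have := K_large; lra.
Qed.

(** Soundness does not presuppose good pieces; these are needed only for returning a schedule at
    all. *)
Definition finish_post (s : seq (piece R)) (o : option (seq (segment R))) : Prop :=
  (forall sch, o = Some sch -> proper_segments c sch) /\ (All good_piece s -> o <> None).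

Lemma make_segment_proper x b b' : (b <= n.+2)%N -> (b' <= n.+2)%N ->
  (forall p, p = b \/ p = b' -> (1 <= p <= n.+1)%N -> weight x <= pm c (pbeta x) p) ->
  proper_segment c (make_segment x b b').
Proof.
move=> h1 h2 H k; rewrite /seg_lo /seg_hi /= => hk.
have : k.+1 = b \/ k.+1 = b'.
  by case: hk => /endpoint_fin E; [left|right]; rewrite E.
by move=> /H; rewrite pmS; apply; rewrite ltn_ord.
Qed.

(* Between [x] and [y] with crossing ends [l <= k], the ratio [pm _ k / pm _ l] grows from
   [x] to [y]: if it is at least 1 at [x], then [k] is heavy for [y], otherwise [l] is heavy
   for [x]. *)
Lemma uncross x y : valid x -> valid y -> pbeta x < pbeta y -> plinked x y -> (0 < plo y)%N ->
  good_piece x -> good_piece y ->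
  ((1 + 3 * eps) * weight x <= pm c (pbeta x) (phi x) /\
   (1 + 3 * eps) * weight y <= pm c (pbeta y) (phi x)) \/
  ((1 + 3 * eps) * weight x <= pm c (pbeta x) (plo y) /\
   (1 + 3 * eps) * weight y <= pm c (pbeta y) (plo y)).
Proof.
move=> vx vy xy /and4P[_ _ _ lk] y0 gx gy.
have xn := phi_le vx vy xy.
have hx : (1 + 3 * eps) * weight x <= pm c (pbeta x) (phi x).
  by apply: good_weight => //; apply: gx.2; move: xn; clear; lia.
have hy : (1 + 3 * eps) * weight y <= pm c (pbeta y) (plo y).
  by apply: good_weight => //; apply: gy.1; rewrite -lt0n.
have cross := pm_cross c_inst (ltW xy) lk.
have /andP[e0 _] := eps01.
have px : 0 < pm c (pbeta x) (phi x).
  by apply: lt_le_trans hx; rewrite mulr_gt0 ?weight_gt0 //; lra.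
have [h|h] := leP (pm c (pbeta x) (plo y)) (pm c (pbeta x) (phi x)); last first.
  by right; split => //; apply: le_trans hx (ltW h).
left; split=> //; apply: le_trans hy _; rewrite -(ler_pM2l px); apply: (le_trans cross).
by rewrite mulrC ler_wpM2r ?pm_ge0.
Qed.

Lemma err_finish_from s : forall b0 b x fx, (b <= b0 <= n.+1)%N -> thinned b0 x s ->
  All valid (x :: s) -> reliable x fx ->
  ((1 <= b)%N -> weight x <= pm c (pbeta x) b) ->
  err nu (finish_from b x fx s) (finish_post (x :: s)) <= (size s)%:R * dlt'.
Proof.
have d0 : 0 <= dlt' := failure_bound_ge0 _.
elim: s => [|y s IH] b0 b x fx /andP[bb b0n].
  move=> _ [vx _] _ wb /=; rewrite mul0r err_sure //=.
  split=> // _ [<-] g; rewrite inE => /eqP ->; apply: make_segment_proper => //.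
    by rewrite (leq_trans bb) // leqW.
  by move=> p [->|->] /andP[p1 p2]; [exact: wb|rewrite ltnn in p2].
move=> /= /and4P[xy pxy by0 th] [vx [vy vs]] rx wb.
have xn := phi_le vx vy xy.
have /and4P[_ _ _ yx] := pxy; have [_ /andP[vx1 vx2] _ _] := vx.
have s0 : 0 <= (size s)%:R * dlt' by rewrite mulr_ge0.
have -> : (size s).+1%:R * dlt' = dlt' + (size s)%:R * dlt'.
  by rewrite -[(size s).+1%:R]natr1; ring.
apply: (err_bind nu0 nu1 (err_reliable vy)) => // ys ry.
set fy := fun p => _ in ry *.
have step b' : (b < b' <= phi x)%N -> (1 + eps) * weight x <= fx b' ->
    (1 + eps) * weight y <= fy b' ->
    err nu (bind (finish_from b' y fy s) (fun o => Ret (omap (cons (make_segment x b b')) o)))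
      (finish_post [:: x, y & s]) <= (size s)%:R * dlt'.
  move=> /andP[b1 b2] okx oky; rewrite -[leRHS]addr0.
  have bn : (b' <= phi x <= n.+1)%N by rewrite b2.
  apply: (err_bind nu0 nu1 (IH (phi x) b' y fy bn th (conj vy vs) ry _)) => //.
    by move=> _; apply: (ry b').1.
  move=> o [h1 h2]; rewrite err_sure //=; split; last first.
    by move=> [_ /h2]; case: (o).
  case: o h1 {h2} => //= sch h1 _ [<-] g; rewrite inE => /predU1P[->|]; last exact: h1.
  apply: make_segment_proper.
  - by rewrite (leq_trans bb) // leqW.
  - by rewrite (leq_trans b2) // leqW.
  by move=> p [->|->] /andP[p1 p2]; [exact: wb|exact: (rx b').1].
case: ifP => [/andP[k1 k2]|ok1].
  by apply: step => //; move: bb by0 yx; clear; lia.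
case: ifP => [/andP[k1 k2]|ok2].
  by apply: step => //; move: bb by0 yx; clear; lia.
rewrite err_sure //; split=> // -[gx [gy _]] _.
have y0 : (0 < plo y)%N by apply: leq_ltn_trans by0.
case: (uncross vx vy xy pxy y0 gx gy) => -[k1 k2].
  by move: ok1; rewrite ((rx _).2 k1) ((ry _).2 k2).
by move: ok2; rewrite ((rx _).2 k1) ((ry _).2 k2).
Qed.

Lemma err_finish x s : thinned 0 x s -> All valid (x :: s) ->
  err nu (finish (x :: s)) (finish_post (x :: s)) <= (size s).+1%:R * dlt'.
Proof.
move=> th vs; have d0 : 0 <= dlt' := failure_bound_ge0 _; have [vx _] := vs.
have -> : (size s).+1%:R * dlt' = dlt' + (size s)%:R * dlt'.
  by rewrite -[(size s).+1%:R]natr1; ring.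
apply: (err_bind nu0 nu1 (err_reliable vx)); first by rewrite mulr_ge0.
by move=> xs rx; apply: (@err_finish_from _ 0%N) th vs rx _.
Qed.

End FinishProof.

(** * The full procedure *)

Section Attempt.
Context {R : realType} {n : nat}.
Variables (bmin bmax a rh eps : R) (l s N1 K1 K2 L : nat).
Hypothesis bmm : bmin < bmax.
Hypothesis a_gt4 : 4 < a.
Hypothesis rh_ge1 : 1 <= rh.
Hypothesis eps01 : 0 < eps <= 100^-1.
Hypothesis l_gt0 : (0 < l)%N.
Hypothesis n_lt : (n.+2 < 2 ^ l)%N.
Hypothesis K1_gt0 : (0 < K1)%N.
Hypothesis K1_large : 128 * l%:R * rh <= K1%:R * eps ^+ 2.

Definition as_piece (bt : nat -> R) (B : item) : piece R :=
  Piece (bt (iedge B)) (ilo B) (ihi B).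

Definition attempt : tree R n (option (seq (segment R))) :=
  (* A search with parameter [eta] yields tolerance [4 * eta], hence [eps / 4]. Run [i] serves the
     threshold [i.+1]. *)
  bind (collect 0 (fun i => search n bmin bmax (64 * l%:R) i.+1 N1 (eps / 4) s) n) (fun g =>
    let bt := @threshold R n bmin bmax (fun e => g e.-1) in
    bind (skeleton n bmin bmax eps bt K1 l) (fun its =>
      finish n a rh eps K2 (thin (map (as_piece bt) its)))).

(** A covering schedule of inverse weight 2 that need not be proper; it is returned only when every
    attempt has failed. *)
Definition fallback : seq (segment R) :=
  [:: (bmin, (-oo%E, 0%E), 1); (bmax, (0%E, +oo%E), 1)].

Definition schedule_ok (sch : seq (segment R)) : Prop :=
  covering_schedule n bmin bmax sch /\ InvWeight sch <= a * n.+1%:R * rh.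

Lemma fallback_ok : schedule_ok fallback.
Proof.
have seg0 : exists k : 'I_n.+1, (0%E : \bar int) = (k%:Z)%:E by exists ord0.
split; last first.
  rewrite /InvWeight big_cons big_seq1 /= invr1.
  have h1 : 1 <= n.+1%:R :> R by rewrite ler1n.
  apply: (@le_trans _ _ (4 * 1 * 1)); first by lra.
  by do 2! apply: ler_pM => //; exact: ltW.
rewrite /covering_schedule /=; split=> //.
- split; first by rewrite inE andbT /seg_beta; apply/eqP => -[E]; move: bmm; rewrite E ltxx.
  move=> g; rewrite !inE => /orP[] /eqP ->; split => /=; rewrite ?lexx ?ltr01 ?(ltW bmm) ?leNye
    ?leey //.
  + by left.
  + by right.
  + by right.
  + by left.
- by move=> g; rewrite !inE => /orP[] /eqP ->; rewrite /seg_lo /seg_hi /= ?ltNy0 ?lt0y.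
by rewrite /seg_beta /= bmm.
Qed.

Definition thin_ok (bt : nat -> R) (its : seq item) (x : piece R) (r : seq (piece R)) : Prop :=
  [/\ thin (map (as_piece bt) its) = x :: r, pbeta x = bmin /\ pbeta (last x r) = bmax,
      thinned 0 x r /\ All (valid n bmin bmax) (x :: r),
      (size r <= 2 * n + 3)%N /\ (\sum_(y <- x :: r) plen y <= 2 * n.+1)%N &
      forall Q, merge_closed Q -> All Q (map (as_piece bt) its) -> All Q (x :: r)].

Lemma thin_skeleton bt its : (forall e, bmin <= bt e <= bmax) ->
  (forall e e', (e <= e')%N -> bt e <= bt e') ->
  skeleton_spec (n := n) bmin bmax bt its -> exists x r, thin_ok bt its x r.
Proof.
move=> bt_in bt_homo [A [s' [-> A0 pA hi wA]]].
have pp : path plinked (as_piece bt A) (map (as_piece bt) s').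
  rewrite path_map; apply: sub_path pA => B C /andP[/and3P[h1 h2 h3] h4].
  by rewrite /plinked /= h1 h2 h4 bt_homo.
have vv : All (valid n bmin bmax) (map (as_piece bt) (A :: s')).
  elim: (A :: s') wA => //= B t IH [[/andP[w1 w2] w3 w4 w5] /IH vt]; split=> //.
  split=> //=; first by rewrite w3 andbT (leq_ltn_trans w1).
    by move=> h; apply/eqP; rewrite -w4 h.
  by move=> h; apply/eqP; rewrite -w5 h.
have [x [r [e1 [e2 e3 e4] e5 e6 [e7 e8]]]] := thin_path pp vv.
have vxr := e6; rewrite e1 in vxr.
exists x, r.
have xb : pbeta x = bmin.
  by rewrite e2; case: vv => -[_ _ h _] _; apply: h.
have lb : pbeta (last x r) = bmax.
  rewrite e8; have : All (fun p : piece R => phi p = n.+2 -> pbeta p = bmax)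
      (map (as_piece bt) (A :: s')).
    by elim: (map _ _) vv => //= p t IH [[_ _ _ h] /IH].
  rewrite last_map /= => -[h0 h].
  elim: s' A hi h0 h {A0 pA wA pp vv e1 e2 e3 e4 e6 e7 e8} => [|B t IH] A /= hi h0;
    first by move=> _; exact: h0.
  by move=> [h1 h2]; exact: IH.
have tl := thinned_total_length e5 (leq0n _) vxr.
(* Since [bmin < bmax] there are at least two pieces; this lowers the length bound from [2 * n + 3]
   to [2 * n.+1]. *)
have r0 : (0 < size r)%N.
  by case: (r) lb => //= E; move: bmm; rewrite -xb E ltxx.
split=> //; first by split; move: tl r0; set S := (\sum_(_ <- _) _)%N;
  move: S (size r) (plo x); clear => *; lia.
by move=> Q mQ hQ; rewrite -e1; exact: (All_thin mQ pp vv hQ).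
Qed.

Lemma sure_finish bt its x r : thin_ok bt its x r ->
  sure (finish n a rh eps K2 (x :: r)) (fun o => forall sch, o = Some sch -> schedule_ok sch).
Proof.
move=> [_ [h1 h2] [th vs] [_ len] _].
apply: sure_bind (sure_true _) _ => xs _.
apply: sure_imp (sure_finish_from _ _ a_gt4 rh_ge1 _ (isT : (0 <= 0 <= n.+1)%N) th vs) _.
move=> o ho sch /ho ch; split; first exact: chain_covering ch.
have [s0 [sch' [_ _ _ _ [_ ->]]]] := ch.
rewrite (sum_inv_weight a_gt4 rh_ge1 vs).
have ar : 0 <= a * rh / 2.
  by rewrite divr_ge0 // mulr_ge0 // ltW //; [exact: lt_trans a_gt4|exact: lt_le_trans rh_ge1].
apply: le_trans (ler_wpM2l ar (_ : _ <= (2 * n.+1)%:R)) _; first by rewrite ler_nat.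
by rewrite natrM; lra.
Qed.

Let th_in g := threshold_in (n := n) bmm g.
Let th_homo g := threshold_homo (n := n) bmm g.

Lemma threshold0 g : @threshold R n bmin bmax g 0 = bmin.
Proof. by []. Qed.

Lemma threshold_top g : @threshold R n bmin bmax g n.+1 = bmax.
Proof. by rewrite /threshold ltnSn. Qed.

Lemma sure_threshold_skeleton g : sure (skeleton n bmin bmax eps (@threshold R n bmin bmax g) K1 l)
  (skeleton_spec (n := n) bmin bmax (@threshold R n bmin bmax g)).
Proof.
exact: (sure_skeleton bmm rh_ge1 eps01 (th_in g) (th_homo g) (threshold0 g) (threshold_top g)
  K1_gt0 K1_large n_lt).
Qed.

Lemma sure_attempt : sure attempt (fun o => forall sch, o = Some sch -> schedule_ok sch).
Proof.
apply: sure_bind (sure_true _) _ => g _.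
apply: sure_bind (sure_threshold_skeleton _) _ => its hits.
have [x [r tok]] := thin_skeleton (th_in _) (th_homo _) hits.
by have [-> _ _ _ _] := tok; apply: sure_finish tok.
Qed.

Variable c : 'I_n.+1 -> R.
Hypothesis c_inst : is_instance c.
Local Notation nu := (ker c bmin bmax).
Let nu0 := ker_ge0 bmin bmax c_inst.
Let nu1 := ker_sum1 bmin bmax c_inst.

Lemma cost_attempt : cost nu attempt <=
  n%:R * (35 + 10 * ln (Num.max 1 (log_ratio c bmin bmax)) + N1%:R * s.+1%:R) +
  ((K1 * (2 * n.+2 + l * (4 * n.+2)))%:R + (K2 * (2 * n.+1))%:R).
Proof.
apply: (cost_bind_le nu0 nu1 (sure_true _)).
  by apply: cost_collect => // i _; apply: cost_search.
move=> g _; apply: (cost_bind_le nu0 nu1 (sure_threshold_skeleton _)).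
  exact: (cost_skeleton c_inst bmm rh_ge1 eps01 (th_in _) (th_homo _) (threshold0 _) (threshold_top
    _) K1_gt0 K1_large).
move=> its hits; have [x [r [-> _ _ [_ len] _]]] := thin_skeleton (th_in _) (th_homo _) hits.
by apply: (le_trans (cost_finish _ _ c_inst _ _ _ _ _)); rewrite ler_nat leq_mul2l len orbT.
Qed.

Hypothesis eps_a : (1 + 3 * eps) * (2 / a) * slack eps <= 2^-1 - eps.
Hypothesis K2_gt0 : (0 < K2)%N.
Hypothesis K2_large : 16 * L%:R * a * rh <= K2%:R * eps ^+ 2.

Lemma err_finish_ok bt its x r : thin_ok bt its x r ->
  err nu (finish n a rh eps K2 (x :: r)) (finish_post c rh eps (x :: r)) <=
  (2 * n + 4)%:R * failure_bound (n := n) L.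
Proof.
move=> [_ _ [th vs] [sz _] _].
apply: (le_trans (err_finish c_inst a_gt4 rh_ge1 eps01 eps_a K2_gt0 K2_large th vs)).
by rewrite ler_wpM2r ?failure_bound_ge0 // ler_nat; move: sz; clear; lia.
Qed.

(** The earlier stages contribute no error: their structural properties hold on every branch, and
    certification is sound for any items they produce. *)
Lemma err_attempt_proper :
  err nu attempt (fun o => forall sch, o = Some sch -> proper_segments c sch) <=
  (2 * n + 4)%:R * failure_bound (n := n) L.
Proof.
have d0 : 0 <= (2 * n + 4)%:R * failure_bound (n := n) L :> R by rewrite mulr_ge0
  ?failure_bound_ge0.
rewrite -[leRHS]add0r; apply: (err_bind nu0 nu1 (P := fun=> True)) => //.
  by rewrite err_sure //; exact: sure_true.
move=> g _; rewrite -[leRHS]add0r; apply: (err_bind nu0 nu1 (P := skeleton_spec (n := n) bmin bmax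
  (@threshold R n bmin bmax (fun e => g e.-1)))) => //.
  by rewrite err_sure //; exact: sure_threshold_skeleton.
move=> its hits; have [x [r tok]] := thin_skeleton (th_in _) (th_homo _) hits.
have [-> _ _ _ _] := tok; apply: le_trans (err_finish_ok tok).
by apply: err_sub => // o [].
Qed.

Hypothesis c_side : side_bound c rh.
Hypothesis N1_gt0 : (0 < N1)%N.
Hypothesis s_large : n%:R * (64 * l%:R) <= 2 ^+ s * (eps / 4 / 2).

Lemma err_attempt_none : err nu attempt (fun o => o <> None) <=
  n%:R * (4 * expR (- (8 * l%:R)) + s.+1%:R * (2 * expR (- (N1%:R * (eps / 4) ^+ 2 / 4)))) +
  ((2 ^+ l + 1) * failure_bound (n := n) l + (2 * n + 4)%:R * failure_bound (n := n) L).
Proof.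
have /andP[e0 e1] := eps01.
have d0 : 0 <= (2 * n + 4)%:R * failure_bound (n := n) L :> R by rewrite mulr_ge0
  ?failure_bound_ge0.
have d1 : 0 <= (2 ^+ l + 1) * failure_bound (n := n) l :> R.
  by rewrite mulr_ge0 ?failure_bound_ge0 // addr_ge0 // exprn_ge0.
have eta0 : 0 < eps / 4 <= 2^-1 by lra.
apply: (err_bind nu0 nu1 (P := fun g => forall i, (i < n)%N ->
    near_median c bmin bmax i.+1 (4 * (eps / 4)) (g i))).
- apply: (err_collect nu0 nu1 0
    (Q := fun i => near_median c bmin bmax i.+1 (4 * (eps / 4))));
      first by rewrite addr_ge0 ?mulr_ge0 ?expR_ge0.
  by move=> i _; apply: (err_search c_inst bmm l_gt0).
- by rewrite addr_ge0.
move=> g hg; set bt := threshold _ _ _.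
have bal e : (e <= n.+1)%N -> (bt e = bmin \/ 2^-1 - eps <= 1 - tail c (bt e) e) /\
    (bt e = bmax \/ 2^-1 - eps <= tail c (bt e) e).
  apply: (threshold_balanced c_inst bmm); first by lra.
  move=> [|i] //= hi; have := hg i hi.
  by rewrite (_ : 4 * (eps / 4) = eps) //; field.
apply: (err_bind nu0 nu1 (P := fun its => skeleton_spec (n := n) bmin bmax bt its /\
    All (opt c rh eps bt) its)) => //.
  apply: le_trans (err_skeleton c_inst bmm rh_ge1 eps01 c_side (th_in _) (th_homo _) (threshold0 _)
    (threshold_top _) K1_gt0 K1_large bal l).
  by apply: (err_sub_sure nu0 (sure_threshold_skeleton _)).
move=> its [hits oits]; have [x [r tok]] := thin_skeleton (th_in _) (th_homo _) hits.
have [-> _ _ _ hQ] := tok; apply: le_trans (err_finish_ok tok).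
apply: err_sub => // o [_]; apply; apply: hQ.
  exact: (good_piece_merge c_inst rh_ge1 eps01).
have : All (wf (n := n) bmin bmax bt) its by case: hits => A [t [-> _ _ _]].
elim: its oits {hits tok} => //= B t IH [oB /IH ot] [wB /ot]; split => //.
exact: (opt_quality (bmin := bmin) (bmax := bmax) c_inst rh_ge1 eps01 wB oB).
Qed.

End Attempt.

(** * Bounded trees as procedures *)

Section Embedding.
Context {R : realType} {n : nat} {bmin bmax : R}.
Hypothesis bmm : bmin <= bmax.

Fixpoint embed (t : tree R n (seq (segment R))) : procedure n bmin bmax :=
  match t with
  | Ret out => Return n bmin bmax out
  | Ask b k => Query (clip_in b bmm) (fun x => embed (k x))
  end.

Fixpoint depth A (t : tree R n A) : nat :=
  match t with
  | Ret _ => 0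
  | Ask _ k => (\max_x depth (k x)).+1
  end.

Variable c : 'I_n.+1 -> R.
Hypothesis c_inst : is_instance c.
Local Notation nu := (ker c bmin bmax).
Let nu0 := ker_ge0 bmin bmax c_inst.
Let nu1 := ker_sum1 bmin bmax c_inst.

Lemma prob_within_le1 t m E : prob_within c m (embed t) E <= 1.
Proof.
elim: t m => [out|b k IH] [|m] /=; rewrite ?indicE ?lern1 ?leq_b1 //.
rewrite -[leRHS](nu_avg nu1 b); apply: ler_sum => x _.
by rewrite ler_wpM2l ?gibbs_ge0.
Qed.

Lemma prob_within_embed t m E : (depth t <= m)%N ->
  prob_within c m (embed t) E = 1 - err nu t E.
Proof.
elim: t m => [out|b k IH] m /=.
  rewrite /err /= => _; have -> : prob_within c m (Return n bmin bmax out) E = \1_E out.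
    by case: m.
  rewrite indicE; case: asboolP => h; first by rewrite mem_set // subr0.
  by rewrite memNset // subrr.
case: m => // m h; rewrite /err /=.
rewrite -[X in X - _](nu_avg nu1 b) -sumrB; apply: eq_bigr => x _.
rewrite -mulrBr IH //; move: h; rewrite ltnS; apply: leq_trans.
exact: (leq_bigmax (F := fun x => depth (k x)) x).
Qed.

Lemma calls_within_embed t m : calls_within c m (embed t) <= cost nu t.
Proof.
elim: t m => [out|b k IH] [|m] //=.
  by apply: (cost_ge0 nu0 (Ask b k)).
by rewrite lerD2l; apply: ler_sum => x _; rewrite ler_wpM2l ?gibbs_ge0.
Qed.

Lemma output_prob_embed_ge t E : ((1 - err nu t E)%:E <= output_prob c (embed t) E)%E.
Proof.
apply: ereal_sup_ubound; exists (depth t) => //.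
by rewrite prob_within_embed.
Qed.

Lemma output_prob_embed1 t E : sure t E -> output_prob c (embed t) E = 1%E.
Proof.
move=> h; apply/eqP; rewrite eq_le; apply/andP; split.
  by apply: ge_ereal_sup => _ [m _ <-]; rewrite lee_fin prob_within_le1.
by have := output_prob_embed_ge t E; rewrite err_sure // subr0.
Qed.

Lemma expected_calls_embed t : (expected_calls c (embed t) <= (cost nu t)%:E)%E.
Proof. by apply: ge_ereal_sup => _ [m _ <-]; rewrite lee_fin calls_within_embed. Qed.

End Embedding.

(** * Sample sizes and constants *)

Section SampleSizes.
Context {R : realType}.

Lemma rho_ge1 st n : 1 <= rho st n :> R.
Proof.
case: st => /=; first by rewrite lerDl ln_ge0 // ler1n.
by rewrite -[leLHS]expR0 ler_expR.
Qed.

Definition nat_above (x : R) : nat := (Num.truncn x).+1.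

Lemma nat_above_ge x : x <= (nat_above x)%:R.
Proof. exact/ltW/Num.Theory.truncnS_gt. Qed.

Lemma nat_above_le x : 0 <= x -> (nat_above x)%:R <= x + 1.
Proof. by move=> x0; rewrite -[(nat_above x)%:R]natr1 lerD2r Num.Theory.truncn_le. Qed.

(** Three factors [2 ^ l] pay for polynomially many events, and [expR (- (5 * l))] remains. *)
Lemma decay_bound (l : nat) : (3 <= l)%N -> (2 ^+ l) ^+ 3 * expR (- (8 * l%:R)) <= 72^-1 :> R.
Proof.
move=> l3; have l3' : 3 <= l%:R :> R by rewrite ler_nat.
have -> : 2 ^+ l = expR (ln 2 * l%:R) :> R by rewrite expRM_natr lnK // posrE.
rewrite -expRM_natl -expRD.
have h : 3%:R * (ln 2 * l%:R) <= 3%:R * l%:R :> R.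
  by rewrite ler_pM2l // ler_piMl // ln2_le1.
have e6 : 6 <= expR 5 :> R by apply: le_trans (expR_ge1Dx _); lra.
apply: (@le_trans _ _ (expR (- (5 * 3)))); first by rewrite ler_expR; lra.
rewrite expRN lef_pV2 ?posrE ?expR_gt0 //.
have -> : expR (5 * 3) = expR 5 ^+ 3 :> R by rewrite -expRM_natr.
by apply: (@le_trans _ _ (6 ^+ 3)); [rewrite !exprS expr0; lra|rewrite lerXn2r ?nnegrE].
Qed.

Variables (a eps : R).
(** With [x = 2 / a < 1 / 2], the terms of [(1 + 3 * eps) * (1 + 8 * eps) * x + eps] beyond [x] are
    [11 * eps * x + 24 * eps^2 * x + eps], less than [7 * eps]. *)
Definition accuracy_of : R := Num.min 100^-1 ((2^-1 - 2 / a) / 7).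

(** [s_large] asks for [64 * n * l <= 2^s * eps / 8]; [2^(2 * l)] takes care of [n * l], and
    [512 = 64 * 8]. *)
Definition extra_steps : nat := nat_above (512 / eps).
(** With tolerance [eps / 4] the exponent is [N * eps^2 / 64], here at least
    [(8 + extra_steps) * l]; the second part pays for the extra bisection steps. *)
Definition search_factor : nat := nat_above (64 * (8 + extra_steps%:R) / eps ^+ 2).
(** 128, and [16 * a] below, make the exponents [K * eps^2 / (16 * rho)] and
    [K * eps^2 / (2 * a * rho)] at least 8 times [lsize] and [lsize + lgamma]. *)
Definition find_factor : nat := nat_above (128 / eps ^+ 2).
Definition finish_factor : nat := nat_above (16 * a / eps ^+ 2).

Variables (st : setting) (n : nat) (bmin bmax gamma : R).

Definition lsize : nat := log2_up n.+2.
Definition lgamma : nat := nat_above (ln gamma^-1).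
Definition rsize : nat := nat_above (rho st n).

Definition schedule_tree : tree R n (seq (segment R)) :=
  retry (attempt bmin bmax a (rho st n) eps lsize (2 * lsize + extra_steps) (search_factor * lsize)
           (find_factor * rsize * lsize) (finish_factor * rsize * (lsize + lgamma)))
        (fallback bmin bmax) (2 * lgamma + 1).

Definition schedule_proc : procedure n bmin bmax :=
  match pselect (bmin <= bmax) with
  | left h => embed h schedule_tree
  | right _ => Return n bmin bmax [::]
  end.

Hypothesis a_gt4 : 4 < a.
Hypothesis eps01 : 0 < eps <= 100^-1.
Hypothesis n_ge2 : (2 <= n)%N.
Hypothesis bmm : bmin < bmax.
Hypothesis gamma01 : 0 < gamma < 1.

Lemma lsize_ge3 : (3 <= lsize)%N.
Proof.
have := ltn_log2_up n.+2; rewrite -/lsize; case: lsize => [|[|[|]]] //; move: n_ge2; clear; lia.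
Qed.

Lemma n_lt_lsize : (n.+2 < 2 ^ lsize)%N.
Proof. exact: ltn_log2_up. Qed.

Lemma ln_n_ge : 2^-1 <= ln n%:R :> R.
Proof.
by apply: le_trans ln2_ge_half _; rewrite ler_ln ?posrE ?ltr0n ?ler_nat // (leq_trans _ n_ge2).
Qed.

Lemma lsize_le : lsize%:R <= 6 * ln n%:R :> R.
Proof.
have h := ln_n_ge; apply: (le_trans (log2_up_le _)) => //.
have n0 : 0 < n%:R :> R by rewrite ltr0n (leq_trans _ n_ge2).
have : ln n.+2%:R <= ln (2 * n%:R) :> R.
  by rewrite ler_ln ?posrE ?ltr0n ?mulr_gt0 // -natrM ler_nat; move: n_ge2; clear; lia.
have : ln 2 <= ln n%:R :> R by rewrite ler_ln ?posrE ?ler_nat.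
rewrite lnM ?posrE //; lra.
Qed.

Lemma ln_gamma_ge0 : 0 <= ln gamma^-1.
Proof. by have /andP[g0 g1] := gamma01; rewrite ln_ge0 // invf_ge1 // ltW. Qed.

Lemma lgamma_le : lgamma%:R <= ln gamma^-1 + 1.
Proof. exact/nat_above_le/ln_gamma_ge0. Qed.

Lemma expR_lgamma : expR (- lgamma%:R) <= gamma.
Proof.
have /andP[g0 g1] := gamma01.
rewrite -[leRHS](lnK (_ : gamma \is Num.pos)) ?posrE // ler_expR lerNl -lnV ?posrE //.
exact: nat_above_ge.
Qed.

Lemma rsize_le : rsize%:R <= 2 * rho st n :> R.
Proof.
have h := rho_ge1 st n; rewrite /rsize; apply: le_trans (nat_above_le (le_trans ler01 h)) _; lra.
Qed.

Lemma K1_large : 128 * lsize%:R * rho st n <= (find_factor * rsize * lsize)%:R * eps ^+ 2.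
Proof.
have /andP[e0 _] := eps01; have e2 : 0 < eps ^+ 2 by rewrite exprn_gt0.
have h1 := nat_above_ge (128 / eps ^+ 2); rewrite ler_pdivrMr // -/find_factor in h1.
have h2 := nat_above_ge (rho st n); rewrite -/rsize in h2.
have r1 : 0 <= rho st n :> R := le_trans ler01 (rho_ge1 st n).
rewrite !natrM; have : 128 * rho st n <= find_factor%:R * eps ^+ 2 * rsize%:R by apply: ler_pM.
move=> /(ler_wpM2r (ler0n _ lsize)); lra.
Qed.

Lemma K2_large : 16 * (lsize + lgamma)%:R * a * rho st n <=
  (finish_factor * rsize * (lsize + lgamma))%:R * eps ^+ 2.
Proof.
have /andP[e0 _] := eps01; have e2 : 0 < eps ^+ 2 by rewrite exprn_gt0.
have h1 := nat_above_ge (16 * a / eps ^+ 2); rewrite ler_pdivrMr // -/finish_factor in h1.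
have h2 := nat_above_ge (rho st n); rewrite -/rsize in h2.
have r1 : 0 <= rho st n :> R := le_trans ler01 (rho_ge1 st n).
have a0 : 0 < a by apply: lt_trans a_gt4.
rewrite !natrM; have : 16 * a * rho st n <= finish_factor%:R * eps ^+ 2 * rsize%:R.
  by apply: ler_pM => //; rewrite mulr_ge0 // ltW.
move=> /(ler_wpM2r (ler0n _ (lsize + lgamma))); lra.
Qed.

Lemma s_large : n%:R * (64 * lsize%:R) <= 2 ^+ (2 * lsize + extra_steps) * (eps / 4 / 2).
Proof.
have /andP[e0 _] := eps01.
have h1 := nat_above_ge (512 / eps); rewrite ler_pdivrMr // -/extra_steps in h1.
have h2 : extra_steps%:R <= 2 ^+ extra_steps :> R by rewrite -natrX ler_nat ltnW // ltn_expl.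
have h3 : n%:R <= 2 ^+ lsize :> R.
  by rewrite -natrX ler_nat; have := n_lt_lsize; clear; lia.
have h4 : lsize%:R <= 2 ^+ lsize :> R by rewrite -natrX ler_nat ltnW // ltn_expl.
rewrite mul2n -addnn !exprD.
have h5 : n%:R * lsize%:R <= 2 ^+ lsize * 2 ^+ lsize :> R by apply: ler_pM.
have h6 : 512 <= 2 ^+ extra_steps * eps by apply: le_trans h1 _; rewrite ler_wpM2r // ltW.
have p5 : 0 <= n%:R * lsize%:R :> R by rewrite mulr_ge0 ?ler0n.
have : n%:R * lsize%:R * 512 <= (2 ^+ lsize * 2 ^+ lsize) * (2 ^+ extra_steps * eps).
  by apply: ler_pM; [exact: p5|exact: ler0n|exact: h5|exact: h6].
move: {h1 h2 h3 h4 h5 h6 p5} (2 ^+ lsize * 2 ^+ lsize) (2 ^+ extra_steps) n%:R lsize%:R => x y z t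
  h; lra.
Qed.

Lemma sample_sizes_gt0 : [/\ (0 < search_factor * lsize)%N, (0 < find_factor * rsize * lsize)%N &
  (0 < finish_factor * rsize * (lsize + lgamma))%N].
Proof. by have := lsize_ge3; rewrite /search_factor /find_factor /finish_factor /rsize /nat_above;
  case: lsize. Qed.

Local Notation E := (expR (- (8 * lsize%:R)) : R).
Local Notation P := (2 ^+ lsize : R).

Lemma E3_le : P ^+ 3 * E <= 72^-1.
Proof. exact/decay_bound/lsize_ge3. Qed.

Lemma P_ge8 : 8 <= P.
Proof.
have -> : 8 = 2 ^+ 3 :> R by rewrite !exprS expr0; lra.
by rewrite ler_weXn2l ?ler1n // lsize_ge3.
Qed.

Lemma nP : n.+2%:R <= P.
Proof. by rewrite -natrX ler_nat ltnW // n_lt_lsize. Qed.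

(** In the exponent the part [lsize] pays for the union bound and the part [lgamma] supplies the
    factor [gamma]. *)
Lemma finish_failure_small : (2 * n + 4)%:R * failure_bound (n := n) (lsize + lgamma) <= gamma / 4.
Proof.
have p8 := P_ge8; have np := nP; have e3 := E3_le; have /andP[g0 g1] := gamma01.
have E0 : 0 < E by rewrite expR_gt0.
have h : expR (- (8 * (lsize + lgamma)%:R)) <= E * gamma.
  have -> : - (8 * (lsize + lgamma)%:R) = - (8 * lsize%:R) + - (8 * lgamma%:R) :> R.
    by rewrite natrD; ring.
  rewrite expRD ler_pM2l //; apply: le_trans expR_lgamma; rewrite ler_expR lerN2.
  by rewrite ler_peMl // ler1n.
rewrite /failure_bound; have n1 : n.+1%:R <= P by apply: le_trans np; rewrite ler_nat.
have n2 : (2 * n + 4)%:R <= 2 * P.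
  apply: le_trans (_ : 2 * n.+2%:R <= _); last by rewrite ler_pM2l.
  by rewrite -natrM ler_nat; clear; lia.
apply: (@le_trans _ _ ((2 * P) * (P * (2 * (E * gamma))))).
  have q1 : 0 <= 2 * expR (- (8 * (lsize + lgamma)%:R)) :> R by rewrite mulr_ge0 // expR_ge0.
  apply: ler_pM; [exact: ler0n|by rewrite mulr_ge0|exact: n2|].
  by apply: ler_pM; [exact: ler0n|exact: q1|exact: n1|rewrite ler_pM2l].
have : P ^+ 2 * E * gamma <= P ^+ 3 * E * gamma.
  rewrite ler_pM2r // ler_pM2r // ler_weXn2l //; lra.
have : P ^+ 3 * E * gamma <= 72^-1 * gamma by rewrite ler_pM2r.
rewrite !expr2; lra.
Qed.

(** As [2 ^ lsize] exceeds [n.+2], every contribution before certification reduces to a multiple of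
    [P ^+ 3 * E]. *)
Lemma attempt_failure_small :
  n%:R * (4 * E + (2 * lsize + extra_steps).+1%:R *
     (2 * expR (- ((search_factor * lsize)%:R * (eps / 4) ^+ 2 / 4)))) +
  ((P + 1) * failure_bound (n := n) lsize + (2 * n + 4)%:R * failure_bound (n := n) (lsize +
    lgamma)) <= 2^-1.
Proof.
have p8 := P_ge8; have np := nP; have e3 := E3_le; have /andP[g0 g1] := gamma01.
have E0 : 0 < E by rewrite expR_gt0.
have /andP[e0 _] := eps01; have e2 : 0 < eps ^+ 2 by rewrite exprn_gt0.
have n1 : n.+1%:R <= P by apply: le_trans np; rewrite ler_nat.
have n0 : n%:R <= P by apply: le_trans np; rewrite ler_nat; clear; lia.
have c3p : 0 < 2 ^+ extra_steps :> R by rewrite exprn_gt0.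
have l1 : 1 <= lsize%:R :> R by rewrite ler1n (leq_trans _ lsize_ge3).
have h1 : expR (- ((search_factor * lsize)%:R * (eps / 4) ^+ 2 / 4)) <= E * (2 ^+ extra_steps)^-1.
  have h := nat_above_ge (64 * (8 + extra_steps%:R) / eps ^+ 2).
  rewrite ler_pdivrMr // -/search_factor in h.
  have -> : (2 ^+ extra_steps)^-1 = expR (- (ln 2 * extra_steps%:R)) :> R.
    by rewrite expRN expRM_natr lnK // posrE.
  rewrite -expRD ler_expR -opprD lerN2.
  have -> : (search_factor * lsize)%:R * (eps / 4) ^+ 2 / 4 = search_factor%:R * eps ^+ 2 *
    lsize%:R / 64.
    by rewrite natrM !expr2; field.
  have hl := ler_wpM2r (ler0n R lsize) h.
  have c0 : 0 <= extra_steps%:R :> R by [].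
  have h2 : ln 2 * extra_steps%:R <= extra_steps%:R :> R by rewrite ler_piMl // ln2_le1.
  have h3 : extra_steps%:R <= extra_steps%:R * lsize%:R :> R by rewrite ler_peMr.
  lra.
have h2 : (2 * lsize + extra_steps).+1%:R <= P ^+ 2 * 2 ^+ extra_steps :> R.
  rewrite -exprM [(lsize * 2)%N]mulnC -!natrX -natrM ler_nat.
  apply: leq_trans (leq_mul (ltn_expl (2 * lsize) (isT : 1 < 2)%N) (ltn_expl extra_steps (isT : 1 <
    2)%N)).
  by rewrite mulSn mulnS; clear; lia.
have h3 : (2 * lsize + extra_steps).+1%:R * (2 * expR (- ((search_factor * lsize)%:R * (eps / 4) ^+
  2 / 4))) <=
    2 * (P ^+ 2 * E).
  apply: le_trans (_ : (P ^+ 2 * 2 ^+ extra_steps) * (2 * (E * (2 ^+ extra_steps)^-1)) <= _).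
    by apply: ler_pM => //; rewrite ?mulr_ge0 ?expR_ge0 // ler_pM2l.
  by rewrite le_eqVlt; apply/orP; left; apply/eqP; field; rewrite gt_eqF.
have PE2 : P ^+ 2 * E <= P ^+ 3 * E by rewrite ler_pM2r // ler_weXn2l //; lra.
have PE1 : 8 * (P * E) <= P ^+ 2 * E.
  by rewrite mulrA ler_pM2r // expr2 ler_pM2r //; lra.
have EE : 8 * (8 * E) <= P ^+ 2 * E.
  by rewrite mulrA ler_pM2r // expr2 ler_pM //.
have t1 : n%:R * (4 * E + (2 * lsize + extra_steps).+1%:R *
     (2 * expR (- ((search_factor * lsize)%:R * (eps / 4) ^+ 2 / 4)))) <= P * (3 * (P ^+ 2 * E)).
  apply: ler_pM; [exact: ler0n| |exact: n0|lra].
  by rewrite addr_ge0 ?mulr_ge0 ?expR_ge0 ?ler0n.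
have t2 : (P + 1) * failure_bound (n := n) lsize <= 4 * (P ^+ 2 * E).
  apply: le_trans (_ : (2 * P) * (P * (2 * E)) <= _); last by rewrite expr2; lra.
  apply: ler_pM; [lra|exact: failure_bound_ge0|lra|].
  apply: ler_pM; [exact: ler0n| |exact: n1|exact: lexx].
  by rewrite mulr_ge0 ?expR_ge0.
have t3 := finish_failure_small.
have PE3 : P * (P ^+ 2 * E) = P ^+ 3 * E by rewrite mulrA -exprS.
have : 8 * (P ^+ 2 * E) <= P ^+ 3 * E by rewrite -PE3 ler_pM2r // mulr_gt0 // exprn_gt0; lra.
lra.
Qed.

(** Since [2 * ln 2 >= 1], the first [2 * lgamma] attempts bring the chance of no output below
    [gamma]; one more attempt halves it. *)
Lemma retry_failure_small : 2 * (gamma / 4) + 2^-1 ^+ (2 * lgamma + 1) <= gamma.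
Proof.
have h : 2^-1 ^+ (2 * lgamma) <= gamma.
  apply: le_trans expR_lgamma.
  have -> : 2^-1 ^+ (2 * lgamma) = expR (- (ln 2 * (2 * lgamma)%:R)) :> R.
    by rewrite expRN expRM_natr lnK ?posrE // exprVn.
  rewrite ler_expR lerN2 natrM.
  have : 0 <= (ln 2 - 2^-1) * lgamma%:R :> R by rewrite mulr_ge0 ?subr_ge0 ?ln2_ge_half.
  lra.
rewrite exprD expr1; move: (2^-1 ^+ _) h => x h; lra.
Qed.

(** Everything is compared with [Z = n * rho * (ln n ^ 2 + ln (1 / gamma))] through
    [lsize <= 6 * ln n], the source of the factors 36. As [ln n >= 1 / 2], lower-order terms are
    absorbed as well. *)
Lemma attempt_cost_le (lq : R) : 0 <= lq ->
  n%:R * (35 + 10 * lq + (search_factor * lsize)%:R * (2 * lsize + extra_steps).+1%:R) +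
  ((find_factor * rsize * lsize * (2 * n.+2 + lsize * (4 * n.+2)))%:R +
   (finish_factor * rsize * (lsize + lgamma) * (2 * n.+1))%:R) <=
  (150 + 36 * search_factor%:R * (extra_steps%:R + 3) + 864 * find_factor%:R + 128 *
    finish_factor%:R) *
  (n%:R * rho st n * (ln n%:R ^+ 2 + ln gamma^-1) + n%:R * lq).
Proof.
move=> lq0; have r1 := rho_ge1 st n; have rs := rsize_le; have ll := lsize_le.
have lg := lgamma_le; have X2 := ln_n_ge; have Y0 := ln_gamma_ge0.
have l1 : 1 <= lsize%:R :> R by rewrite ler1n (leq_trans _ lsize_ge3).
set X := ln n%:R in ll X2 *; set Y := ln gamma^-1 in lg Y0 *.
set r := rho st n in r1 rs *; set l : R := lsize%:R in ll l1 *.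
set c1 : R := search_factor%:R; set c2 : R := find_factor%:R; set c3 : R := extra_steps%:R;
  set c4 : R := finish_factor%:R.
have [c10 c20 c30 c40] : [/\ 0 <= c1, 0 <= c2, 0 <= c3 & 0 <= c4] by [].
have n2 : 2 <= n%:R :> R by rewrite ler_nat.
have lX : l ^+ 2 <= 36 * X ^+ 2.
  have -> : 36 * X ^+ 2 = (6 * X) ^+ 2 by rewrite exprMn; congr (_ * _); rewrite expr2; ring.
  by rewrite lerXn2r // nnegrE; lra.
have X4 : 1 <= 4 * X ^+ 2.
  have : 2^-1 * 2^-1 <= X * X by apply: ler_pM.
  rewrite expr2; lra.
have XX : X <= 2 * X ^+ 2.
  have : 2^-1 * X <= X * X by rewrite ler_pM2r; lra.
  rewrite expr2; lra.
set Z := n%:R * r * (X ^+ 2 + Y).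
have nr : n%:R <= n%:R * r by rewrite ler_peMr.
have nX : n%:R * X ^+ 2 <= Z.
  apply: ler_pM => //; rewrite ?sqr_ge0 //; lra.
have nl : n%:R * l ^+ 2 <= 36 * Z.
  apply: le_trans (_ : n%:R * (36 * X ^+ 2) <= _); first by rewrite ler_wpM2l.
  rewrite mulrCA; lra.
have n1 : n%:R <= 4 * Z.
  apply: le_trans (_ : n%:R * (4 * X ^+ 2) <= _); first by rewrite ler_peMr.
  rewrite mulrCA; lra.
have rnl : n%:R * r * l ^+ 2 <= 36 * Z.
  rewrite (_ : 36 * Z = n%:R * r * (36 * (X ^+ 2 + Y))); last by rewrite /Z; ring.
  by apply: ler_wpM2l; [apply: mulr_ge0 => //|]; lra.
have rnL : n%:R * r * (l + (Y + 1)) <= 16 * Z.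
  rewrite (_ : 16 * Z = n%:R * r * (16 * (X ^+ 2 + Y))); last by rewrite /Z; ring.
  by apply: ler_wpM2l; [apply: mulr_ge0 => //|]; lra.
have Z0 : 0 <= Z by lra.
have q0 : 0 <= n%:R * lq by rewrite mulr_ge0.
have t1 : n%:R * ((search_factor * lsize)%:R * (2 * lsize + extra_steps).+1%:R) <= 36 * c1 * (c3 +
  3) * Z.
  have h : (2 * lsize + extra_steps).+1%:R <= (c3 + 3) * l.
    rewrite -natr1 natrD natrM -/l -/c3.
    have : 0 <= c3 * (l - 1) by rewrite mulr_ge0 // subr_ge0.
    lra.
  rewrite natrM -/c1 -/l.
  apply: le_trans (_ : n%:R * (c1 * l * ((c3 + 3) * l)) <= _).
    by rewrite ler_wpM2l // ler_wpM2l // mulr_ge0 //; lra.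
  have -> : n%:R * (c1 * l * ((c3 + 3) * l)) = c1 * (c3 + 3) * (n%:R * l ^+ 2).
    by rewrite expr2; ring.
  have : c1 * (c3 + 3) * (n%:R * l ^+ 2) <= c1 * (c3 + 3) * (36 * Z).
    by rewrite ler_wpM2l // mulr_ge0 //; lra.
  lra.
have t2 : (find_factor * rsize * lsize * (2 * n.+2 + lsize * (4 * n.+2)))%:R <= 864 * c2 * Z.
  have h : (2 * n.+2 + lsize * (4 * n.+2))%:R <= 12 * l * n%:R.
    apply: (@le_trans _ _ (12 * lsize * n)%:R); last by rewrite !natrM.
    rewrite ler_nat; have := lsize_ge3; move: n_ge2; clear; move: lsize => m; nia.
  rewrite !natrM -/c2 -/l.
  apply: le_trans (_ : c2 * (2 * r) * l * (12 * l * n%:R) <= _).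
    apply: ler_pM => //; first by rewrite !mulr_ge0 //; lra.
    by rewrite ler_wpM2r ?ler_wpM2l //; lra.
  have -> : c2 * (2 * r) * l * (12 * l * n%:R) = 24 * c2 * (n%:R * r * l ^+ 2).
    by rewrite expr2; ring.
  have : 24 * c2 * (n%:R * r * l ^+ 2) <= 24 * c2 * (36 * Z).
    by rewrite ler_wpM2l // mulr_ge0.
  lra.
have t3 : (finish_factor * rsize * (lsize + lgamma) * (2 * n.+1))%:R <= 128 * c4 * Z.
  have h : (2 * n.+1)%:R <= 4 * n%:R :> R.
    by rewrite -natrM ler_nat; move: n_ge2; clear; lia.
  rewrite [(finish_factor * _ * _ * _)%:R]natrM [(finish_factor * _ * _)%:R]natrM [(finish_factor *
    _)%:R]natrM natrD -/c4 -/l.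
  apply: le_trans (_ : c4 * (2 * r) * (l + (Y + 1)) * (4 * n%:R) <= _).
    have p1 : 0 <= c4 * rsize%:R by rewrite mulr_ge0 ?ler0n.
    have p2 : 0 <= l + lgamma%:R by rewrite addr_ge0 ?ler0n.
    have p3 : c4 * rsize%:R <= c4 * (2 * r) by rewrite ler_wpM2l.
    apply: ler_pM; [exact: mulr_ge0 p1 p2|exact: ler0n| |exact: h].
    by apply: ler_pM; [exact: p1|exact: p2|exact: p3|lra].
  have -> : c4 * (2 * r) * (l + (Y + 1)) * (4 * n%:R) =
     8 * c4 * (n%:R * r * (l + (Y + 1))) by ring.
  have : 8 * c4 * (n%:R * r * (l + (Y + 1))) <= 8 * c4 * (16 * Z).
    by rewrite ler_wpM2l // mulr_ge0.
  lra.
have u0 : 0 <= 36 * c1 * (c3 + 3) by rewrite !mulr_ge0 //; lra.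
have v0 : 0 <= 864 * c2 by exact: mulr_ge0 (ler0n _ _) c20.
have w0 : 0 <= 128 * c4 by exact: mulr_ge0 (ler0n _ _) c40.
move: (36 * c1 * (c3 + 3)) (864 * c2) (128 * c4) u0 v0 w0 t1 t2 t3 => u v w u0 v0 w0 t1 t2 t3.
have aux (m x y : R) : m * (35 + 10 * x + y) = 35 * m + 10 * (m * x) + m * y by ring.
rewrite aux.
set A := (search_factor * lsize)%:R * _ in t1 *; set B := (find_factor * _ * _ * _)%:R in t2 *.
set D := (finish_factor * _ * _ * _)%:R in t3 *.
move: (n%:R * A) B D (n%:R * lq) q0 t1 t2 t3 => {}A {}B {}D N N0 t1 t2 t3.
have := mulr_ge0 u0 N0; have := mulr_ge0 v0 N0; have := mulr_ge0 w0 N0.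
by clear nX nl rnl rnL nr; clearbody Z; lra.
Qed.

End SampleSizes.

Theorem theorem28 (R : realType) (a : R) (ha : 4 < a) :
  exists (C : R)
         (proc : forall (st : setting) (n : nat) (bmin bmax gamma : R),
                   procedure n bmin bmax),
  forall (st : setting) (n : nat) (bmin bmax gamma : R) (c : 'I_n.+1 -> R),
    (2 <= n)%N -> bmin < bmax -> 0 < gamma < 1 ->
    is_instance c -> in_setting st c ->
    let p := proc st n bmin bmax gamma in
    let q := Num.max 1 (log_ratio c bmin bmax) in
    [/\ output_prob c p
          [set sch | covering_schedule n bmin bmax sch
                   /\ InvWeight sch <= a * n.+1%:R * rho st n] = 1%E,
        ((1 - gamma)%:E <= output_prob c p [set sch | proper_segments c sch])%E &
        (expected_calls c p <=
           (C * (n%:R * rho st n * (ln n%:R ^+ 2 + ln gamma^-1)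
                 + n%:R * ln q))%:E)%E].
Proof.
have a0 : 0 < a by lra.
have ainv : 0 < 2 / a < 2^-1.
  by rewrite divr_gt0 //= ltr_pdivrMr //; lra.
pose eps := accuracy_of a.
have eps01 : 0 < eps <= 100^-1.
  by rewrite /eps /accuracy_of lt_min ge_min lexx /= andbT; lra.
have eps7 : 7 * eps <= 2^-1 - 2 / a.
  have : eps <= (2^-1 - 2 / a) / 7 by rewrite /eps /accuracy_of ge_min lexx orbT.
  lra.
have eps_a : (1 + 3 * eps) * (2 / a) * slack eps <= 2^-1 - eps.
  have /andP[e0 e1] := eps01; move: ainv eps7; rewrite /slack.
  move: (2 / a) => x /andP[x0 x1] eps7.
  have h1 : eps * eps <= 100^-1 * eps by rewrite ler_pM2r.
  have h2 : eps * x <= eps * 2^-1 by rewrite ler_pM2l // ltW.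
  have h3 : eps * eps * x <= 100^-1 * eps * x by rewrite ler_pM2r.
  lra.
(* The leading 2 is the price of repeating attempts until one succeeds. *)
exists (2 * (150 + 36 * (search_factor eps)%:R * ((extra_steps eps)%:R + 3) + 864 * (find_factor
  eps)%:R + 128 * (finish_factor a eps)%:R)).
exists (fun st n bmin bmax gamma => schedule_proc a eps st n bmin bmax gamma).
move=> st n bmin bmax gamma c n2 bmm g01 c_inst c_st p q.
rewrite {}/p /schedule_proc; case: pselect => [bb|]; last by rewrite (ltW bmm).
have r1 := rho_ge1 (R := R) st n.
have l3 := lsize_ge3 n2.
have l0 : (0 < lsize n)%N by exact: leq_trans l3.
have [N0 K10 K20] := sample_sizes_gt0 a eps st gamma n2.
have sb : side_bound c (rho st n).
  case: (st) c_st => [_|lc]; first exact: general_side_bound.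
  exact: log_concave_side_bound.
have K1l := K1_large st n eps01.
have K2l := K2_large st n gamma ha eps01.
have none : err (ker c bmin bmax) (attempt bmin bmax a (rho st n) eps (lsize n)
    (2 * lsize n + extra_steps eps) (search_factor eps * lsize n) (find_factor eps * @rsize R st n
      * lsize n)
    (finish_factor a eps * @rsize R st n * (lsize n + lgamma gamma))) (fun o => o <> None) <= 2^-1.
  apply: le_trans (attempt_failure_small eps01 n2 g01).
  apply: (err_attempt_none bmm ha r1 eps01 l0 (n_lt_lsize n) K10 K1l c_inst eps_a K20 K2l sb N0).
  exact: s_large.
split.
- apply: output_prob_embed1 => //; apply: sure_retry; last exact: fallback_ok.
  exact: (sure_attempt _ _ _ bmm ha r1 eps01 (n_lt_lsize n) K10 K1l).
- apply: le_trans (output_prob_embed_ge bb c_inst _ _).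
  rewrite lee_fin lerD2l lerN2; apply: le_trans (retry_failure_small g01).
  apply: err_retry none; [exact: ker_ge0|exact: ker_sum1|].
  apply: le_trans (finish_failure_small n2 g01).
  exact: (err_attempt_proper _ _ bmm ha r1 eps01 (n_lt_lsize n) K10 K1l c_inst eps_a K20 K2l).
apply: (le_trans (expected_calls_embed bb c_inst _)); rewrite lee_fin -mulrA.
apply: cost_retry none; first exact: ker_ge0.
apply: le_trans (attempt_cost_le a eps st n2 g01 (lq := ln q) _).
  exact: (cost_attempt _ _ _ _ bmm r1 eps01 l0 (n_lt_lsize n) K10 K1l c_inst).
by rewrite ln_ge0 // le_max lexx.
Qed.
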